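(* Let $k\ge 2$ and $\ell$ be fixed integers with $\ell\le k\le 2\ell$, and let $n\to\infty$ range over multiples of $\ell$. Let $p=p(n)\in(0,1]$ satisfy $np/\log^2 n\to\infty$. Then with high probability the random hypergraph $H=H(n,p,k)$ contains a collection of at least $(1-\epsilon)\binom{n}{k}p/\nu_\ell$ pairwise edge-disjoint type $\ell$ Hamilton cycles, where $\nu_\ell=n/\ell$ and $\epsilon=O\big((\log n/(np)^{1/2})^{1/2}\big)=o(1)$.
   Context: $H(n,p,k)$ is the random $k$-uniform hypergraph on vertex set $[n]=\{1,\dots,n\}$ in which each $k$-subset of $[n]$ is an edge independently with probability $p$. ''With high probability'' means with probability tending to $1$ as $n\to\infty$. For $1\le \ell\le k$ and $\ell\mid n$, a type $\ell$ Hamilton cycle in a $k$-uniform hypergraph $H$ on $n$ vertices is a collection of $\nu_\ell=n/\ell$ edges $E_1,\dots,E_{\nu_\ell}$ of $H$ such that for some cyclic ordering of the vertex set every edge consists of $k$ consecutive vertices and for every pair of consecutive edges $E_{i-1},E_i$ (indices mod $\nu_\ell$) we have $|E_{i-1}\setminus E_i|=\ell$; thus the sets $E_i\setminus E_{i-1}$ partition the vertex set into sets of size $\ell$. For $\ell=k$ a type $k$ Hamilton cycle is a perfect matching. *)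

(* Defs.v *)
From HB Require Import structures.
From Stdlib Require Import Reals ClassicalEpsilon.
From mathcomp Require Import all_boot fingroup perm.

Set Implicit Arguments.
Unset Strict Implicit.
Unset Printing Implicit Defensive.

(* The i-th edge of a type-l Hamilton cycle w.r.t. the cyclic ordering in which
   vertex v sits at position (s v) : it consists of the k cyclically consecutive
   vertices at positions i*l, i*l+1, ..., i*l+k-1 (mod n). *)
Definition ham_edge (n k l : nat) (s : {perm 'I_n}) (i : nat) : {set 'I_n} :=
  [set v : 'I_n | has (fun j => (i * l + j) %% n == (s v : nat)) (iota 0 k)].

Definition is_ham_cycle (n k l : nat) (C : {set {set 'I_n}}) : bool :=
  [exists s : {perm 'I_n},
     (C == [set ham_edge k l s i | i : 'I_(n %/ l)]) && (#|C| == n %/ l)].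

Definition kgraph (n k : nat) (H : {set {set 'I_n}}) : bool :=
  [forall e in H, #|e| == k].

Definition hyp_weight (n k : nat) (p : R) (H : {set {set 'I_n}}) : R :=
  Rmult (pow p #|H|) (pow (Rminus 1 p) ('C(n, k) - #|H|)).

Definition prob_H (n k : nat) (p : R) (E : {set {set 'I_n}} -> Prop) : R :=
  \big[Rplus/R0]_(H : {set {set 'I_n}} | kgraph k H)
     (if excluded_middle_informative (E H) then hyp_weight k p H else R0).

Definition has_disjoint_ham_cycles (n k l : nat) (b : R) (H : {set {set 'I_n}}) : Prop :=
  exists F : {set {set {set 'I_n}}},
    (forall C, C \in F -> is_ham_cycle k l C && (C \subset H)) /\
    (forall C D, C \in F -> D \in F -> C != D -> [disjoint C & D]) /\
    Rle b (INR #|F|).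

(* Main.v *)
(** A "structure" is a weighted family of k-sets of vertices ("slots") on which
    disjoint Hamilton cycles can be found in a sparse random subset. Superpose m
    independently and randomly relabelled copies of it: by a Chernoff bound every
    k-set is covered almost equally often, so an edge of H can be assigned at
    random to one of the copies containing it in such a way that each copy
    receives a random subset of its slots. It is thus enough to pack cycles in
    one copy, with failure probability n^-(k+2).

    If k < 2l, the vertices are cut into n/l blocks of l consecutive ones; the
    last vertex of a block lies in a single edge of the cycle, and matching these
    edges to these vertices arbitrarily still yields a Hamilton cycle. A random
    bipartite graph splits almost entirely into perfect matchings.

    If k = 2l, an edge is a pair of blocks, so that Hamilton cycles of an
    ordinary graph on n/l vertices are wanted. Random matchings between three
    layers of vertices compose to permutations with few cycles, and these are
    merged into one Hamilton cycle by Posa rotations with a few sprinkled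
    edges. *)
Require Import Defs.
From HB Require Import structures.
From Stdlib Require Import Reals ClassicalEpsilon.
From mathcomp Require Import all_boot all_order all_algebra fingroup perm.
From mathcomp Require Import boolp Rstruct ring lra zify.

Set Implicit Arguments.
Unset Strict Implicit.
Unset Printing Implicit Defensive.

Import Order.TTheory GRing.Theory Num.Theory.

Bind Scope ring_scope with R.
Arguments exp x%_ring_scope.
Arguments ln x%_ring_scope.

(** * Product measures *)

(** The exponent in epsilon balances two Chernoff bounds: [e] satisfies e^4 n p = log^2 n. Covering
    the k-sets within a factor 1 + 4e needs mean coverage of order log n / e^2, which leaves one
    copy a density q0 of order p e^2 / log n. Packing one copy with loss O(e) needs n q0 of order
    log n / e^2, and this e meets both. All losses are multiples of e and go into the constant; once
    the constant times e reaches 1 the claim is void, so e may be taken small. The number of copies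
    can be of order n^(k+1), hence the failure probability n^-(k+2) demanded of each.

    For k = 2l the obstacle is that matchings come from an existence proof, so their distribution is
    unknown. A symmetry supplies the randomness: permuting one layer as seen from one neighbouring
    layer preserves the law of the graph and multiplies every composed permutation by the same
    permutation, over which one averages. The sprinkled edges are not exposed in stages; failure is
    bounded by a union over all histories. *)

Section ExpFacts.
Local Open Scope ring_scope.

Lemma expRM (x y : R) : exp x * exp y = exp (x + y).
Proof. exact: expRD. Qed.

Lemma exp0 : exp 0 = 1.
Proof. exact: exp_0. Qed.

Lemma exp_gt0 (x : R) : 0 < exp x.
Proof. by apply/RltP; exact: exp_pos. Qed.

Lemma exp_ge0 (x : R) : 0 <= exp x.
Proof. by apply: ltW; apply: exp_gt0. Qed.

Lemma exp_ge1D (x : R) : 1 + x <= exp x.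
Proof. by apply/RleP; exact: exp_ineq1_le. Qed.

Lemma exp_mono (x y : R) : x <= y -> exp x <= exp y.
Proof.
rewrite le_eqVlt => /orP[/eqP->//|/RltP xy].
by apply/ltW/RltP; exact: exp_increasing.
Qed.

Lemma exp_inv (x : R) : exp x * exp (- x) = 1.
Proof. by rewrite expRM subrr exp0. Qed.

Lemma expN_le (a : R) : 0 <= a -> exp (- a) <= 1 - a + a ^+ 2.
Proof.
move=> a0; have h1 := exp_ge1D a; have h2 := exp_inv a; have h3 := exp_gt0 (- a).
have h4 : (1 + a) * exp (- a) <= 1 by rewrite -[leRHS]h2 ler_wpM2r ?exp_ge0.
have h5 : 0 <= a * exp (- a) by rewrite mulr_ge0 ?exp_ge0.
have h6 : (1 + a) * (1 - a + a ^+ 2) >= 1.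
  have : 0 <= a ^+ 3 by rewrite exprn_ge0.
  by nra.
have h7 : 0 < 1 + a by lra.
by rewrite -(ler_pM2l h7); apply: le_trans h6.
Qed.

Lemma exp_le_quad (a : R) : 0 <= a -> a <= 1 / 2 -> exp a <= 1 + a + 2 * a ^+ 2.
Proof.
move=> a0 a1; have h1 := exp_ge1D (- a); have h2 := exp_inv a.
have h3 := exp_gt0 a.
have h4 : (1 - a) * exp a <= 1 by rewrite -[leRHS]h2 [leRHS]mulrC ler_wpM2r ?exp_ge0.
have h6 : (1 - a) * (1 + a + 2 * a ^+ 2) >= 1 by rewrite !expr2; nra.
have h7 : 0 < 1 - a by lra.
by rewrite -(ler_pM2l h7); apply: le_trans h6.
Qed.

Lemma exp1_le3 : exp 1 <= 3.
Proof. by have /RleP := exp_le_3; rewrite IZRposE. Qed.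

Lemma exp_sum (I : finType) (P : pred I) (F : I -> R) :
  exp (\sum_(i | P i) F i) = \prod_(i | P i) exp (F i).
Proof.
apply: (big_morph (fun x : R => exp x)) => [x y|]; last exact: exp0.
by rewrite expRM.
Qed.

End ExpFacts.

Section ProductMeasure.
Local Open Scope ring_scope.

Definition Ex (I A : finType) (w : I -> A -> R) (F : {ffun I -> A} -> R) : R :=
  \sum_(f : {ffun I -> A}) (\prod_i w i (f i)) * F f.

Definition Pr (I A : finType) (w : I -> A -> R) (E : pred {ffun I -> A}) : R :=
  Ex w (fun f => (E f)%:R).

Definition prob_weight (I A : finType) (w : I -> A -> R) : Prop :=
  (forall i a, 0 <= w i a) /\ (forall i, \sum_a w i a = 1).

Variables (I A : finType) (w : I -> A -> R).
Implicit Types (F : {ffun I -> A} -> R) (E : pred {ffun I -> A}).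

Lemma Ex_prod (h : I -> A -> R) :
  Ex w (fun f => \prod_i h i (f i)) = \prod_i \sum_a w i a * h i a.
Proof.
rewrite bigA_distr_bigA; apply: eq_bigr => f _.
by rewrite big_split.
Qed.

Lemma eq_Ex F1 F2 : F1 =1 F2 -> Ex w F1 = Ex w F2.
Proof. by move=> e; apply: eq_bigr => f _; rewrite e. Qed.

Lemma ExZ c F : Ex w (fun f => c * F f) = c * Ex w F.
Proof. by rewrite mulr_sumr; apply: eq_bigr => f _; rewrite mulrCA. Qed.

Lemma Ex_sum (K : Type) (r : seq K) (P : pred K) (F : K -> {ffun I -> A} -> R) :
  Ex w (fun f => \sum_(k <- r | P k) F k f) = \sum_(k <- r | P k) Ex w (F k).
Proof.
rewrite /Ex exchange_big /=; apply: eq_bigr => f _.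
by rewrite mulr_sumr.
Qed.

Lemma ExD F1 F2 : Ex w (fun f => F1 f + F2 f) = Ex w F1 + Ex w F2.
Proof. by rewrite /Ex -big_split; apply: eq_bigr => f _; rewrite mulrDr. Qed.

Hypothesis ww : prob_weight w.

Lemma Ex_le F1 F2 : (forall f, F1 f <= F2 f) -> Ex w F1 <= Ex w F2.
Proof.
move=> le12; apply: ler_sum => f _; apply: ler_wpM2l => //.
by apply: prodr_ge0 => i _; apply: ww.1.
Qed.

Lemma Ex_cst c : Ex w (fun=> c) = c.
Proof.
transitivity (c * Ex w (fun f => \prod_(i : I) 1)).
  by rewrite -ExZ; apply: eq_Ex => f; rewrite big1_eq mulr1.
rewrite (Ex_prod (fun _ _ => 1)) big1 ?mulr1 // => i _.
by rewrite -[RHS](ww.2 i); apply: eq_bigr => a _; rewrite mulr1.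
Qed.

Lemma Pr_le E1 E2 : (forall f, E1 f -> E2 f) -> Pr w E1 <= Pr w E2.
Proof.
move=> sE; apply: Ex_le => f; rewrite ler_nat.
by case: (boolP (E1 f)) => // /sE ->.
Qed.

Lemma Pr_markov E F : (forall f, 0 <= F f) -> (forall f, E f -> 1 <= F f) ->
  Pr w E <= Ex w F.
Proof.
by move=> F0 F1; apply: Ex_le => f; case: (boolP (E f)) => [/F1|].
Qed.

Lemma PrC E : Pr w (fun f => ~~ E f) = 1 - Pr w E.
Proof.
apply: (@addIr _ (Pr w E)); rewrite subrK -[RHS](Ex_cst 1) -ExD.
by apply: eq_Ex => f; case: (E f); rewrite /= ?addr0 ?add0r.
Qed.

Lemma Pr_le1 E : Pr w E <= 1.
Proof. by rewrite -[leRHS](Ex_cst 1); apply: Ex_le => f; case: (E f). Qed.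

Lemma Pr_union (K : finType) (P : pred K) (E : K -> pred {ffun I -> A}) :
  Pr w (fun f => [exists k, P k && E k f]) <= \sum_(k | P k) Pr w (E k).
Proof.
rewrite -Ex_sum; apply: Ex_le => f; case: existsP => [[k /andP[Pk Ekf]]|_].
  rewrite (bigD1 k) //= Ekf lerDl; apply: sumr_ge0 => j _; exact: ler0n.
by apply: sumr_ge0 => k _; exact: ler0n.
Qed.

Lemma PrU E1 E2 : Pr w (fun f => E1 f || E2 f) <= Pr w E1 + Pr w E2.
Proof.
rewrite -ExD; apply: Ex_le => f.
by case: (E1 f); case: (E2 f); rewrite /= ?addr0 ?add0r // lerDl.
Qed.

Lemma Pr_lt1_ex E : Pr w E < 1 -> exists f, ~~ E f.
Proof.
move=> lt1; apply/existsP; apply: contraLR lt1 => /existsPn h.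
rewrite -leNgt -[leLHS](Ex_cst 1); apply: Ex_le => f.
by have := h f; rewrite negbK => ->.
Qed.

End ProductMeasure.

(** * Images of product measures *)

Section Pull.
Local Open Scope ring_scope.
Variables (I U A A' : finType) (w : I -> A -> R) (emb : U -> I) (phi : U -> A -> A').
Hypothesis ww : prob_weight w.
Hypothesis emb_inj : injective emb.

(** Coordinates read through an injection stay independent, so only the marginals must be compared.
    This gives the law of the hypergraph and of each copy from the edge labels, the law of a
    bipartite block from the graph, and invariance under relabelling. *)
Lemma Ex_pull (w' : U -> A' -> R) (F : {ffun U -> A'} -> R) :
  (forall u a', w' u a' = \sum_(a | phi u a == a') w (emb u) a) ->
  Ex w (fun f => F [ffun u => phi u (f (emb u))]) = Ex w' F.
Proof.
move=> w'E.
rewrite /Ex (partition_big (fun f : {ffun I -> A} => [ffun u => phi u (f (emb u))])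
  xpredT) //=.
apply: eq_bigr => f' _.
transitivity (\sum_(f : {ffun I -> A} | [ffun u => phi u (f (emb u))] == f')
   (\prod_i w i (f i)) * F f').
  by apply: eq_bigr => f /eqP e; rewrite [X in F X]e.
rewrite -mulr_suml; congr (_ * _).
pose Q i a := [forall u, (emb u == i) ==> (phi u a == f' u)].
transitivity (\sum_(f in family Q) \prod_i w i (f i)).
  apply: eq_bigl => f; apply/eqP/familyP => [e i|h].
    by apply/forallP => u; apply/implyP => /eqP <-; rewrite -e ffunE.
  apply/ffunP => u; rewrite ffunE; apply/eqP.
  by have /forallP/(_ u) := h (emb u); rewrite eqxx.
rewrite -bigA_distr_big_dep /=.
(* Coordinates outside the image are unconstrained and contribute total mass 1. *)
rewrite (bigID (mem (codom emb))) /= [X in _ * X]big1 ?mulr1; last first.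
  move=> i ni; rewrite -[RHS](ww.2 i); apply: eq_bigl => a.
  by apply/forallP => u; apply/implyP => /eqP ei; rewrite -ei codom_f in ni.
transitivity (\prod_(i in [set emb u | u : U]) \sum_(a | Q i a) w i a).
  by apply: eq_bigl => i; apply/codomP/imsetP => -[u]; exists u.
rewrite big_imset /=; last by move=> u v _ _; apply: emb_inj.
apply: eq_bigr => u _; rewrite w'E; apply: eq_bigl => a.
apply/forallP/eqP => [/(_ u)|e v]; first by rewrite eqxx => /eqP.
by apply/implyP => /eqP /emb_inj ->; rewrite e.
Qed.

End Pull.

Section PairBits.
Local Open Scope ring_scope.
Variables (I A1 A2 : finType) (w1 : I -> A1 -> R) (w2 : I -> A2 -> R).

Lemma Ex_pair (F : {ffun I -> A1} -> {ffun I -> A2} -> R) :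
  Ex (fun i (a : A1 * A2) => w1 i a.1 * w2 i a.2)
     (fun f => F [ffun i => (f i).1] [ffun i => (f i).2]) =
  Ex w1 (fun f1 => Ex w2 (F f1)).
Proof.
rewrite /Ex; under [RHS]eq_bigr do rewrite mulr_sumr.
rewrite pair_big /=.
rewrite (reindex (fun p : {ffun I -> A1} * {ffun I -> A2} =>
   [ffun i => (p.1 i, p.2 i)])) /=; last first.
  exists (fun f : {ffun I -> A1 * A2} => ([ffun i => (f i).1], [ffun i => (f i).2])).
    by move=> [f1 f2] _; congr pair; apply/ffunP => i; rewrite !ffunE.
  by move=> f _; apply/ffunP => i; rewrite !ffunE; case: (f i).
apply: eq_bigr => -[f1 f2] _ /=; rewrite mulrA -big_split /=; congr (_ * _).
  by apply: eq_bigr => i _; rewrite ffunE.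
by congr F; apply/ffunP => i; rewrite !ffunE.
Qed.

End PairBits.

(** * Random subsets and Chernoff bounds *)

Section RandomSet.
Local Open Scope ring_scope.
Variable U : finType.

Definition bern (q : U -> R) (u : U) (b : bool) : R := if b then q u else 1 - q u.

Definition on_set (f : {ffun U -> bool}) : {set U} := [set u | f u].

Variable q : U -> R.
Hypothesis q01 : forall u, 0 <= q u <= 1.

Lemma bern_weight : prob_weight (bern q).
Proof.
split=> [u b|u]; first by have := q01 u; case: b; rewrite /bern; lra.
by rewrite big_bool /bern /=; lra.
Qed.

Lemma mgf_set (S : {set U}) (t : R) :
  Ex (bern q) (fun f => exp (t * #|on_set f :&: S|%:R)) =
  \prod_(u in S) (1 + q u * (exp t - 1)).
Proof.
transitivity (Ex (bern q) (fun f => \prod_u (if (u \in S) && f u then exp t else 1))).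
  apply: eq_Ex => f; rewrite -big_mkcond /= -[in LHS]sum1_card natr_sum mulr_sumr exp_sum.
  apply: eq_big => [u|u _]; first by rewrite !inE andbC.
  by rewrite mulr1.
rewrite (Ex_prod _ (fun u b => if (u \in S) && b then exp t else 1)).
rewrite [RHS]big_mkcond; apply: eq_bigr => u _; rewrite big_bool /bern /=.
by case: (u \in S) => /=; lra.
Qed.

Lemma mgf_set_le (S : {set U}) (t : R) :
  Ex (bern q) (fun f => exp (t * #|on_set f :&: S|%:R)) <=
  exp ((exp t - 1) * \sum_(u in S) q u).
Proof.
rewrite mgf_set mulr_sumr exp_sum; apply: ler_prod => u _.
have := exp_gt0 t; have /andP[q0 q1] := q01 u; move=> et.
apply/andP; split; first by nra.
by rewrite mulrC; apply: exp_ge1D.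
Qed.

(** Exponential Markov at parameter 1, where exp 1 - 1 is at most 2. It is only useful for
    thresholds above twice the mean, which is how it is applied. *)
Lemma upper_tail (S : {set U}) (m mu : R) :
  \sum_(u in S) q u <= mu ->
  Pr (bern q) (fun f => m <= #|on_set f :&: S|%:R) <= exp (2 * mu - m).
Proof.
move=> mu_ge.
have sq0 : 0 <= \sum_(u in S) q u by apply: sumr_ge0 => u _; case/andP: (q01 u).
apply: (@le_trans _ _ (Ex (bern q)
   (fun f => exp (- m) * exp (1 * #|on_set f :&: S|%:R)))).
  apply: (Pr_markov bern_weight) => [f|f /= le].
    by rewrite mulr_ge0 ?exp_ge0.
  by rewrite expRM -[leLHS]exp0; apply: exp_mono; lra.
rewrite ExZ; apply: le_trans (ler_wpM2l (exp_ge0 _) (mgf_set_le _ _)) _.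
rewrite expRM; apply: exp_mono.
have e3 := exp1_le3; have := exp_ge1D 1 => e1.
by nra.
Qed.

(** Exponential Markov at parameter -a, with exp (-a) - 1 bounded by -a + a^2. The parameter stays
    free because the thresholds range from a fixed fraction of the mean to nearly all of it. *)
Lemma lower_tail (S : {set U}) (a t mu : R) :
  0 <= a <= 1 -> mu <= \sum_(u in S) q u ->
  Pr (bern q) (fun f => #|on_set f :&: S|%:R <= t) <= exp (a * t - a * (1 - a) * mu).
Proof.
move=> /andP[a0 a1] mu_le.
have sq0 : 0 <= \sum_(u in S) q u by apply: sumr_ge0 => u _; case/andP: (q01 u).
apply: (@le_trans _ _ (Ex (bern q)
   (fun f => exp (a * t) * exp ((- a) * #|on_set f :&: S|%:R)))).
  apply: (Pr_markov bern_weight) => [f|f /= le].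
    by rewrite mulr_ge0 ?exp_ge0.
  by rewrite expRM -[leLHS]exp0; apply: exp_mono; nra.
rewrite ExZ; apply: le_trans (ler_wpM2l (exp_ge0 _) (mgf_set_le _ _)) _.
rewrite expRM; apply: exp_mono.
have h := expN_le a0.
have : (exp (- a) - 1) * (\sum_(u in S) q u) <= (- a + a ^+ 2) * (\sum_(u in S) q u).
  by apply: ler_wpM2r => //; lra.
have : (a - a ^+ 2) * mu <= (a - a ^+ 2) * (\sum_(u in S) q u).
  by apply: ler_wpM2l => //; nra.
by rewrite expr2; nra.
Qed.

End RandomSet.

(** * Disjoint perfect matchings *)

Section Factor.
Variable T : finType.
Implicit Types (F G : {set T * T}) (A B : {set T}).

Definition ecount F A B : nat := \sum_(e in F) ((e.1 \in A) && (e.2 \in B)).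

(** The Ore-Ryser condition e(A,B) >= r(|A| + |B| - |T|) for an r-regular spanning subgraph of a
    bipartite graph with both sides [T], written additively to avoid truncated subtraction. For r =
    1 it amounts to Hall's condition. *)
Definition dense r F : bool :=
  [forall A : {set T}, forall B : {set T},
     r * (#|A| + #|B|) <= ecount F A B + r * #|T|].

Lemma denseP r F :
  reflect (forall A B, r * (#|A| + #|B|) <= ecount F A B + r * #|T|) (dense r F).
Proof.
by apply: (iffP forallP) => [h A B|h A]; [have /forallP := h A|apply/forallP].
Qed.

(** Checked edge by edge. This is the uncrossing inequality for pairs ordered by inclusion on the
    left and reverse inclusion on the right. *)
Lemma ecount_modular F A B A' B' :
  ecount F (A :&: A') (B :|: B') + ecount F (A :|: A') (B :&: B') <=
  ecount F A B + ecount F A' B'.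
Proof.
rewrite /ecount -!big_split; apply: leq_sum => e _ /=; rewrite !inE.
by case: (e.1 \in A); case: (e.1 \in A'); case: (e.2 \in B); case: (e.2 \in B').
Qed.

Lemma ecountD1 F A B e : e \in F ->
  ecount F A B = ((e.1 \in A) && (e.2 \in B)) + ecount (F :\ e) A B.
Proof.
move=> eF; rewrite /ecount (bigD1 e) //=; congr (_ + _).
by apply: eq_bigl => f; rewrite !inE andbC.
Qed.

Definition outdeg F x := ecount F [set x] setT.
Definition indeg F y := ecount F setT [set y].

Lemma outdegDU1 F A B x : x \in A ->
  ecount F A B = ecount F (A :\ x) B + ecount F [set x] B.
Proof.
move=> xA; rewrite /ecount -big_split; apply: eq_bigr => e _ /=; rewrite !inE.
by case: eqP => [->|]; rewrite ?xA //= ?add0n ?addn0.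
Qed.

Lemma sum_outdeg F : \sum_x outdeg F x = \sum_(e in F) 1.
Proof.
rewrite exchange_big; apply: eq_bigr => e _.
rewrite (bigD1 e.1) //= !inE eqxx big1 ?addn0 // => x nx.
by rewrite !inE eq_sym (negbTE nx).
Qed.

Lemma sum_indeg F : \sum_y indeg F y = \sum_(e in F) 1.
Proof.
rewrite exchange_big; apply: eq_bigr => e _.
rewrite (bigD1 e.2) //= !inE eqxx big1 ?addn0 // => x nx.
by rewrite !inE eq_sym (negbTE nx).
Qed.

Definition regular r F := (forall x, outdeg F x = r) /\ (forall y, indeg F y = r).

(* Tight pairs (A, B), those with equality in [dense], are closed under
   (A, B), (A', B') |-> (A n A', B u B'); in an edge-minimal dense F every edge
   lies in a tight pair, so the neighbourhood of x lies in a single tight pair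
   (A, B) with x in A, and removing x from A bounds the degree of x by r. *)
Lemma dense_min_regular r F :
  minset (dense r) F -> regular r F.
Proof.
move=> /minsetP[/denseP dF minF].
pose tight A B := ecount F A B + r * #|T| == r * (#|A| + #|B|).
have cap A B A' B' : tight A B -> tight A' B' -> tight (A :&: A') (B :|: B').
  rewrite /tight /= => /eqP t1 /eqP t2.
  have h1 := dF (A :&: A') (B :|: B'); have h2 := dF (A :|: A') (B :&: B').
  have h3 := ecount_modular F A B A' B'.
  have h4 : #|A :|: A'| + #|A :&: A'| = #|A| + #|A'| := cardsUI A A'.
  have h5 : #|B :|: B'| + #|B :&: B'| = #|B| + #|B'| := cardsUI B B'.
  have h6 := congr1 (muln r) h4; have h7 := congr1 (muln r) h5.
  rewrite /tight; rewrite !mulnDr in t1 t2 h1 h2 h6 h7 *; apply/eqP.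
  move: t1 t2 h1 h2 h3 h6 h7; clear.
  move: (ecount _ _ _) (ecount _ _ _) (ecount _ _ _) (ecount _ _ _) (r * _) (r * _) (r * _).
  move: (r * _) (r * _) (r * _) (r * _) (r * _) (r * _).
  lia.
have edge_tight x y : (x, y) \in F -> exists A B, [/\ x \in A, y \in B & tight A B].
  move=> xyF.
  have : ~~ dense r (F :\ (x, y)).
    apply/negP => /minF; rewrite subsetDl => /(_ isT) e.
    by move: xyF; rewrite -e !inE eqxx.
  rewrite /dense negb_forall => /existsP[A]; rewrite negb_forall => /existsP[B].
  rewrite -ltnNge => lt; have := dF A B; rewrite (ecountD1 _ _ xyF) /= => le.
  case: (boolP (x \in A)) le => xA; last by rewrite /= add0n leqNgt lt.
  case: (boolP (y \in B)) => yB; last by rewrite /= add0n leqNgt lt.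
  rewrite /= => le; exists A, B; split => //; rewrite /tight.
  by rewrite eqn_leq (ecountD1 _ _ xyF) /= xA yB le andbT add1n.
have out_ge x : r <= outdeg F x.
  by have := dF [set x] setT; rewrite cards1 cardsT -/(outdeg _ _); nia.
have in_ge y : r <= indeg F y.
  by have := dF setT [set y]; rewrite cards1 cardsT -/(indeg _ _); nia.
have out_le x : outdeg F x <= r.
  rewrite leqNgt; apply/negP => deg_gt.
  have [y xyF] : exists y, (x, y) \in F.
    have : 0 < outdeg F x by lia.
    rewrite lt0n sum_nat_eq0 negb_forall => /existsP[[x' y]].
    rewrite negb_imply /= !inE andbT => /andP[xyF].
    by have [<- _|//] := eqVneq x' x; exists y.
  have [A0 [B0 [xA0 yB0 t0]]] := edge_tight _ _ xyF.
  pose P (D : {set T} * {set T}) := (x \in D.1) && tight D.1 D.2.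
  have P0 : P (A0, B0) by rewrite /P /= xA0.
  have [[A B] /= /andP[/= xA tAB] maxB] :
      {D | P D & forall D', P D' -> #|D'.2| <= #|D.2|}.
    by case: (arg_maxnP (fun D : {set T} * {set T} => #|D.2|) P0) => D; exists D.
  have NB z : (x, z) \in F -> z \in B.
    move=> xzF; have [A' [B' [xA' zB' t']]] := edge_tight _ _ xzF.
    have : P (A :&: A', B :|: B') by rewrite /P /= inE xA xA' cap.
    move=> /maxB /= le.
    have /eqP -> : B == B :|: B' by rewrite eqEcard subsetUl.
    by rewrite inE zB' orbT.
  have e1 : ecount F [set x] B = outdeg F x.
    apply: eq_bigr => -[x' z] F' /=; rewrite !inE andbT.
    by case: eqP => //= e; rewrite NB // -e.
  have := dF (A :\ x) B; have := outdegDU1 F B xA; rewrite e1.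
  move: tAB => /eqP; rewrite (cardsD1 x A) xA; nia.
have outE x : outdeg F x = r by apply/eqP; rewrite eqn_leq out_le out_ge.
split=> // y; apply/eqP; rewrite eq_sym.
(* Indegrees are at least r and sum to the same total as the outdegrees, r|T|, so all of them equal
   r. *)
have e : \sum_y0 indeg F y0 = \sum_(y0 : T) r.
  by rewrite sum_indeg -sum_outdeg; apply: eq_bigr.
have /leqif_sum h : forall y0, true -> r <= indeg F y0 ?= iff (r == indeg F y0).
  by move=> z _; split.
by have [_] := h; rewrite e eqxx => /esym/forallP/(_ y)/implyP/(_ isT).
Qed.

Lemma dense_regular r G : dense r G -> exists2 F : {set T * T}, F \subset G & regular r F.
Proof.
move=> dG; have [F mF sF] := minset_exists (P := dense r) dG.
by exists F => //; apply: dense_min_regular.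
Qed.

Lemma outdegE F x : outdeg F x = #|[set y | (x, y) \in F]|.
Proof.
rewrite -(card_imset _ (f := pair x)) => [|y z [] //].
rewrite /outdeg /ecount -big_mkcondr /= sum1_card; apply: eq_card => -[x' y].
rewrite unfold_in /= !inE andbT; apply/andP/imsetP => [[xyF /eqP e]|[z]].
  by exists y; rewrite ?inE -?e.
by rewrite inE => xzF [-> ->].
Qed.

(** Of the r|B| edges into B, at most r(|T| - |A|) start outside A. *)
Lemma regular_dense r F : regular r F -> dense r F.
Proof.
move=> [outF inF]; apply/denseP => A B.
have sumB : \sum_(y in B) indeg F y = ecount F setT B.
  rewrite /indeg /ecount exchange_big; apply: eq_bigr => e _ /=.
  have [eB|neB] := boolP (e.2 \in B).
    rewrite (bigD1 e.2) //= !inE eqxx big1 // => y /andP[_ ny].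
    by rewrite !inE eq_sym (negbTE ny).
  rewrite big1 ?andbF // => y yB; rewrite !inE.
  by case: eqP => // e2; rewrite e2 yB in neB.
have sumA : \sum_(x in ~: A) outdeg F x = ecount F (~: A) setT.
  rewrite /outdeg /ecount exchange_big; apply: eq_bigr => e _ /=.
  have [eB|neB] := boolP (e.1 \in ~: A).
    rewrite (bigD1 e.1) //= !inE eqxx big1 // => y /andP[_ ny].
    by rewrite !inE eq_sym (negbTE ny).
  rewrite big1 ?andbF // => y yB; rewrite !inE.
  by case: eqP => // e2; rewrite e2 yB in neB.
have le : ecount F setT B <= ecount F A B + ecount F (~: A) setT.
  rewrite -big_split; apply: leq_sum => e _ /=; rewrite !inE.
  by case: (e.1 \in A); case: (e.2 \in B).
rewrite (eq_bigr (fun=> r)) // sum_nat_const in sumA.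
rewrite (eq_bigr (fun=> r)) // sum_nat_const in sumB.
rewrite -sumA -sumB in le.
rewrite mulnDr -(cardsC A) mulnDr addnCA leq_add2l [r * _]mulnC.
by apply: leq_trans le _; rewrite leq_add2l mulnC.
Qed.

(** The demand r'(|A| + |B| - |T|) is either nonpositive or smaller than the one for r. With r' = 1
    this supplies the matching to be peeled off next. *)
Lemma denseW r r' F : r' <= r -> regular r F -> dense r' F.
Proof.
move=> le /regular_dense/denseP dF; apply/denseP => A B.
have [small|big] := leqP (#|A| + #|B|) #|T|.
  by apply: leq_trans (leq_addl _ _); rewrite leq_mul2l small orbT.
have := dF A B; have := subnKC (ltnW big); move: (_ - _) => c <-.
rewrite !mulnDr [_ + r * #|T|]addnC [_ + r' * #|T|]addnC !leq_add2l.
by apply: leq_trans; rewrite leq_mul2r le orbT.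
Qed.

Lemma regular_perm F : regular 1 F -> exists f : {perm T}, F = [set (x, f x) | x : T].
Proof.
move=> [outF inF].
have fP x : exists y, [set y | (x, y) \in F] == [set y].
  have /eqP/cards1P[y e] : #|[set y | (x, y) \in F]| = 1 by rewrite -outdegE outF.
  by exists y; rewrite e.
pose f0 x := xchoose (fP x).
have f0P x y : ((x, y) \in F) = (y == f0 x).
  by have /eqP/setP/(_ y) := xchooseP (fP x); rewrite !inE.
have inj : injective f0.
  move=> x x' e; apply/eqP; apply: contraT => nx.
  have m1 : (x, f0 x) \in F by rewrite f0P.
  have m2 : (x', f0 x) \in F :\ (x, f0 x).
    by rewrite !inE xpair_eqE eq_sym (negbTE nx) f0P e eqxx.
  by have := inF (f0 x); rewrite /indeg (ecountD1 _ _ m1) (ecountD1 _ _ m2) /= !inE !eqxx.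
exists (perm inj); apply/setP => -[x y]; rewrite f0P; apply/eqP/imsetP => [->|].
  by exists x; rewrite ?permE.
by case=> x' _ [-> ->]; rewrite permE.
Qed.

Lemma regularD r F (M : {set T * T}) : M \subset F -> regular r.+1 F -> regular 1 M ->
  regular r (F :\: M).
Proof.
move=> sM [oF iF] [oM iM].
have h A B : ecount F A B = ecount M A B + ecount (F :\: M) A B.
  rewrite /ecount (bigID (mem M)) /=; congr (_ + _); apply: eq_bigl => e.
    by rewrite andbC andb_idr // => /(subsetP sM).
  by rewrite inE andbC.
split=> [x|y].
  by have := oF x; rewrite /outdeg h -/(outdeg M x) oM add1n => -[].
by have := iF y; rewrite /indeg h -/(indeg M y) iM add1n => -[].
Qed.

(** König's edge colouring: removing a perfect matching leaves a regular graph of degree one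
    less. *)
Lemma regular_packing r F : regular r F ->
  exists f : 'I_r -> {perm T},
    (forall i x, (x, f i x) \in F) /\ (forall i j x, f i x = f j x -> i = j).
Proof.
elim: r F => [|r IH] F rF; first by exists (fun=> 1%g); split=> [] [].
have [M sM rM] := dense_regular (denseW (ltn0Sn r) rF).
have [g gM] := regular_perm rM.
have [f [fF fd]] := IH _ (regularD sM rF rM).
exists (fun i => if unlift ord0 i is Some j then f j else g); split=> [i x|i j x].
  case: unliftP => [j _|_]; first by have := fF j x; rewrite inE => /andP[].
  by apply: (subsetP sM); rewrite gM imset_f.
have fg k y : f k y <> g y.
  by move=> e; have := fF k y; rewrite inE gM e imset_f.
case: unliftP => [i' ->|->]; case: unliftP => [j' ->|->] //.
- by move/fd ->.
- by move/fg.
- by move/esym/fg.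
Qed.

Lemma dense_packing r G : dense r G ->
  exists f : 'I_r -> {perm T},
    (forall i x, (x, f i x) \in G) /\ (forall i j x, f i x = f j x -> i = j).
Proof.
move=> /dense_regular[F sF /regular_packing[f [fF fd]]].
by exists f; split=> // i x; apply: (subsetP sF).
Qed.

End Factor.

(** * Path extensions and rotations *)

Section Consecutive.
Variable V : eqType.
Implicit Types (s p : seq V) (a b w : V).

Fixpoint consec s a b : bool :=
  if s is x :: s' then ((x == a) && (ohead s' == Some b)) || consec s' a b
  else false.

Definition adjacent s a b := consec s a b || consec s b a.

Lemma consecP s a b : reflect (exists s1 s2, s = s1 ++ a :: b :: s2) (consec s a b).
Proof.
apply: (iffP idP) => [|[s1 [s2 ->]]].
  elim: s => //= x s IH /orP[/andP[/eqP-> ]|/IH[s1 [s2 ->]]].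
    by case: s {IH} => //= y s /eqP[->]; exists [::], s.
  by exists (x :: s1), s2.
elim: s1 => [|x s1 IH] /=; first by rewrite !eqxx.
by rewrite IH orbT.
Qed.

Lemma consec_cat s1 x y s2 a b :
  consec (rcons s1 x ++ y :: s2) a b =
  [|| consec (rcons s1 x) a b, (x == a) && (y == b) | consec (y :: s2) a b].
Proof.
elim: s1 => [|z s1 IH]; first by rewrite /= andbF.
rewrite [LHS]/= [consec (rcons (z :: s1) x) a b]/= IH !orbA; congr (_ || _ || _ || _).
by case: s1 {IH}.
Qed.

Lemma consec_rev s a b : consec (rev s) a b = consec s b a.
Proof.
elim: s => // x [|y s] IH; first by rewrite /= !andbF.
rewrite rev_cons -cats1 rev_cons consec_cat -rev_cons IH /=.
rewrite -[Some y == Some a]/(y == a) -[None == Some b]/false.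
by case: (x == b); case: (y == a); case: (x == a); case: (_ && _); case: (consec s b a).
Qed.

Lemma adjacent_sym s a b : adjacent s a b = adjacent s b a.
Proof. exact: orbC. Qed.

(** The only adjacency broken by a rotation is that of w and z. Just the presence of z is recorded,
    since z is the new last vertex. *)
Lemma adjacent_rot s1 w z s2 a b :
  adjacent (s1 ++ w :: z :: s2) a b ->
  [\/ a = z, b = z | adjacent (s1 ++ w :: rev (z :: s2)) a b].
Proof.
have e t : s1 ++ w :: t = rcons s1 w ++ t by rewrite -cats1 -catA.
have aux c d : consec (s1 ++ w :: z :: s2) c d ->
    d = z \/ adjacent (s1 ++ w :: rev (z :: s2)) c d.
  rewrite e consec_cat => /or3P[h|/andP[_ /eqP->]|h]; [right|by left|right].
    rewrite /adjacent e; case E : (rev _) => [|t r]; first by rewrite cats0 h.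
    by rewrite consec_cat h.
  rewrite /adjacent e; have := consec_rev (z :: s2) d c; rewrite h.
  by case E : (rev _) => [|t r] // h'; rewrite !consec_cat h' !orbT.
case/orP => /aux[->|h]; [by constructor 2|by constructor 3|by constructor 1|].
by constructor 3; rewrite adjacent_sym.
Qed.

(** The default value makes the last vertex its own successor; likewise [pred_in] sends the first
    vertex to itself. *)
Definition succ_in p a := nth a p (index a p).+1.
Definition pred_in p b := nth b p (index b p).-1.

Lemma consec_index p a b : uniq p -> consec p a b -> index b p = (index a p).+1.
Proof.
move=> up /consecP[s1 [s2 e]]; move: up; rewrite e cat_uniq /= !negb_or.
case/and3P => _ /and3P[na nb _] /andP[/andP[ab _] _].
rewrite !index_cat (negbTE na) (negbTE nb) /= !eqxx (negbTE ab).
by rewrite addn0 addn1.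
Qed.

Lemma consec_succ p a b : uniq p -> consec p a b -> b = succ_in p a.
Proof.
move=> up cab; rewrite /succ_in -(consec_index up cab) nth_index //.
by case/consecP: cab => s1 [s2 ->]; rewrite mem_cat !inE eqxx !orbT.
Qed.

Lemma consec_pred p a b : uniq p -> consec p a b -> a = pred_in p b.
Proof.
move=> up cab; rewrite /pred_in (consec_index up cab) /= nth_index //.
by case/consecP: cab => s1 [s2 ->]; rewrite mem_cat !inE eqxx !orbT.
Qed.

End Consecutive.

Section Rotation.
Variables (V : finType) (A : rel V).
Hypothesis Asym : symmetric A.
Implicit Types (p q : seq V) (S : {set V}).

(** Pósa rotations: the first vertex never moves, as the reversed tail starts after some w. *)
Inductive rotated p : seq V -> Prop :=
| rotated_refl : rotated p p
| rotated_step p1 w z p2 : rotated p (p1 ++ w :: z :: p2) -> A (last z p2) w ->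
    rotated p (p1 ++ w :: rev (z :: p2)).

Definition endpoints p : {set V} := [set v | `[< exists q, rotated p (rcons q v) >]].

Lemma endpointsP p v : reflect (exists q, rotated p (rcons q v)) (v \in endpoints p).
Proof. by rewrite inE; apply: asboolP. Qed.

Lemma rotated_perm p q : rotated p q -> perm_eq p q.
Proof.
elim=> // p1 w z p2 _ h _; apply: perm_trans h _.
by rewrite perm_cat2l perm_cons perm_sym perm_rev.
Qed.

Lemma rotated_mem p q : rotated p q -> p =i q.
Proof. by move=> /rotated_perm/perm_mem. Qed.

Lemma rotated_uniq p q : uniq p -> rotated p q -> uniq q.
Proof. by move=> up /rotated_perm/perm_uniq <-. Qed.

Lemma sorted_cat_cons p1 w p2 :
  sorted A (p1 ++ w :: p2) = sorted A (rcons p1 w) && path A w p2.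
Proof.
case: p1 => [|x p1] //=; rewrite cat_path rcons_path /=.
by rewrite andbA.
Qed.

Lemma rotated_sorted p q : sorted A p -> rotated p q -> sorted A q.
Proof.
move=> sp; elim=> // p1 w z p2 _; rewrite !sorted_cat_cons => /andP[-> /=].
move=> /andP[wz zp] lw; rewrite -/(rev (z :: p2)).
have := rev_path A z (rcons p2 (last z p2)).
have -> : path A w (rev (z :: p2)) = A w (last z p2) && sorted A (rev (z :: p2)).
  by case/lastP: p2 {wz zp lw} => // p2 y; rewrite last_rcons rev_cons rev_rcons.
rewrite Asym lw /= => _; rewrite rev_sorted /=.
by rewrite (eq_path (e' := A)) // => x y; rewrite Asym.
Qed.

Lemma rotated_head p q x : rotated p q -> head x q = head x p.
Proof. by elim=> // p1 w z p2 _ <- _; case: p1. Qed.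

(** Each broken adjacency involves the vertex that becomes last, which is an endpoint. *)
Lemma rotated_adjacent p q a b : rotated p q -> a \notin endpoints p ->
  b \notin endpoints p -> adjacent p a b -> adjacent q a b.
Proof.
move=> rpq na nb pab; elim: rpq => // p1 w z p2 r h lw.
have zS : z \in endpoints p.
  apply/endpointsP; exists (p1 ++ w :: rev p2).
  by rewrite rcons_cat rcons_cons -rev_cons; apply: rotated_step.
have [e|e|//] := adjacent_rot h.
  by rewrite e zS in na.
by rewrite e zS in nb.
Qed.

Lemma head_index p x : uniq p -> x \in p -> (index x p == 0) = (head x p == x).
Proof. by case: p => //= y p _ _; case: (y == x). Qed.

Lemma not_endpoint_consec p w : w \in p -> w \notin endpoints p ->
  exists u, consec p w u.
Proof.
move=> wp; have /splitPr E := wp; case: E => r1 [|u r2] nw.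
  by case/endpointsP: nw; exists r1; rewrite cats1; apply: rotated_refl.
by exists u; apply/consecP; exists r1, r2.
Qed.

(** Suppose neither neighbour of w along p is an endpoint. Both are then still adjacent to w in the
    rotated path ending in y. The successor z of w there becomes last after rotating along the chord
    from y to w, so it is an endpoint; hence both old neighbours must precede w, which leaves room
    for one only. *)
Lemma posa_neighbour p y w : uniq p -> y \in endpoints p -> A y w -> w \in p ->
  w \notin endpoints p ->
  (succ_in p w \in endpoints p) || (pred_in p w \in endpoints p).
Proof.
move=> up /endpointsP[q rq] Ayw wp nw; apply: contraT; rewrite negb_or => /andP[nu nt].
have uq := rotated_uniq up rq; have wq : w \in rcons q y by rewrite -(rotated_mem rq).
have [p1 [z [p2 eq]]] : exists p1 z p2, rcons q y = p1 ++ w :: z :: p2.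
  have /splitPr E := wq; case: E rq uq => p1 [|z p2] rq uq; last by exists p1, z, p2.
  case/endpointsP: nw; exists p1; by rewrite cats1 in rq.
have ly : last z p2 = y.
  by have := congr1 (last y) eq; rewrite last_rcons last_cat /=.
have zS : z \in endpoints p.
  apply/endpointsP; exists (p1 ++ w :: rev p2).
  rewrite rcons_cat rcons_cons -rev_cons; apply: rotated_step; first by rewrite -eq.
  by rewrite ly.
have cwz : consec (rcons q y) w z by apply/consecP; exists p1, p2.
have zE := consec_succ uq cwz.
have nbr u : u \notin endpoints p -> adjacent p w u -> consec (rcons q y) u w.
  move=> nuS pwu; have := rotated_adjacent rq nw nuS pwu.
  case/orP => // /(consec_succ uq) e; by rewrite e -zE zS in nuS.
have [u cwu] := not_endpoint_consec wp nw; have /consecP[r1 [r2 ep]] := cwu.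
have uE := consec_succ up cwu; rewrite -uE in nu.
have cu := nbr u nu; rewrite /adjacent cwu in cu; have {}cu := cu isT.
(* If w is first in p it is still first after rotations, and so has no predecessor there at all. *)
case/lastP: r1 => [|r1 t] in ep.
  have := head_index uq wq; have := rotated_head w rq; rewrite ep /= => ->.
  by rewrite eqxx (consec_index uq cu).
have ctw : consec p t w by apply/consecP; exists r1, (u :: r2); rewrite -cats1 -catA in ep.
have tE := consec_pred up ctw; rewrite -tE in nt.
have := nbr t nt; rewrite /adjacent ctw orbT => /(_ isT) /(consec_pred uq) et.
(* The vertices before and after w in p coincide, although their positions differ by two. *)
have := consec_pred uq cu; rewrite -et => eut.
have := consec_index up cwu; rewrite eut; have := consec_index up ctw.
by clear; move: (index _ _) (index _ _); lia.
Qed.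

Definition nbhd S : {set V} := [set w | [exists y in S, A y w]].

(** By [posa_neighbour], the set S of endpoints together with its neighbours lies in the union of S,
    its predecessors and its successors along p, of size at most 3|S|. The expansion hypothesis
    rules this out for small S. *)
Lemma posa p s0 : uniq p -> p != [::] ->
  (forall S, 0 < #|S| <= s0 -> 3 * #|S| < #|S :|: nbhd S|) ->
  (forall y w, y \in endpoints p -> A y w -> w \in p) ->
  s0 < #|endpoints p|.
Proof.
move=> up p0 hS inp; set S := endpoints p.
have S0 : 0 < #|S|.
  case/lastP: p up p0 inp @S => // p y _ _ _ S; apply/card_gt0P; exists y.
  by apply/endpointsP; exists p; apply: rotated_refl.
rewrite ltnNge; apply/negP => le; have := hS S; rewrite S0 le => /(_ isT).
rewrite ltnNge => /negP; apply.
suff sub : S :|: nbhd S \subset S :|: (pred_in p @: S) :|: (succ_in p @: S).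
  apply: leq_trans (subset_leq_card sub) _.
  apply: leq_trans (leq_card_setU _ _) _; rewrite mulSn addnC leq_add ?leq_imset_card //.
  apply: leq_trans (leq_card_setU _ _) _; rewrite mulSn mul1n.
  by rewrite leq_add ?leq_imset_card.
apply/subsetP => w; rewrite in_setU => /orP[wS|]; first by rewrite !in_setU wS.
rewrite inE => /existsP[y /andP[yS Ayw]].
have wp := inp _ _ yS Ayw.
have [wS|nw] := boolP (w \in S); first by rewrite !in_setU wS.
have [ctw|nc] := boolP [exists t, consec p t w].
  have {ctw}[t ctw] := existsP ctw.
  have [sS|tS] := orP (posa_neighbour up yS Ayw wp nw); last first.
    rewrite -(consec_pred up ctw) in tS.
    by rewrite !in_setU (consec_succ up ctw) imset_f ?orbT.
  have [u cwu] := not_endpoint_consec wp nw.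
  rewrite -(consec_succ up cwu) in sS.
  by rewrite !in_setU [X in X \in pred_in _ @: _](consec_pred up cwu) imset_f ?orbT.
have i0 : index w p = 0.
  have /splitPr E := wp; case: E up nc {nw} => r1 r2 up nc.
  rewrite index_cat /= eqxx; case/lastP: r1 up nc => // r1 t up /existsP[].
  by exists t; apply/consecP; exists r1, r2; rewrite -cats1 -catA.
have [sS|] := orP (posa_neighbour up yS Ayw wp nw); last first.
  (* For the first vertex [pred_in] returns w itself, which is not an endpoint. *)
  by rewrite /pred_in i0 /= -i0 nth_index // (negbTE nw).
have [u cwu] := not_endpoint_consec wp nw.
rewrite -(consec_succ up cwu) in sS.
by rewrite !in_setU [X in X \in pred_in _ @: _](consec_pred up cwu) imset_f ?orbT.
Qed.

End Rotation.

Section Extension.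
Variables (V : finType) (pi : {perm V}).
Implicit Types (A : rel V) (p q c : seq V).

(** Paths are kept unions of cycles of pi, so that each extension absorbs at least one whole cycle
    and the number of extensions is bounded by the number of cycles instead of the number of
    vertices. *)
Definition pi_closed p := [forall x, (pi x \in p) == (x \in p)].

Definition good A p := [&& p != [::], uniq p, sorted A p & pi_closed p].

Definition extends A p := exists2 p', good A p' &
  [set x in p] \proper [set x in p'].

Definition hamiltonian A := exists c, [/\ uniq c, #|V| = size c & path.cycle A c].

Definition add_edge A (e : V * V) : rel V :=
  [rel x y | [|| A x y, (x, y) == e | (y, x) == e]].

Lemma add_edge_sub A e : subrel A (add_edge A e).
Proof. by move=> x y Axy; rewrite /add_edge /= Axy. Qed.

Lemma pi_closedP p x : pi_closed p -> (pi x \in p) = (x \in p).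
Proof. by move=> /forallP/(_ x)/eqP. Qed.

Lemma pi_closed_eq p q : p =i q -> pi_closed p = pi_closed q.
Proof. by move=> e; apply: eq_forallb => x; rewrite !e. Qed.

Lemma pi_closed_connect p x y : pi_closed p -> fconnect pi x y -> (y \in p) = (x \in p).
Proof. by move=> cp /iter_findex <-; elim: findex => //= n <-; apply: pi_closedP. Qed.

Lemma frel_sorted A p : (forall x, x != pi x -> A x (pi x)) -> uniq p ->
  sorted (frel pi) p -> sorted A p.
Proof.
move=> hA; case: p => // x p; elim: p x => //= y p IH x.
rewrite !inE negb_or => /andP[/andP[xy _] up] /andP[/eqP e pp].
by rewrite IH //; have := hA x; rewrite e xy => ->.
Qed.

(* A path whose last vertex has a neighbour outside absorbs the pi-orbit of
   this neighbour. *)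
Lemma attach A p y w : (forall x, x != pi x -> A x (pi x)) -> good A (rcons p y) ->
  A y w -> w \notin rcons p y -> extends A (rcons p y).
Proof.
move=> hA /and4P[_ up sp cp] Ayw nw.
have uo := orbit_uniq pi w.
have mo v : (v \in orbit pi w) = fconnect pi w v by rewrite fconnect_orbit.
have eo : orbit pi w = w :: behead (orbit pi w) by rewrite /orbit -orderSpred.
have so : sorted A (orbit pi w).
  apply: frel_sorted => //; rewrite /orbit -orderSpred /=.
  exact: fpath_traject.
exists (rcons p y ++ orbit pi w); last first.
  apply/properP; split; first by apply/subsetP => v; rewrite !inE mem_cat => ->.
  exists w; last by rewrite inE.
  by rewrite inE mem_cat mo connect0 orbT.
apply/and4P; split.
- by case: (p).
- rewrite cat_uniq up uo andbT /=; apply/hasPn => v; rewrite mo => cv.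
  by rewrite (pi_closed_connect cp cv).
- rewrite eo; case: p sp {up cp nw} => [|x p] /=; rewrite ?cat_path ?last_rcons /= => sp.
    by rewrite Ayw; rewrite eo in so.
  by rewrite sp Ayw; rewrite eo in so.
- apply/forallP => x; rewrite !mem_cat (pi_closedP _ cp) !mo; apply/eqP; congr (_ || _).
  by rewrite -(same_fconnect1_r (@perm_inj _ pi)).
Qed.

Lemma good_rotated A p q : symmetric A -> good A p -> rotated A p q -> good A q.
Proof.
move=> sA /and4P[p0 up sp cp] r; apply/and4P; split.
- by apply: contraNneq p0 => e; have := perm_size (rotated_perm r); rewrite e => /size0nil ->.
- exact: rotated_uniq r.
- exact: rotated_sorted r.
- by rewrite -(pi_closed_eq (rotated_mem r)).
Qed.

Lemma good_rev A p : symmetric A -> good A p -> good A (rev p).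
Proof.
move=> sA /and4P[p0 up sp cp]; apply/and4P; split.
- by apply: contraNneq p0 => e; rewrite -[p]revK e.
- by rewrite rev_uniq.
- by rewrite rev_sorted (eq_sorted (e' := A)) // => x y; rewrite sA.
- by rewrite -(pi_closed_eq (fun x => esym (mem_rev p x))).
Qed.

Lemma extends_mem A p q : p =i q -> extends A q -> extends A p.
Proof.
move=> e [p' gp' pr]; exists p' => //.
by rewrite (_ : [set x in p] = [set x in q]) //; apply/setP => x; rewrite !inE e.
Qed.

Lemma extends_sub A B p : subrel A B -> extends A p -> extends B p.
Proof.
move=> sAB [p' /and4P[h1 h2 h3 h4] pr]; exists p' => //.
by rewrite /good h1 h2 h4 /= (sub_sorted sAB).
Qed.

Lemma hamiltonian_sub A B : subrel A B -> hamiltonian A -> hamiltonian B.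
Proof.
by move=> sAB [c [h1 h2 h3]]; exists c; split => //; apply: sub_cycle h3.
Qed.

(* Closing the path up: if a cycle on the vertices of p has an edge leaving it,
   opening the cycle there and attaching yields a longer path. *)
Lemma close A p x q y : symmetric A -> (forall x, x != pi x -> A x (pi x)) ->
  good A (x :: rcons q y) -> p =i x :: rcons q y -> A y x ->
  [\/ extends A p, hamiltonian A |
     (forall u v, u \in p -> A u v -> v \in p) /\ exists v, v \notin p].
Proof.
move=> sA hA gp ep Ayx; set c := x :: rcons q y.
have /and4P[_ uc sc cc] := gp.
have cyc : path.cycle A c by rewrite /c (cycle_path x) /= last_rcons Ayx.
case: (pselect (exists u v, [/\ u \in p, A u v & v \notin p])) => [[u [v [up Auv nv]]]|no].
  constructor 1; apply: (extends_mem ep); rewrite -/c.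
  have uc' : u \in c by rewrite -ep.
  have [i s es] := rot_to uc'.
  have e2 : rot 1 (rot i c) = rcons s u by rewrite es rot1_cons.
  have gs : good A (rcons s u).
    apply/and4P; split; first by case: (s).
    - by rewrite -e2 !rot_uniq.
    - have : path.cycle A (rcons s u) by rewrite -e2 !rot_cycle.
      by case: (s) => //= a l; rewrite rcons_path => /andP[].
    - by rewrite -(pi_closed_eq (p := c)) // => z; rewrite -e2 !mem_rot.
  apply: (@extends_mem _ _ (rcons s u)) => [z|]; first by rewrite -e2 !mem_rot.
  by apply: attach Auv _ => //; rewrite -e2 !mem_rot /c -ep.
case: (pselect (exists v, v \notin p)) => [nv|all].
  constructor 3; split=> // u v up Auv; apply: contrapT => nvp; apply: no.
  by exists u, v; split => //; apply/negP.
constructor 2; exists c; split => //.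
have <- : #|c| = size c by apply/card_uniqP.
by apply: eq_card => v; rewrite -ep !inE; apply/esym; apply: contrapT => /negP nv; apply: all; exists v.
Qed.

(** Boosters: if p cannot be extended directly, Pósa's lemma gives more than s0 possible last
    vertices y, and for each of them at least s0 partners such that adding the pair extends p or
    closes a Hamilton cycle. *)
Lemma extension_step A p s0 : symmetric A -> (forall x, x != pi x -> A x (pi x)) ->
  (forall S : {set V}, 0 < #|S| <= s0 -> 3 * #|S| < #|S :|: nbhd A S|) ->
  good A p ->
  extends A p \/ exists2 B : {set V * V}, s0 * s0 <= #|B| &
    forall e, e \in B -> e.1 != e.2 /\
      (extends (add_edge A e) p \/ hamiltonian (add_edge A e)).
Proof.
move=> sA hA hS gp; case: (pselect (extends A p)) => [|nE]; [by left|right].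
have [s00|s0_gt0] := posnP s0.
  by exists set0; [rewrite s00|move=> e; rewrite inE].
have sE e : symmetric (add_edge A e).
  by move=> x y; rewrite /add_edge /= sA; congr (_ || _); rewrite orbC.
have hE e x : x != pi x -> add_edge A e x (pi x).
  by move=> /hA; apply: add_edge_sub.
have big q : good A q -> q =i p -> s0 < #|endpoints A q|.
  move=> gq eq; have /and4P[q0 uq _ _] := gq; apply: posa => // y w /endpointsP[r rq] Ayw.
  apply: contrapT => /negP nw; apply: nE.
  have er : p =i rcons r y by move=> z; rewrite -eq (rotated_mem rq).
  apply: (extends_mem er); apply: attach Ayw _ => //; first exact: good_rotated rq.
  by rewrite -(rotated_mem rq).
have [yP|] := pselect (exists y q, [/\ good A (rcons q y), rcons q y =i p & True]); last first.
  case; have /and4P[p0 _ _ _] := gp.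
  by case/lastP: p p0 gp {big nE} => // q y _ gp; exists y, q.
pose Q y := `[< exists2 q, good A (rcons q y) & rcons q y =i p >].
pose S1 := [set y | Q y].
have S1_big : s0 < #|S1|.
  apply: leq_trans (big p gp (fun=> erefl)) _; apply: subset_leq_card.
  apply/subsetP => y /endpointsP[q rq]; rewrite inE; apply/asboolP; exists q.
    exact: good_rotated rq.
  by move=> z; rewrite (rotated_mem rq).
pose T y := [set t | `[< exists2 q, good A (y :: rcons q t) & y :: rcons q t =i p >]].
have T_big y : y \in S1 -> s0 <= #|T y|.
  rewrite inE => /asboolP[q gq eq].
  have gr : good A (y :: rev q) by rewrite -rev_rcons; apply: good_rev.
  have er : y :: rev q =i p by move=> z; rewrite -rev_rcons mem_rev eq.
  have := big _ gr er => lt.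
  (* On a single-vertex path the first vertex is itself an endpoint. Discarding it costs one,
     covered by the strict inequality in [posa]. *)
  have sub : endpoints A (y :: rev q) \subset y |: T y.
    apply/subsetP => t /endpointsP[r rr]; rewrite !inE.
    case: eqP => //= ty; apply/asboolP.
    have := rotated_head t rr; case: r rr => [|a r] rr /= hd.
      by case: ty; rewrite hd.
    exists r; first by rewrite -hd; apply: good_rotated rr.
    by move=> z; rewrite -hd -er (rotated_mem rr).
  have := leq_trans lt (subset_leq_card sub); rewrite cardsU1.
  by case: (y \in T y) => /=; rewrite ?add0n ?add1n; [apply: ltnW|].
have card_pairs (F : V -> {set V}) : (forall y, y \in S1 -> s0 <= #|F y|) ->
    s0 * s0 <= #|[set e : V * V | (e.1 \in S1) && (e.2 \in F e.1)]|.
  move=> hF; rewrite -sum1_card.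
  rewrite (eq_bigl (fun e => (e.1 \in S1) && (e.2 \in F e.1))); last first.
    by move=> e; rewrite inE.
  rewrite -(pair_big_dep (fun y => y \in S1) (fun y t => t \in F y) (fun _ _ => 1)) /=.
  apply: (@leq_trans (\sum_(y in S1) s0)).
    by rewrite sum_nat_const leq_mul2r (ltnW S1_big) orbT.
  by apply: leq_sum => y yS; rewrite sum1_card hF.
(* If no edge leaves p but vertices remain outside, the partners are these outside vertices. In the
   other two cases (p spanning, or some edge leaving p) the partners are opposite ends and the added
   pair closes a cycle. *)
case: (pselect (forall u v, u \in p -> A u v -> v \in p)) => [inside|out].
  case: (pselect (exists v, v \notin p)) => [[v nv]|all].
    pose Y := [set v | v \notin p].
    (* No edge leaves Y, so Y does not expand and must be larger than the scale at which expansion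
       is guaranteed. *)
    have Y_big : s0 <= #|Y|.
      rewrite leqNgt; apply/negP => lt.
      have := hS Y; rewrite (ltnW lt) andbT.
      have Y0 : 0 < #|Y| by apply/card_gt0P; exists v; rewrite inE.
      move=> /(_ Y0); rewrite (_ : Y :|: nbhd A Y = Y) ?ltnNge ?leq_pmull //.
      apply/setUidPl/subsetP => w; rewrite inE => /existsP[u /andP[]].
      rewrite !inE => nu Auw; apply: contra nu => wp; apply: inside wp _.
      by rewrite sA.
    exists [set e : V * V | (e.1 \in S1) && (e.2 \in Y)]; first exact: (card_pairs (fun=> Y)).
    move=> [y w]; rewrite inE /= => /andP[yS]; rewrite inE => nw.
    move: yS; rewrite inE => /asboolP[q gq eq].
    have yp : y \in p by rewrite -eq mem_rcons inE eqxx.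
    split; first by apply: contraNneq nw => <-.
    left; apply: (extends_mem (q := rcons q y)) => [z|]; first by rewrite eq.
    apply: (attach (w := w) (hE (y, w))); rewrite ?eq //; last by rewrite /add_edge /= eqxx orbT.
    have /and4P[h1 h2 h3 h4] := gq; apply/and4P; split => //.
    exact: sub_sorted (@add_edge_sub _ _) _ h3.
  exists [set e : V * V | (e.1 \in S1) && (e.2 \in T e.1)]; first exact: card_pairs.
  move=> [y t]; rewrite inE /= => /andP[_]; rewrite inE => /asboolP[q gq eq].
  have /and4P[_ /= /andP[ny _] _ _] := gq.
  split; first by apply: contraNneq ny => ->; rewrite mem_rcons inE eqxx.
  have ge : good (add_edge A (y, t)) (y :: rcons q t).
    have /and4P[h1 h2 h3 h4] := gq; apply/and4P; split => //.
    exact: sub_sorted (@add_edge_sub _ _) _ h3.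
  have [] := close (sE _) (hE _) ge (fun z => esym (eq z)) _; first by rewrite /add_edge /= eqxx !orbT.
  - by left.
  - by right.
  - by case=> _ /all.
exists [set e : V * V | (e.1 \in S1) && (e.2 \in T e.1)]; first exact: card_pairs.
move=> [y t]; rewrite inE /= => /andP[_]; rewrite inE => /asboolP[q gq eq].
have /and4P[_ /= /andP[ny _] _ _] := gq.
split; first by apply: contraNneq ny => ->; rewrite mem_rcons inE eqxx.
have ge : good (add_edge A (y, t)) (y :: rcons q t).
  have /and4P[h1 h2 h3 h4] := gq; apply/and4P; split => //.
  exact: sub_sorted (@add_edge_sub _ _) _ h3.
have [] := close (sE _) (hE _) ge (fun z => esym (eq z)) _; first by rewrite /add_edge /= eqxx !orbT.
- by left.
- by right.
- case=> inside _; case: out => u v up Auv; apply: inside up _; exact: add_edge_sub.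
Qed.

End Extension.

(** * Dense random bipartite graphs *)

Section SubsetSums.
Local Open Scope ring_scope.
Variable T : finType.

Lemma sum_set_pow (y : R) : \sum_(B : {set T}) y ^+ #|B| = (1 + y) ^+ #|T|.
Proof.
rewrite -prodr_const addrC bigA_distr /=.
apply: eq_bigr => B _; rewrite -big_mkcond /= prodr_const.
by congr (_ ^+ _); apply: eq_card.
Qed.

Lemma sum_set_pow_le (y : R) : 0 <= y -> #|T|%:R * y <= 1 / 2 ->
  \sum_(B : {set T}) y ^+ #|B| <= 1 + 2 * (#|T|%:R * y).
Proof.
move=> y0 small; rewrite sum_set_pow.
have h : (1 + y) ^+ #|T| <= exp (#|T|%:R * y).
  rewrite mulr_natl -expRX; apply: lerXn2r; rewrite ?nnegrE ?exp_ge0 ?exp_ge1D //.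
  by lra.
apply: le_trans h _; have ty : 0 <= #|T|%:R * y by rewrite mulr_ge0.
have := exp_le_quad ty small; move: (#|T|%:R * y) ty small => z; rewrite expr2; nra.
Qed.

Lemma sum_set0_pow_le (y : R) : 0 <= y -> #|T|%:R * y <= 1 / 2 ->
  \sum_(B : {set T} | (0 < #|B|)%N) y ^+ #|B| <= 2 * (#|T|%:R * y).
Proof.
move=> y0 small; have := sum_set_pow_le y0 small.
rewrite (bigD1 set0) //= cards0 expr0 lerD2l.
by rewrite (eq_bigl (fun B : {set T} => 0 < #|B|)%N) // => B; rewrite card_gt0.
Qed.

End SubsetSums.

Section RandomDense.
Local Open Scope ring_scope.

(** Up to the factor q, this bounds the gap between the mean number of edges in an a by b rectangle
    and the number demanded by [dense]. If w - b >= e w the first product in the identity pays for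
    the negative part of the second; otherwise both sides are nearly full and w - a is at most b /
    2. *)
Lemma rect_deficit (a b w e : R) : 0 <= b <= a -> a <= w -> 0 < e <= 1 / 4 ->
  e / 2 * (w * b) <= a * b - (1 - e) * w * (a + b - w).
Proof.
move=> /andP[b0 ba] aw /andP[e0 e1].
have -> : a * b - (1 - e) * w * (a + b - w) =
  (w - a) * (w - b) + e * w * (b - (w - a)) by ring.
have [h|h] := lerP (e * w) (w - b).
  have : (w - a) * (e * w) <= (w - a) * (w - b) by rewrite ler_wpM2l // subr_ge0.
  have : 0 <= e / 2 * (w * b) by rewrite !mulr_ge0 //; lra.
  by nra.
have h1 : e * w <= w / 4 by nra.
have h2 : b / 2 <= b - (w - a) by lra.
have : (e * w) * (b / 2) <= (e * w) * (b - (w - a)) by rewrite ler_wpM2l //; nra.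
have : 0 <= (w - a) * (w - b) by rewrite mulr_ge0 //; lra.
by nra.
Qed.

Lemma few_arith (x r a b w e q : R) : x + r * w < r * (a + b) ->
  r <= (1 - e) * (w * q) -> 0 <= r -> 0 <= x ->
  x <= (1 - e) * w * (a + b - w) * q.
Proof.
move=> lt rle r0 x0; have [c0|c0] := lerP 0 (a + b - w).
  have : r * (a + b - w) <= (1 - e) * (w * q) * (a + b - w) by rewrite ler_wpM2r.
  by lra.
have : r * (a + b - w) <= 0 by rewrite mulr_ge0_le0 // ltW.
by lra.
Qed.

(** With a = e / 4 in [lower_tail], the gain a(mu - t) >= e^2 d / 8 exceeds twice over the loss a^2
    mu <= e^2 d / 16. *)
Lemma exponent_bound (e t mu d : R) : 0 < e -> e / 2 * d <= mu - t -> mu <= d ->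
  e / 4 * t - e / 4 * (1 - e / 4) * mu <= - (e ^+ 2 * d / 16).
Proof.
move=> e0 h1 h2.
have : (e / 4) * (e / 2 * d) <= e / 4 * (mu - t) by rewrite ler_wpM2l //; lra.
have : (e / 4) ^+ 2 * mu <= (e / 4) ^+ 2 * d by rewrite ler_wpM2l // sqr_ge0.
by rewrite !expr2; lra.
Qed.

Variables (T : finType) (q e : R) (r : nat).
Hypothesis q01 : 0 <= q <= 1.
Hypothesis e14 : 0 < e <= 1 / 4.
Let w : R := #|T|%:R.
Hypothesis r_le : r%:R <= (1 - e) * (w * q).

Let few (A B : {set T}) (f : {ffun T * T -> bool}) : bool :=
  (ecount (on_set f) A B + r * #|T| < r * (#|A| + #|B|))%N.

Let y0 : R := exp (- (e ^+ 2 * (w * q) / 16)).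
Let y : R := exp (- (e ^+ 2 * (w * q) / 32)).

Lemma few_bound (A B : {set T}) (b : nat) : b = minn #|A| #|B| ->
  Pr (bern (fun=> q)) (few A B) <= y0 ^+ b.
Proof.
move=> bE; pose S := setX A B.
pose t : R := (1 - e) * w * (#|A|%:R + #|B|%:R - w) * q.
have w0 : 0 <= w by rewrite /w ler0n.
have [e0 e1] : 0 < e /\ e <= 1 / 4 by split; case/andP: e14.
have q0 : 0 <= q by case/andP: q01.
apply: (@le_trans _ _ (Pr (bern (fun=> q)) (fun f => #|on_set f :&: S|%:R <= t))).
  apply: (Pr_le (bern_weight (fun=> q01))) => f; rewrite /few.
  have -> : ecount (on_set f) A B = #|on_set f :&: S|.
    rewrite /ecount -big_mkcondr /= sum1_card; apply: eq_card => -[u v].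
    by rewrite unfold_in /= !inE /=.
  rewrite -(ltr_nat R) natrD !natrM natrD => lt.
  exact: few_arith lt r_le (ler0n _ _) (ler0n _ _).
pose mu : R := q * (#|A|%:R * #|B|%:R).
have muE : mu = \sum_(u in S) q.
  by rewrite sumr_const cardsX /mu -natrM mulr_natr.
apply: le_trans (lower_tail (fun=> q01) (a := e / 4) (mu := mu) _ _ _) _.
- by lra.
- by rewrite muE.
rewrite /y0 expRX; apply: exp_mono.
rewrite -[_ *+ b]mulr_natr.
have le1 : e / 2 * (w * q * b%:R) <= mu - t.
  have hA : #|A|%:R <= w by rewrite /w ler_nat max_card.
  have hB : #|B|%:R <= w by rewrite /w ler_nat max_card.
  have [le|lt] := leqP #|B| #|A|.
    have -> : b = #|B| by rewrite bE; apply/minn_idPr.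
    have := @rect_deficit #|A|%:R #|B|%:R w e; rewrite ler0n ler_nat le => /(_ isT hA e14).
    by move=> /(ler_wpM2r q0); rewrite /mu /t; lra.
  have -> : b = #|A| by rewrite bE; apply/minn_idPl/ltnW.
  have := @rect_deficit #|B|%:R #|A|%:R w e; rewrite ler0n ler_nat (ltnW lt).
  by move=> /(_ isT hB e14) /(ler_wpM2r q0); rewrite /mu /t; lra.
have le2 : mu <= w * q * b%:R.
  rewrite /mu [w * q]mulrC -mulrA ler_wpM2l // -natrM /w -natrM ler_nat bE.
  rewrite /minn; case: ltnP => _; last by rewrite leq_mul2r max_card orbT.
  by rewrite mulnC leq_mul2r max_card orbT.
have := exponent_bound e0 le1 le2.
suff -> : - (e ^+ 2 * (w * q * b%:R) / 16) = - (e ^+ 2 * (w * q) / 16) * b%:R by [].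
by move: w b%:R => w1 b1; ring.
Qed.

Lemma y0E : y0 = y ^+ 2.
Proof. by rewrite /y0 /y expRX; congr exp; rewrite mulr2n; lra. Qed.

(** Union bound over the pairs with |A| + |B| > |T|, since others impose nothing. If B is the
    smaller set then |~A| < |B|, so the bound y^(2|B|) is at most y^|~A| y^|B|; the sum now factors
    into two binomial sums, and B is nonempty, which makes the second factor small. *)
Lemma random_dense : w * y <= 1 / 2 ->
  Pr (bern (fun _ : T * T => q)) (fun f => ~~ dense r (on_set f)) <= 8 * (w * y).
Proof.
move=> small; have y_ge0 : 0 <= y by apply: exp_ge0.
have y_le1 : y <= 1.
  rewrite -exp0; apply: exp_mono; rewrite oppr_le0.
  have w0 : 0 <= w := ler0n _ _; have q0 : 0 <= q by case/andP: q01.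
  have /andP[e0 _] := e14; by rewrite !mulr_ge0 //; lra.
pose bad (D : {set T} * {set T}) := (#|T| < #|D.1| + #|D.2|)%N.
apply: (@le_trans _ _ (Pr (bern (fun=> q))
   (fun f => [exists D, bad D && few D.1 D.2 f]))).
  apply: (Pr_le (bern_weight (fun=> q01))) => f.
  rewrite /dense negb_forall => /existsP[A]; rewrite negb_forall => /existsP[B].
  rewrite -ltnNge => lt; apply/existsP; exists (A, B); rewrite /few lt andbT /bad /=.
  rewrite ltnNge; apply/negP => le; move: lt; rewrite ltnNge => /negP; apply.
  by apply: leq_trans (leq_addl _ _); rewrite leq_mul2l le orbT.
apply: le_trans (Pr_union (bern_weight (fun=> q01)) _ _) _.
pose g1 (D : {set T} * {set T}) : R :=
  if (0 < #|D.2|)%N then y ^+ #|~: D.1| * y ^+ #|D.2| else 0.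
pose g2 (D : {set T} * {set T}) : R :=
  if (0 < #|D.1|)%N then y ^+ #|~: D.2| * y ^+ #|D.1| else 0.
have g1_ge0 D : 0 <= g1 D by rewrite /g1; case: ifP => // _; rewrite mulr_ge0 ?exprn_ge0.
have g2_ge0 D : 0 <= g2 D by rewrite /g2; case: ifP => // _; rewrite mulr_ge0 ?exprn_ge0.
apply: (@le_trans _ _ (\sum_D (g1 D + g2 D))).
  rewrite big_mkcond; apply: ler_sum => -[A B] _; case: ifP => [|_]; last first.
    by rewrite addr_ge0.
  rewrite /bad /= => big; apply: le_trans (few_bound (erefl _)) _ => /=.
  have cA := cardsC A; have cB := cardsC B.
  have [le|lt] := leqP #|B| #|A|.
    apply: (@le_trans _ _ (g1 (A, B))); last by rewrite lerDl.
    have B0 : (0 < #|B|)%N.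
      by have := max_card (mem A); move: big; clear; move: #|_| #|_| #|_|; lia.
    rewrite /g1 /= B0 y0E -exprM mul2n -addnn -exprD.
    apply: ler_wiXn2l => //; rewrite leq_add2r.
    by move: big cA; clear; move: #|_| #|_| #|_| #|_|; lia.
  apply: (@le_trans _ _ (g2 (A, B))); last by rewrite lerDr.
  have A0 : (0 < #|A|)%N.
    by have := max_card (mem B); move: big; clear; move: #|_| #|_| #|_|; lia.
  rewrite /g2 /= A0 y0E -exprM mul2n -addnn -exprD.
  apply: ler_wiXn2l => //; rewrite leq_add2r.
  by move: big cB; clear; move: #|_| #|_| #|_| #|_|; lia.
have S1 := sum_set_pow_le y_ge0 small; have S0 := sum_set0_pow_le y_ge0 small.
have S1' : \sum_(A : {set T}) y ^+ #|~: A| <= 1 + 2 * (w * y).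
  apply: le_trans S1; rewrite (reindex_inj (inv_inj (@setCK T))) /=.
  by under eq_bigr do rewrite setCK.
have S2 : (\sum_(A : {set T}) y ^+ #|~: A|) * (\sum_(B : {set T} | (0 < #|B|)%N) y ^+ #|B|)
    <= 2 * (2 * (w * y)).
  apply: ler_pM => //; try by apply: sumr_ge0 => *; rewrite exprn_ge0.
  by apply: le_trans S1' _; lra.
rewrite big_split /=.
have -> : \sum_D g1 D = (\sum_(A : {set T}) y ^+ #|~: A|) *
    (\sum_(B : {set T} | (0 < #|B|)%N) y ^+ #|B|).
  rewrite -(pair_bigA _ (fun A B => g1 (A, B))) /= mulr_suml; apply: eq_bigr => A _.
  by rewrite mulr_sumr [RHS]big_mkcond.
have -> : \sum_D g2 D = (\sum_(A : {set T}) y ^+ #|~: A|) *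
    (\sum_(B : {set T} | (0 < #|B|)%N) y ^+ #|B|).
  rewrite -(pair_bigA _ (fun A B => g2 (A, B))) /= exchange_big mulr_suml.
  apply: eq_bigr => A _.
  by rewrite mulr_sumr [RHS]big_mkcond.
by lra.
Qed.

End RandomDense.

(** * Permutations with many cycles *)

Section CycleCount.
Local Open Scope group_scope.
Variable T : finType.

(** The transposition inserts the fixed point x into the cycle of y. *)
Lemma porbits_mul_fix (s : {perm T}) x y : x != y -> s x = x ->
  #|porbits (tperm x y * s)|.+1 = #|porbits s|.
Proof.
move=> xy sx; have := porbits_mul_tperm s x y; rewrite xy.
have -> : x \notin porbit s y.
  rewrite porbit_sym; apply/porbitP => -[i e]; case/eqP: xy.
  by rewrite e permX; elim: i {e} => //= i <-; rewrite sx.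
by rewrite /= addn1 => /eqP; rewrite addn2 eqSS => /eqP.
Qed.

(** The generating function of cycle numbers at 2, a rising factorial; fixed points outside A give
    the factor 2^(|T| - |A|). Induction removes x from A: a permutation of A is tperm x y * s with s
    fixing x, where y = x keeps the number of cycles and each of the |A| - 1 other choices of y
    lowers it by one. *)
Lemma sum_exp_porbits_on (A : {set T}) :
  ((\sum_(s | perm_on A s) 2 ^ #|porbits s|) * 2 ^ #|A| = 2 ^ #|T| * (#|A|.+1)`!)%N.
Proof.
elim: {A}_.+1 {-2}A (ltnSn #|A|) => // n IH A leA.
have [->|[x xA]] := set_0Vmem A.
  rewrite cards0 muln1 (big_pred1 1) => [|s].
    rewrite muln1; congr (2 ^ _)%N.
    rewrite /porbits card_imset // => x y e.
    have : y \in porbit 1 x by rewrite e porbit_id.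
    by case/porbitP => i ->; rewrite expg1n perm1.
  apply/idP/eqP => [h|->]; last by apply: perm_on1.
  by apply/permP => x; rewrite perm1; apply: out_perm h _; rewrite inE.
have cA : #|A| = #|A :\ x|.+1 by rewrite (cardsD1 x A) xA.
have {leA}lt : (#|A :\ x| < n)%N by rewrite -ltnS -cA.
have {lt} IH := IH _ lt.
rewrite (partition_big (fun s : {perm T} => s^-1 x) (mem A)) /=; last first.
  by move=> s sA; rewrite -(perm_closed _ sA) permKV.
have split y : y \in A -> (\sum_(s | perm_on A s && (s^-1 x == y)) 2 ^ #|porbits s| =
    \sum_(s | perm_on (A :\ x) s) 2 ^ #|porbits (tperm x y * s)|)%N.
  move=> yA; rewrite (reindex_inj (mulgI (tperm x y))) /=; apply: eq_bigl => s.
  have txy : perm_on A (tperm x y).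
    by apply/subsetP => z; rewrite inE; apply: contraR => nz; rewrite tpermD //;
      apply: contraNneq nz => <-.
  apply/andP/idP => [[sA /eqP e]|sA].
    have sx : s x = x by move: e => /(congr1 (tperm x y * s)); rewrite permKV permM tpermR.
    apply/subsetP => z; rewrite !inE => nz; rewrite (contraNneq _ nz) /= => [|->]; last by rewrite sx.
    have s1A : perm_on A s.
      by have := perm_onM txy sA; rewrite mulgA tperm2 mul1g.
    by apply: contraR nz => zA; rewrite (out_perm s1A zA).
  have s1A : perm_on A s by apply: subset_trans sA (subsetDl _ _).
  have sx : s x = x by apply: (out_perm sA); rewrite !inE eqxx.
  split; first exact: perm_onM.
  by apply/eqP/(@perm_inj _ (tperm x y * s)); rewrite permKV permM tpermR sx.
rewrite (eq_bigr _ split) (bigD1 x) //= tperm1.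
under eq_bigr do rewrite mul1g.
set S := (\sum_(s | perm_on (A :\ x) s) 2 ^ #|porbits s|)%N in IH *.
have half y : (y \in A) && (y != x) ->
    (2 * \sum_(s | perm_on (A :\ x) s) 2 ^ #|porbits (tperm x y * s)| = S)%N.
  case/andP=> yA yx; rewrite big_distrr; apply: eq_bigr => s sA /=.
  rewrite -expnS porbits_mul_fix //; first by rewrite eq_sym.
  by apply: (out_perm sA); rewrite !inE eqxx.
have sumhalf : (2 * \sum_(y | (y \in A) && (y != x))
    \sum_(s | perm_on (A :\ x) s) 2 ^ #|porbits (tperm x y * s)| = #|A :\ x| * S)%N.
  rewrite big_distrr (eq_bigr _ half) /= sum_nat_const; congr (_ * _)%N.
  by apply: eq_card => y; rewrite !inE andbC.
rewrite cA expnS mulnA [(_ * 2)%N]mulnC mulnDr sumhalf -mulnDl -mulnA IH.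
by rewrite [RHS in _ = RHS](_ : _ = 2 ^ #|T| * (#|A :\ x|.+2 * (#|A :\ x|.+1)`!))%N ?factS // mulnCA addnC addn2.
Qed.

Lemma sum_exp_porbits : (\sum_(s : {perm T}) 2 ^ #|porbits s| = (#|T|.+1)`!)%N.
Proof.
have := sum_exp_porbits_on setT; rewrite cardsT.
rewrite (eq_bigl xpredT) => [|s]; last by apply/subsetP => x; rewrite inE.
by rewrite mulnC => /eqP; rewrite eqn_pmul2l ?expn_gt0 // => /eqP.
Qed.

Lemma card_many_porbits K :
  (#|[set s : {perm T} | K <= #|porbits s| ]| * 2 ^ K <= (#|T|.+1)`!)%N.
Proof.
rewrite -sum_exp_porbits -sum_nat_const big_mkcond.
apply: leq_sum => s _; rewrite inE; case: ifP => // le.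
by rewrite leq_exp2l.
Qed.

End CycleCount.

(** * Superposing randomly relabelled structures *)

Lemma perm_imset_eq (T : finType) (A B : {set T}) : #|A| = #|B| ->
  exists t : {perm T}, t @: A = B.
Proof.
move=> cAB.
pose l (C : {set T}) := enum C ++ enum (~: C).
have ml C x : x \in l C by rewrite mem_cat !mem_enum inE orbN.
have ul C : uniq (l C).
  rewrite cat_uniq !enum_uniq andbT /=; apply/hasPn => x.
  by rewrite !mem_enum inE.
have sl C : size (l C) = #|T| by rewrite size_cat -!cardE cardsC.
pose f x := nth x (l B) (index x (l A)).
have lt x : index x (l A) < size (l B) by rewrite sl -(sl A) index_mem.
have f_inj : injective f.
  move=> x y; rewrite /f (set_nth_default y) // => /eqP; rewrite nth_uniq // => /eqP e.
  by rewrite -(nth_index x (ml A x)) e (set_nth_default y) ?nth_index // index_mem.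
exists (perm f_inj); apply/eqP; rewrite eqEcard card_imset ?cAB ?leqnn ?andbT; last exact: perm_inj.
apply/subsetP => _ /imsetP[x xA ->]; rewrite permE /f nth_cat.
have iA : index x (l A) < #|A| by rewrite index_cat mem_enum xA cardE index_mem mem_enum.
by rewrite -cardE -cAB iA -mem_enum mem_nth // -cardE -cAB.
Qed.

Section Cover.
Local Open Scope ring_scope.
Variables (n k m : nat) (U : finType) (emb : U -> {set 'I_n}) (g : U -> R).
Hypothesis emb_inj : injective emb.
Hypothesis g01 : forall u, 0 <= g u <= 1.
Hypothesis g_supp : forall u, g u != 0 -> #|emb u| = k.
Hypothesis kn : (k <= n)%N.

Definition slot_weight (s : {perm 'I_n}) (e : {set 'I_n}) : R :=
  \sum_(u | s @: emb u == e) g u.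

Definition slot_density : R := (\sum_u g u) / 'C(n, k)%:R.

Lemma slot_weight_emb s u : slot_weight s (s @: emb u) = g u.
Proof.
rewrite /slot_weight (big_pred1 u) // => v.
by rewrite (inj_eq (imset_inj (@perm_inj _ s))) (inj_eq emb_inj).
Qed.

Lemma slot_weight01 s e : 0 <= slot_weight s e <= 1.
Proof.
have [[u ->]|no] := pselect (exists u, e = s @: emb u).
  by rewrite slot_weight_emb.
rewrite /slot_weight big_pred0 ?lexx ?ler01 // => u.
by apply/negP => /eqP h; apply: no; exists u.
Qed.

Lemma slot_weight_mean (e : {set 'I_n}) : #|e| = k ->
  \sum_(s : {perm 'I_n}) slot_weight s e = n`!%:R * slot_density.
Proof.
move=> ek; pose S e' := \sum_(s : {perm 'I_n}) slot_weight s e'.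
have Sconst (e' : {set 'I_n}) : #|e'| = k -> S e' = S e.
  move=> e'k; have [t te] := perm_imset_eq (etrans e'k (esym ek)).
  rewrite -te /S [RHS](reindex_inj (mulIg t)); apply: eq_bigr => s _.
  apply: eq_bigl => u; rewrite -[RHS](inj_eq (imset_inj (@perm_inj _ t^-1))).
  rewrite -!imset_comp; congr (_ == _); first by apply: eq_imset => x; rewrite /= permM permK.
  by rewrite -[LHS]imset_id; apply: eq_imset => x /=; rewrite permK.
have tot : \sum_(e' : {set 'I_n} | #|e'| == k) S e' = n`!%:R * \sum_u g u.
  rewrite exchange_big /= (eq_bigr (fun=> \sum_u g u)) => [|s _].
    rewrite sumr_const mulr_natl; congr (_ *+ _).
    by rewrite card_Sn.
  rewrite /slot_weight (exchange_big_dep xpredT) //=; apply: eq_bigr => u _.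
  have [gu|gu] := eqVneq (g u) 0; first by rewrite gu big1.
  rewrite (big_pred1 (s @: emb u)) // => e'; rewrite /= [RHS]eq_sym.
  by rewrite andb_idl // => /eqP <-; rewrite card_imset ?(g_supp gu) //; apply: perm_inj.
have cE : #|[pred e' : {set 'I_n} | #|e'| == k]| = 'C(n, k).
  rewrite -[in RHS](card_ord n) -card_draws; apply: eq_card => e'.
  by rewrite !inE.
have : \sum_(e' : {set 'I_n} | #|e'| == k) S e' = S e * 'C(n, k)%:R.
  rewrite (eq_bigr (fun=> S e)) => [|e' /eqP]; last exact: Sconst.
  by rewrite sumr_const mulr_natr; congr (_ *+ _); rewrite -cE.
have C0 : 'C(n, k)%:R != 0 :> R by rewrite pnatr_eq0 -lt0n bin_gt0.
rewrite tot => h; apply: (mulIf C0); rewrite -/(S e) -h /slot_density mulrA divfK //.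
Qed.

(** Only overcoverage is controlled: it decides how thinly an edge of the hypergraph is shared among
    the copies, while the total weight of the copies is fixed. *)
Lemma exists_cover (a : R) : 0 <= a <= 1 / 2 ->
  'C(n, k)%:R * exp (- (2 * a ^+ 2 * (m%:R * slot_density))) < 1 ->
  exists s : {ffun 'I_m -> {perm 'I_n}}, forall e,
    \sum_j slot_weight (s j) e <= (1 + 4 * a) * (m%:R * slot_density).
Proof.
move=> /andP[a0 a1] small; set th := slot_density in small *.
have th0 : 0 <= th.
  by rewrite /th mulr_ge0 ?invr_ge0 ?ler0n // sumr_ge0 // => u _; case/andP: (g01 u).
have mth0 : 0 <= m%:R * th by rewrite mulr_ge0 ?ler0n.
pose w (_ : 'I_m) (_ : {perm 'I_n}) : R := n`!%:R^-1.
have n0 : n`!%:R != 0 :> R by rewrite pnatr_eq0 -lt0n fact_gt0.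
have ww : prob_weight w.
  split=> [i s|i]; first by rewrite invr_ge0 ler0n.
  by rewrite sumr_const card_Sn /w -[LHS]mulr_natl divff.
pose M := (1 + 4 * a) * (m%:R * th).
pose bad e (s : {ffun 'I_m -> {perm 'I_n}}) := M < \sum_j slot_weight (s j) e.
have [s hs] : exists s, ~~ [exists e : {set 'I_n}, (#|e| == k) && bad e s].
  apply: (Pr_lt1_ex ww); apply: le_lt_trans (Pr_union ww _ _) _.
  apply: le_lt_trans _ small.
  have -> : 'C(n, k)%:R * exp (- (2 * a ^+ 2 * (m%:R * th))) =
     \sum_(e : {set 'I_n} | #|e| == k) exp (- (2 * a ^+ 2 * (m%:R * th))).
    rewrite sumr_const mulr_natl; congr (_ *+ _).
    rewrite -[in LHS](card_ord n) -card_draws; apply: eq_card => e'.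
    by rewrite !inE.
  apply: ler_sum => e /eqP ek.
  apply: (@le_trans _ _ (Ex w (fun s => exp (- (a * M)) *
      \prod_j exp (a * slot_weight (s j) e)))).
    apply: (Pr_markov ww) => [s|s]; first by rewrite mulr_ge0 ?exp_ge0 // prodr_ge0 // => *; apply: exp_ge0.
    rewrite /bad => lt; rewrite -exp_sum -mulr_sumr expRM -[leLHS]exp0; apply: exp_mono.
    by rewrite addrC subr_ge0 ler_wpM2l // ltW.
  rewrite ExZ (Ex_prod w (fun _ s => exp (a * slot_weight s e))).
  rewrite (eq_bigr (fun=> \sum_(s : {perm 'I_n}) n`!%:R^-1 * exp (a * slot_weight s e))) //.
  rewrite prodr_const card_ord.
  have le1 : \sum_(s : {perm 'I_n}) n`!%:R^-1 * exp (a * slot_weight s e) <= exp ((a + 2 * a ^+ 2) * th).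
    (* On [0,1] the exponential is replaced by a linear function of the weight, whose mean is
       known. *)
    apply: (@le_trans _ _ (\sum_(s : {perm 'I_n}) n`!%:R^-1 * (1 + (a + 2 * a ^+ 2) * slot_weight s e))).
      apply: ler_sum => s _; rewrite ler_wpM2l ?invr_ge0 ?ler0n //.
      have /andP[x0 x1] := slot_weight01 s e; move: (slot_weight s e) x0 x1 => x x0 x1.
      have := @exp_le_quad (a * x); rewrite mulr_ge0 // => /(_ isT) h.
      apply: le_trans (h _) _; first by nra.
      by have : 0 <= a ^+ 2 * (x * (1 - x)); [rewrite !mulr_ge0 ?sqr_ge0 //; lra|rewrite !expr2; nra].
    rewrite -mulr_sumr big_split /= -mulr_sumr slot_weight_mean // sumr_const card_Sn -/th.
    rewrite mulrDr mulr_natl -mulr_natr.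
    have -> : 1%R *+ n`! = n`!%:R :> R by [].
    apply: le_trans (exp_ge1D _); rewrite le_eqVlt; apply/orP; left; apply/eqP; field.
    by rewrite n0.
  have le2 : 0 <= \sum_(s : {perm 'I_n}) n`!%:R^-1 * exp (a * slot_weight s e).
    by apply: sumr_ge0 => s _; rewrite mulr_ge0 ?exp_ge0 ?invr_ge0 ?ler0n.
  apply: (@le_trans _ _ (exp (- (a * M)) * exp ((a + 2 * a ^+ 2) * th) ^+ m)).
    by rewrite ler_wpM2l ?exp_ge0 // lerXn2r ?nnegrE ?exp_ge0.
  rewrite expRX expRM; apply: exp_mono; rewrite /M -[(_ * th) *+ m]mulr_natl !expr2.
  by rewrite le_eqVlt; apply/orP; left; apply/eqP; ring.
exists s => e; rewrite leNgt; have [ek|ek] := eqVneq #|e| k.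
  by move: hs => /existsPn/(_ e); rewrite ek eqxx.
(* Sets whose size is not k carry no weight in any copy. *)
rewrite -leNgt big1; first by apply: mulr_ge0 => //; lra.
move=> j _; rewrite /slot_weight big1 // => u /eqP eu; apply: contraNeq ek => gu.
by rewrite -eu card_imset ?(g_supp gu) //; apply: perm_inj.
Qed.

End Cover.

Lemma is_ham_cycle_perm n k l (C : {set {set 'I_n}}) (t : {perm 'I_n}) :
  is_ham_cycle k l C -> is_ham_cycle k l [set t @: (e : {set 'I_n}) | e in C].
Proof.
case/existsP => s /andP[/eqP CE /eqP cC]; apply/existsP; exists (t^-1 * s)%g.
rewrite card_imset ?cC ?eqxx ?andbT; last by apply: imset_inj; apply: perm_inj.
rewrite {1}CE -imset_comp; apply/eqP/eq_imset => i /=; apply/setP => v.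
by rewrite -[v](permKV t) mem_imset ?inE ?permM ?permK //; apply: perm_inj.
Qed.

(** * Distributing the edges of the hypergraph over the copies *)

Section Master.
Local Open Scope ring_scope.
Variables (n k l m r : nat) (U : finType) (emb : U -> {set 'I_n}) (g h : U -> R).
Variables (p q0 D delta : R) (s : {ffun 'I_m -> {perm 'I_n}}).
Hypothesis emb_inj : injective emb.
Hypothesis g_supp : forall u, g u != 0 -> #|emb u| = k.
Hypothesis h_le : forall u, 0 <= h u <= q0 * g u.
Hypothesis p01 : 0 <= p <= 1.
Hypothesis q0D : q0 * D <= p.
Hypothesis cover : forall e, \sum_j slot_weight emb g (s j) e <= D.
Hypothesis q0_ge0 : 0 <= q0.
Hypothesis nl : (0 < n %/ l)%N.

Definition ham_packing (M : {set U}) : Prop :=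
  exists c : 'I_r -> {set U},
    (forall i, is_ham_cycle k l [set emb u | u in c i] && (c i \subset M)) /\
    (forall i j, i != j -> [disjoint c i & c j]).

Hypothesis fail_le :
  Pr (bern h) (fun f => ~~ `[< ham_packing (on_set f) >]) <= delta.

Let hs j e := slot_weight emb h (s j) e.

Lemma hs_ge0 j e : 0 <= hs j e.
Proof. by apply: sumr_ge0 => u _; case/andP: (h_le u). Qed.

(** This leaves a nonnegative probability for an edge that is assigned to no copy. *)
Lemma hs_sum e : \sum_j hs j e <= p.
Proof.
apply: le_trans q0D; apply: le_trans (ler_wpM2l q0_ge0 (cover e)).
rewrite mulr_sumr; apply: ler_sum => j _; rewrite mulr_sumr; apply: ler_sum => u _.
by case/andP: (h_le u).
Qed.

Lemma h_supp u : h u != 0 -> #|emb u| = k.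
Proof.
move=> hu; apply: g_supp; apply: contraNneq hu => gu.
by have := h_le u; rewrite gu mulr0 -eq_le eq_sym.
Qed.

(** The hypergraph and the assignment of its edges are drawn at once: [None] is a non-edge,
    [Some None] an edge given to no copy, [Some (Some j)] an edge given to copy j. The probabilities
    are chosen so that copy j sees exactly the weights [h] on its slots. *)
Definition label_weight (e : {set 'I_n}) (a : option (option 'I_m)) : R :=
  match a with
  | None => if #|e| == k then 1 - p else 1
  | Some None => if #|e| == k then p - \sum_j hs j e else 0
  | Some (Some j) => hs j e
  end.

Lemma hs0 j (e : {set 'I_n}) : #|e| != k -> hs j e = 0.
Proof.
move=> ek; rewrite /hs /slot_weight big1 // => u /eqP eu; apply: contraNeq ek => hu.
by rewrite -eu card_imset ?(h_supp hu) //; apply: perm_inj.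
Qed.

Lemma big_option (I : finType) (F : option I -> R) :
  \sum_a F a = F None + \sum_i F (Some i).
Proof.
rewrite (bigD1 None) //=; congr (_ + _).
rewrite (reindex_omap (fun i : I => Some i) id) /=; last by case.
by apply: eq_bigl => i; rewrite eqxx.
Qed.

Lemma label_weightP : prob_weight label_weight.
Proof.
split=> [e a|e].
  have := hs_sum e; case/andP: p01 => p0 p1 le.
  case: a => [[j|]|] /=; first exact: hs_ge0.
    by case: ifP => // _; rewrite subr_ge0.
  by case: ifP => // _; rewrite subr_ge0.
rewrite !big_option /=; case: ifPn => ek; first by ring.
by rewrite big1 ?add0r ?addr0 // => j _; apply: hs0.
Qed.

Definition label_support (f : {ffun {set 'I_n} -> option (option 'I_m)}) : {set {set 'I_n}} :=
  [set e | f e != None].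

Lemma kgraph_prod (H : {set {set 'I_n}}) :
  \prod_e bern (fun e : {set 'I_n} => if #|e| == k then p else 0) e (e \in H) =
  if kgraph k H then hyp_weight k p H else 0.
Proof.
case: ifPn => [/forallP kH|].
  have HE : #|H| + #|[set e : {set 'I_n} | #|e| == k] :\: H| = 'C(n, k).
    rewrite -[in RHS](card_ord n) -card_draws -[RHS](cardsID H); congr (_ + _)%N.
    apply: eq_card => e; rewrite !inE; have := kH e; case: (e \in H) => /=; last by rewrite andbF.
    by move=> ->.
  rewrite /hyp_weight !RealsE -HE addKn.
  rewrite (bigID (mem H)) /=; congr (_ * _).
    rewrite -prodr_const; apply: eq_bigr => e eH; rewrite /bern eH.
    by have := kH e; rewrite eH => /= ->.
  rewrite (bigID (fun e : {set 'I_n} => #|e| == k)) /= [X in _ * X]big1 ?mulr1.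
    rewrite -prodr_const; apply: eq_big => [e|e /andP[nH ek]]; first by rewrite !inE.
    by rewrite /bern (negbTE nH) ek.
  by move=> e /andP[nH ek]; rewrite /bern (negbTE nH) (negbTE ek) subr0.
rewrite negb_forall => /existsP[e]; rewrite negb_imply => /andP[eH ek].
by rewrite (bigD1 e) //= /bern eH (negbTE ek) mul0r.
Qed.

(** Forgetting which copy an edge was given to recovers H(n,p,k). *)
Lemma prob_H_labels (E : {set {set 'I_n}} -> Prop) :
  prob_H k p E = Pr label_weight (fun f => `[< E (label_support f) >]).
Proof.
pose F (f : {ffun {set 'I_n} -> bool}) : R := (`[< E (on_set f) >])%:R.
transitivity (Ex (bern (fun e : {set 'I_n} => if #|e| == k then p else 0)) F).
  rewrite /prob_H /Ex (reindex (fun H : {set {set 'I_n}} => [ffun e => e \in H])) /=; last first.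
    exists (fun f => on_set f) => [H _|f _]; first by apply/setP => e; rewrite inE ffunE.
    by apply/ffunP => e; rewrite ffunE inE.
  rewrite [LHS]big_mkcond; apply: eq_bigr => H _.
  rewrite (eq_bigr (fun e => bern (fun e : {set 'I_n} => if #|e| == k then p else 0) e (e \in H))); last first.
    by move=> e _; rewrite ffunE.
  rewrite kgraph_prod /F; have -> : on_set [ffun e => e \in H] = H.
    by apply/setP => e; rewrite inE ffunE.
  case: ifP => _; last by rewrite mul0r.
  case: excluded_middle_informative => h1; first by rewrite asboolT ?mulr1.
  by rewrite asboolF ?mulr0.
rewrite -(@Ex_pull _ _ _ _ label_weight id (fun _ a => a != None)) //.
- apply: eq_Ex => f; rewrite /F; congr ((asbool (E _))%:R).
  by apply/setP => e; rewrite !inE ffunE.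
- exact: label_weightP.
move=> e [] /=; rewrite big_mkcond !big_option /=; last first.
  by rewrite big1 // !addr0 /bern; case: ifP => // _; rewrite subr0.
rewrite add0r; case: ifPn => ek; first by ring.
by rewrite add0r big1 // => j _; apply: hs0.
Qed.

(** A union bound over the copies, so their dependence is harmless. Cycles of different copies are
    disjoint because an edge has one label. *)
Theorem master_bound (b : R) : b <= (m * r)%:R ->
  1 - m%:R * delta <= @prob_H n k p (has_disjoint_ham_cycles k l b).
Proof.
move=> b_le; rewrite prob_H_labels.
pose Mj (j : 'I_m) (f : {ffun {set 'I_n} -> option (option 'I_m)}) : {set U} :=
  [set u | f (s j @: emb u) == Some (Some j)].
pose bad j f := ~~ `[< ham_packing (Mj j f) >].
have ww := label_weightP.
have badj j : Pr label_weight (bad j) <= delta.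
  apply: le_trans fail_le; rewrite le_eqVlt; apply/orP; left; apply/eqP.
  rewrite /Pr -(@Ex_pull _ _ _ _ label_weight (fun u => s j @: emb u)
     (fun _ a => a == Some (Some j))) //.
  - apply: eq_Ex => f; rewrite /bad; congr ((~~ (asbool (ham_packing _)))%:R).
    by apply/setP => u; rewrite !inE ffunE.
  - exact: inj_comp (imset_inj (@perm_inj _ (s j))) emb_inj.
  have hE u : hs j (s j @: emb u) = h u by apply: slot_weight_emb.
  have tot u := ww.2 (s j @: emb u).
  move=> u [] /=.
    by rewrite (big_pred1 (Some (Some j))) //= hE.
  have := tot u; rewrite (bigID (fun a => a == Some (Some j))) /=.
  rewrite (big_pred1 (Some (Some j))) //= hE => /esym e1.
  rewrite /bern e1 addrAC subrr add0r; apply: eq_bigl => a.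
  by rewrite eqbF_neg.
have anybad : Pr label_weight (fun f => [exists j, true && bad j f]) <= m%:R * delta.
  apply: le_trans (Pr_union ww _ _) _.
  rewrite mulr_natl -[in leRHS](card_ord m) -sumr_const.
  by apply: ler_sum => j _; apply: badj.
rewrite -[leLHS]opprB opprB -subr_ge0 opprB.
suff : 1 - Pr label_weight (fun f => `[< has_disjoint_ham_cycles k l b (label_support f) >])
   <= m%:R * delta by lra.
rewrite -(PrC ww); apply: le_trans anybad; apply: (Pr_le ww) => f.
apply: contraNT => /existsPn nobad; apply/asboolP.
have packs j : ham_packing (Mj j f) by have := nobad j; rewrite /bad negbK => /asboolP.
have [c cP] := choice packs.
pose C (x : 'I_m * 'I_r) : {set {set 'I_n}} := [set s x.1 @: emb u | u in c x.1 x.2].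
have hamC x : is_ham_cycle k l (C x).
  have [h1 _] := cP x.1; have /andP[hc _] := h1 x.2.
  have := is_ham_cycle_perm (s x.1) hc; rewrite /C -imset_comp.
  by congr is_ham_cycle; apply: eq_imset.
have labC x e : e \in C x -> f e = Some (Some x.1).
  case/imsetP => u uc ->; have [h1 _] := cP x.1; have /andP[_ /subsetP sub] := h1 x.2.
  by have := sub _ uc; rewrite inE => /eqP.
have disC x y : x != y -> [disjoint C x & C y].
  move=> xy; rewrite -setI_eq0; apply/eqP/setP => e; rewrite !inE; apply/negP => /andP[ex ey].
  have := labC _ _ ex; rewrite (labC _ _ ey) => -[e1].
  case: x y xy e1 ex ey => [j i] [j' i'] /= xy e1; rewrite {}e1 in xy *.
  move=> /imsetP[u uc ->] /imsetP[v vc] /(imset_inj (@perm_inj _ _)) /emb_inj uv.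
  have [_ h2] := cP j; have ii : i != i' by apply: contraNneq xy => ->.
  have := h2 _ _ ii; rewrite -setI_eq0 => /eqP/setP/(_ u); rewrite !inE uc /= uv vc //.
(* Disjoint cycles are distinct as soon as they are nonempty, so the family really has m r
   members. *)
have C_inj : injective C.
  move=> x y e; apply/eqP; apply: contraT => xy; have := disC _ _ xy.
  rewrite e -setI_eq0 setIid => /eqP C0; have := hamC y; rewrite C0.
  by case/existsP => t /andP[_ /eqP]; rewrite cards0 => e0; have := nl; rewrite -e0.
exists [set C x | x in setT]; split; [|split].
- move=> _ /imsetP[x _ ->]; rewrite hamC /=; apply/subsetP => e eC.
  by rewrite inE (labC _ _ eC).
- by move=> _ _ /imsetP[x _ ->] /imsetP[y _ ->] xy; apply: disC; apply: contraNneq xy => ->.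
- apply/RleP; rewrite INRE card_imset // cardsT card_prod !card_ord //.
Qed.

End Master.

(** * Overlap less than half of an edge *)

Lemma succ_mod_neq nu x : 1 < nu -> x < nu -> x.+1 %% nu != x.
Proof.
move=> nu1 xnu; have [xn|xn] := ltnP x.+1 nu; first by rewrite modn_small //; lia.
have xE : x.+1 = nu by lia.
by rewrite xE modnn; lia.
Qed.

Lemma succ_succ_mod_neq nu x : 2 < nu -> x < nu -> (x.+1 %% nu).+1 %% nu != x.
Proof.
move=> nu2 xnu; apply/eqP; have [xn|xn] := ltnP x.+1 nu.
  rewrite [x.+1 %% nu]modn_small //; have [xn2|xn2] := ltnP x.+2 nu; first by rewrite modn_small //; lia.
  have -> : x.+2 = nu by lia.
  by rewrite modnn; lia.
have -> : x.+1 = nu by lia.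
by rewrite modnn modn_small //; lia.
Qed.

Section HamEdges.
Variables (n k l : nat).
Hypothesis (l0 : 0 < l) (lk : l <= k) (k2l : k <= 2 * l) (ln : l %| n).
Hypothesis nu3 : 2 < n %/ l.
Let nu := n %/ l.

Lemma nuE : n = nu * l. Proof. by rewrite divnK. Qed.

Definition base_edge (x : 'I_nu) : {set 'I_n} := ham_edge k l (1%g : {perm 'I_n}) x.

(** As k <= 2l, an edge is block x followed by an initial part of the next block, and cyclic
    arithmetic reduces to comparing blocks. *)
Lemma base_edgeE (x : 'I_nu) (v : 'I_n) :
  (v \in base_edge x) = (v %/ l == x) || ((v %/ l == x.+1 %% nu) && (v %% l < k - l)).
Proof.
rewrite inE perm1; apply/hasP/orP => [[j]|].
  rewrite mem_iota add0n => /andP[_ jk] /eqP <-.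
  have [jl|jl] := ltnP j l.
    left; rewrite modn_small; first by rewrite divnMDl // divn_small // addn0.
    by have := ltn_ord x; rewrite nuE; nia.
  right; have jE := subnKC jl; set i := j - l in jE.
  have il : i < l by lia.
  have -> : x * l + j = x.+1 * l + i by rewrite -jE; lia.
  have [xn|xn] := ltnP x.+1 nu.
    rewrite [_ %% nu]modn_small // modn_small; last by rewrite nuE; nia.
    by rewrite divnMDl // divn_small // addn0 eqxx modnMDl modn_small //=; lia.
  have -> : x.+1 = nu by have := ltn_ord x; lia.
  rewrite modnn -nuE modnDl modn_small; last by rewrite nuE; nia.
  by rewrite divn_small // eqxx /= modn_small //; lia.
have vE := divn_eq v l; have vl := ltn_pmod v l0; case=> [/eqP e|/andP[/eqP e lt]].
  exists (v %% l); first by rewrite mem_iota; lia.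
  by rewrite -e -vE modn_small.
exists (l + v %% l); first by rewrite mem_iota; lia.
have [xn|xn] := ltnP x.+1 nu.
  rewrite modn_small // in e.
  have -> : x * l + (l + v %% l) = x.+1 * l + v %% l by lia.
  by rewrite -e -vE modn_small.
have xE : x.+1 = nu by have := ltn_ord x; lia.
have -> : x * l + (l + v %% l) = n + v %% l.
  by have E2 : x.+1 * l = n; [rewrite xE -nuE|move: E2; rewrite mulSn; clear; lia].
rewrite xE modnn in e; have e2 : v %% l = v by rewrite [RHS]vE e.
by rewrite modnDl e2 modn_small.
Qed.

Lemma card_block_part a c : a < nu -> c <= l ->
  #|[set v : 'I_n | (v %/ l == a) && (v %% l < c)]| = c.
Proof.
move=> an cl; have lt (j : 'I_c) : a * l + j < n.
  by have := ltn_ord j; rewrite nuE; nia.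
rewrite -[RHS]card_ord -(card_imset _ (f := fun j : 'I_c => Ordinal (lt j))).
  apply: eq_card => v; rewrite !inE; apply/andP/imsetP => [[/eqP e vc]|[j _ ->]] /=.
    by exists (Ordinal vc) => //; apply: val_inj; rewrite /= {1}(divn_eq v l) e.
  have jl : j < l by apply: leq_trans cl.
  by rewrite divnMDl // divn_small // addn0 modnMDl modn_small // eqxx.
by move=> i j [] /eqP; rewrite eqn_add2l => /eqP /val_inj.
Qed.

Lemma card_base_edge x : #|base_edge x| = k.
Proof.
have -> : base_edge x = [set v : 'I_n | (v %/ l == x) && (v %% l < l)] :|:
   [set v : 'I_n | (v %/ l == x.+1 %% nu) && (v %% l < k - l)].
  by apply/setP => v; rewrite base_edgeE !inE ltn_pmod // andbT.
rewrite cardsU !card_block_part //; [|by rewrite ltn_pmod //; have := nu3; rewrite -/nu; lia|lia].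
rewrite (_ : _ :&: _ = set0) ?cards0; first by lia.
apply/setP => v; rewrite !inE; apply/negP => /andP[/andP[/eqP e1 _] /andP[/eqP e2 _]].
by have := succ_mod_neq (ltnW nu3) (ltn_ord x); rewrite -/nu -e2 e1 eqxx.
Qed.

End HamEdges.

Section ShortOverlap.
Variables (n k l : nat).
Hypothesis (l1 : 1 < l) (lk : l <= k) (k2l : k < 2 * l) (ln : l %| n).
Hypothesis nu3 : 2 < n %/ l.
Let nu := n %/ l.

Let l0 : 0 < l. Proof. exact: ltnW. Qed.
Let k2l' : k <= 2 * l. Proof. exact: ltnW. Qed.

Lemma free_lt (y : 'I_nu) : y * l + l.-1 < n.
Proof. by rewrite (nuE ln); have := ltn_ord y; rewrite -/nu; nia. Qed.

(* The last vertex of the y-th block lies in a single edge of the cyclic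
   arrangement, so these vertices may be permuted freely among the edges. *)
Definition free_vertex (y : 'I_nu) : 'I_n := Ordinal (free_lt y).

Lemma free_vertex_inj : injective free_vertex.
Proof.
move=> x y /(congr1 val) /= /eqP; rewrite eqn_add2r eqn_pmul2r; last exact: l0.
by move=> /eqP; apply: val_inj.
Qed.

Lemma free_vertexE y : (free_vertex y %/ l = y) * (free_vertex y %% l = l.-1).
Proof.
have h : l.-1 < l by lia.
by split; rewrite /= ?divnMDl ?modnMDl // ?divn_small ?modn_small ?addn0.
Qed.

Lemma free_base_edge x y : (free_vertex y \in base_edge k x) = (y == x).
Proof.
rewrite (base_edgeE l0 lk k2l' ln nu3) !free_vertexE.
by rewrite (_ : _ < _ = false) ?andbF ?orbF //; lia.
Qed.

(** Edge u.1 with its free vertex replaced by that of block u.2; the pairs form a complete bipartite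
    graph between edges and free vertices. *)
Definition slot_edge (u : 'I_nu * 'I_nu) : {set 'I_n} :=
  tperm (free_vertex u.1) (free_vertex u.2) @: base_edge k u.1.

Lemma card_slot_edge u : #|slot_edge u| = k.
Proof.
by rewrite card_imset ?(card_base_edge l0 lk k2l' ln nu3) //; apply: perm_inj.
Qed.

Lemma slot_edgeE u v : (v \in slot_edge u) =
  ((v \in base_edge k u.1) && (v != free_vertex u.1)) || (v == free_vertex u.2).
Proof.
rewrite /slot_edge -{1}[v](tpermK (free_vertex u.1) (free_vertex u.2)).
rewrite mem_imset; last exact: perm_inj.
case: tpermP => [->|->|/eqP n1 /eqP n2].
- by rewrite eqxx andbF /= free_base_edge (inj_eq free_vertex_inj) eq_sym.
- by rewrite free_base_edge !eqxx orbT.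
- by rewrite n1 (negbTE n2) andbT orbF.
Qed.

(** The second component is the only free vertex in the slot. Blocks begin with a vertex that is not
    free, as l > 1; if two first components gave the same slot, each would be the cyclic successor
    of the other, impossible with more than two blocks. *)
Lemma slot_edge_inj : injective slot_edge.
Proof.
move=> [x y] [x' y'] e.
have ey : y = y'.
  have := slot_edgeE (x, y) (free_vertex y'); rewrite e slot_edgeE /= eqxx orbT.
  rewrite free_base_edge !(inj_eq free_vertex_inj).
  by case: (eqVneq y' x) => //= _ /esym /eqP.
rewrite -{}ey in e *; congr pair; apply/eqP; apply: contraT => xx'.
have start_lt (z : 'I_nu) : z * l < n.
  by rewrite (nuE ln) ltn_pmul2r //; apply: ltn_ord.
have aux (z z' : 'I_nu) : z != z' -> slot_edge (z, y) = slot_edge (z', y) ->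
    z'.+1 %% nu = z.
  move=> zz' ez; pose v : 'I_n := Ordinal (start_lt z).
  have nf t : v != free_vertex t.
    apply/eqP => /(congr1 val) /= ev.
    have := congr1 (modn^~ l) ev; rewrite modnMl modnMDl modn_small; lia.
  have := slot_edgeE (z, y) v; rewrite ez slot_edgeE /= !nf !andbT (negbTE (nf y)) !orbF.
  rewrite !(base_edgeE l0 lk k2l' ln nu3) /= mulnK // eqxx /= (inj_eq val_inj) (negbTE zz') /=.
  by case/andP => /eqP ->.
have e1 := aux _ _ xx' e; have e2 := aux x' x; rewrite eq_sym xx' in e2.
by have := succ_succ_mod_neq nu3 (ltn_ord x'); rewrite -/nu e1 (e2 isT (esym e)) eqxx.
Qed.

Definition move_free (f : {perm 'I_nu}) (v : 'I_n) : 'I_n :=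
  if [pick y | v == free_vertex y] is Some y then free_vertex (f y) else v.

Lemma move_freeE f y : move_free f (free_vertex y) = free_vertex (f y).
Proof.
rewrite /move_free; case: pickP => [z /eqP/free_vertex_inj -> //|/(_ y)].
by rewrite eqxx.
Qed.

Lemma move_free_id f v : (forall y, v != free_vertex y) -> move_free f v = v.
Proof. by move=> nf; rewrite /move_free; case: pickP => // z; rewrite (negbTE (nf z)). Qed.

Lemma move_free_inj f : injective (move_free f).
Proof.
have cases v : (exists y, v = free_vertex y) \/ forall y, v != free_vertex y.
  case: (pickP (fun y => v == free_vertex y)) => [y /eqP|h]; first by left; exists y.
  by right=> y; rewrite h.
move=> u v; case: (cases u) => [[y ->]|nu']; case: (cases v) => [[z ->]|nv].
- by rewrite !move_freeE => /free_vertex_inj/perm_inj ->.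
- by rewrite move_freeE move_free_id // => e; have := nv (f y); rewrite -e eqxx.
- by rewrite move_freeE move_free_id // => e; have := nu' (f z); rewrite e eqxx.
- by rewrite !move_free_id.
Qed.

(** An edge contains one free vertex only, so on it the transposition agrees with the single
    permutation [move_free f]. The slots of a matching are thus the base cycle relabelled. *)
Lemma slot_edge_move (f : {perm 'I_nu}) x :
  slot_edge (x, f x) = perm (@move_free_inj f) @: base_edge k x.
Proof.
apply: eq_in_imset => v vx; rewrite permE /=.
case: (pickP (fun y => v == free_vertex y)) => [y /eqP ev|h].
  by move: vx; rewrite ev free_base_edge => /eqP ->; rewrite tpermL move_freeE.
by rewrite tpermD ?move_free_id // => [y||]; rewrite ?h // eq_sym h.
Qed.

Lemma base_edge_inj : injective (fun x : 'I_nu => base_edge k x : {set 'I_n}).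
Proof.
move=> x y e; apply/eqP; rewrite -free_base_edge -e free_base_edge eqxx //.
Qed.

Lemma base_ham_cycle : is_ham_cycle k l [set base_edge k x | x : 'I_nu].
Proof.
apply/existsP; exists 1%g; rewrite eqxx /=.
by rewrite card_imset ?card_ord //; apply: base_edge_inj.
Qed.

Lemma matching_ham_cycle (f : {perm 'I_nu}) :
  is_ham_cycle k l [set slot_edge u | u in [set (x, f x) | x : 'I_nu]].
Proof.
have := is_ham_cycle_perm (perm (@move_free_inj f)) base_ham_cycle.
rewrite -!imset_comp; congr is_ham_cycle; apply: eq_imset => x /=.
by rewrite slot_edge_move.
Qed.

Lemma dense_ham_packing r (M : {set 'I_nu * 'I_nu}) :
  dense r M -> ham_packing k l r slot_edge M.
Proof.
move=> /dense_packing[f [fM fd]]; exists (fun i => [set (x, f i x) | x : 'I_nu]); split.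
  move=> i; rewrite matching_ham_cycle /=; apply/subsetP => _ /imsetP[x _ ->].
  exact: fM.
move=> i j ij; rewrite -setI_eq0; apply/eqP/setP => e; rewrite !inE.
apply/negP => /andP[/imsetP[x _ ->] /imsetP[y _ [<-]]] /fd eij.
by rewrite eij eqxx in ij.
Qed.

End ShortOverlap.

(** * Sprinkling edges one at a time *)

Section Online.
Local Open Scope ring_scope.
Variables (U : finType) (q : U -> R) (b : R) (U2 : {set U}).
Hypothesis q01 : forall u, 0 <= q u <= 1.
Hypothesis b01 : 0 <= b <= 1.
Hypothesis qb : forall u, u \in U2 -> q u = b.

Lemma Pr_avoid (S : {set U}) : S \subset U2 ->
  Pr (bern q) (fun f => [disjoint on_set f & S]) = (1 - b) ^+ #|S|.
Proof.
move=> /subsetP sS.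
transitivity (Ex (bern q) (fun f => \prod_u (if (u \in S) && f u then 0 else 1))).
  apply: eq_Ex => f; case: (boolP [disjoint _ & _]) => [dis|].
    rewrite big1 // => u _; case: ifP => // /andP[uS fu].
    by move: dis; rewrite disjoint_subset => /subsetP/(_ u); rewrite !inE fu uS => /(_ isT).
  rewrite -setI_eq0 => /set0Pn[u]; rewrite !inE => /andP[fu uS].
  by rewrite (bigD1 u) //= uS fu mul0r.
rewrite (Ex_prod _ (fun u a => if (u \in S) && a then 0 else 1)).
rewrite -prodr_const [RHS]big_mkcond; apply: eq_bigr => u _.
rewrite big_bool /bern; case: (boolP (u \in S)) => uS /=; last by ring.
by rewrite (qb (sS _ uS)); ring.
Qed.

Variables (St : Type) (prog : St -> nat) (used : St -> {set U}) (valid : St -> Prop).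
Variables (J M0 : nat).
Hypothesis step : forall S, valid S -> (prog S < J)%N ->
  (exists S', [/\ valid S', (prog S < prog S')%N & used S' \subset used S]) \/
  exists B : {set U}, [/\ B \subset U2, (M0 <= #|B|)%N & forall u, u \in B ->
    exists S', [/\ valid S', (prog S < prog S')%N & used S' \subset u |: used S]].

Definition reaches S (f : {ffun U -> bool}) : Prop :=
  exists S', [/\ valid S', (J <= prog S')%N & used S' \subset used S :|: on_set f].

(* Union bound over the choices of the sprinkled edge used at each step: the
   booster set B of a state depends only on the edges used so far. *)
Lemma online_bound j S : valid S -> (J <= prog S + j)%N ->
  Pr (bern q) (fun f => ~~ `[< reaches S f >]) <= (1 - b) ^+ M0 * (1 + #|U2|%:R) ^+ j.
Proof.
have ww := bern_weight q01; have /andP[b0 b1] := b01.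
have d0 : 0 <= (1 - b) ^+ M0 by rewrite exprn_ge0 // subr_ge0.
have u0 : 0 <= #|U2|%:R :> R by rewrite ler0n.
have R0 i : 0 <= (1 - b) ^+ M0 * (1 + #|U2|%:R) ^+ i.
  by rewrite mulr_ge0 // exprn_ge0 // addr_ge0.
have reached S' : valid S' -> (J <= prog S')%N ->
    Pr (bern q) (fun f => ~~ `[< reaches S' f >]) = 0.
  move=> vS JS; rewrite -[RHS](Ex_cst ww 0); apply: eq_Ex => f.
  by rewrite asboolT //; exists S'; split=> //; apply: subsetUl.
elim: j S => [|j IH] S vS.
  by rewrite addn0 => JS; rewrite reached.
move=> le; have [done|lt] := leqP J (prog S).
  by rewrite reached.
case: (step vS lt) => [[S' [vS' pS' uS']]|[B [BU MB hB]]].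
  have le' : (J <= prog S' + j)%N by apply: leq_trans le _; rewrite addnS -addSn leq_add2r.
  apply: (@le_trans _ _ (Pr (bern q) (fun f => ~~ `[< reaches S' f >]))).
    apply: (Pr_le ww) => f; apply: contraNN => /asboolP[S2 [v2 p2 us2]].
    apply/asboolP; exists S2; split => //; apply: subset_trans us2 _.
    exact: setSU.
  apply: le_trans (IH _ vS' le') _; rewrite ler_wpM2l // exprS ler_peMl //.
    by rewrite exprn_ge0 // addr_ge0.
  by rewrite lerDl.
have hB' u : exists S', u \in B ->
    [/\ valid S', (prog S < prog S')%N & used S' \subset u |: used S].
  case: (boolP (u \in B)) => [/hB[S' h]|_]; first by exists S'.
  by exists S.
have [nxt nxtP] := choice hB'.
(* If the run fails, either no booster is sprinkled, or the run from the successor state of some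
   booster fails. The second event forgets that this booster is present, so the induction hypothesis
   applies without conditioning. *)
apply: (@le_trans _ _ (Pr (bern q) (fun f => [disjoint on_set f & B] ||
    [exists u, (u \in B) && ~~ `[< reaches (nxt u) f >]]))).
  apply: (Pr_le ww) => f; apply: contraNT; rewrite negb_or => /andP[].
  rewrite -setI_eq0 => /set0Pn[u]; rewrite !inE => /andP[fu uB] /existsPn/(_ u).
  rewrite uB negbK => /asboolP[S2 [v2 p2 us2]]; apply/asboolP; exists S2; split => //.
  have [_ _ us] := nxtP u uB; apply: subset_trans us2 _; rewrite subUset subsetUr andbT.
  apply: subset_trans us _; rewrite subUset subsetUl andbT sub1set !inE fu orbT //.
apply: le_trans (PrU ww _ _) _; rewrite Pr_avoid //.
have h1 : (1 - b) ^+ #|B| <= (1 - b) ^+ M0 by rewrite ler_wiXn2l //; lra.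
have h2 : Pr (bern q) (fun f => [exists u, (u \in B) && ~~ `[< reaches (nxt u) f >]]) <=
    #|U2|%:R * ((1 - b) ^+ M0 * (1 + #|U2|%:R) ^+ j).
  apply: le_trans (Pr_union ww _ _) _.
  apply: (@le_trans _ _ (\sum_(u in B) (1 - b) ^+ M0 * (1 + #|U2|%:R) ^+ j)).
    apply: ler_sum => u uB; have [v' p' _] := nxtP u uB; apply: IH => //.
    by apply: leq_trans le _; rewrite addnS -addSn leq_add2r.
  rewrite sumr_const -[leLHS]mulr_natl ler_wpM2r //.
  by rewrite ler_nat subset_leq_card.
apply: le_trans (lerD h1 h2) _; rewrite exprS.
have h3 : 1 <= (1 + #|U2|%:R) ^+ j :> R by rewrite exprn_ege1 // lerDl.
have : (1 - b) ^+ M0 * 1 <= (1 - b) ^+ M0 * (1 + #|U2|%:R) ^+ j by rewrite ler_wpM2l.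
by move: ((1 + #|U2|%:R) ^+ j) ((1 - b) ^+ M0) => x y; lra.
Qed.

End Online.

(** * Degrees and expansion in graphs given as sets of pairs *)

Section PairSets.
Variable V : finType.
Implicit Types (E G : {set {set V}}) (W : {set V}) (c : seq V) (u : {set V}).

Definition edge_rel_of E : rel V := [rel x y | (x != y) && ([set x; y] \in E)].

Definition perm_edges (s : {perm V}) : {set {set V}} :=
  [set [set x; s x] | x in [set x | x != s x]].

Definition cycle_edges c : {set {set V}} := [set [set x; next c x] | x in c].

Definition incident E v := [set u in E | v \in u].

Definition inner_edges E W := [set u in E | u \subset W].

Lemma set2C (x y : V) : [set x; y] = [set y; x].
Proof. exact: setUC. Qed.

Lemma edge_rel_of_sym E : symmetric (edge_rel_of E).
Proof. by move=> x y; rewrite /edge_rel_of /= eq_sym set2C. Qed.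

Lemma incident_image (P : {pred V}) (f g : V -> V) v : cancel f g ->
  #|incident [set [set x; f x] | x in P] v| <= 2.
Proof.
move=> fK; apply: (@leq_trans #|[set [set v; f v]; [set g v; v]]|); last first.
  by rewrite cards2; case: (_ != _).
apply: subset_leq_card; apply/subsetP => u; rewrite inE => /andP[/imsetP[x _ ->]].
rewrite !inE => /orP[/eqP->|/eqP->]; first by rewrite eqxx.
by rewrite fK eqxx orbT.
Qed.

Lemma incident_perm (s : {perm V}) v : #|incident (perm_edges s) v| <= 2.
Proof.
exact: incident_image (permK s).
Qed.

Lemma incident_cycle c v : uniq c -> #|incident (cycle_edges c) v| <= 2.
Proof.
by move=> uc; apply: incident_image (prev_next uc).
Qed.

Lemma incident_sub E E' v : E \subset E' -> #|incident E v| <= #|incident E' v|.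
Proof.
move=> /subsetP sE; apply: subset_leq_card; apply/subsetP => u; rewrite !inE.
by case/andP => /sE -> ->.
Qed.

Lemma incidentD E E' v : #|incident E v| <= #|incident (E :\: E') v| + #|incident E' v|.
Proof.
apply: leq_trans (leq_card_setU _ _); apply: subset_leq_card; apply/subsetP => u.
by rewrite !inE => /andP[-> ->]; rewrite andbT; case: (u \in E').
Qed.

Lemma incident_bigcup (I : finType) (P : pred I) (F : I -> {set {set V}}) v :
  #|incident (\bigcup_(i | P i) F i) v| <= \sum_(i | P i) #|incident (F i) v|.
Proof.
have -> : incident (\bigcup_(i | P i) F i) v = \bigcup_(i | P i) incident (F i) v.
  apply/setP => u; rewrite !inE; apply/andP/bigcupP => [[/bigcupP[i Pi uF] vu]|[i Pi]].
    by exists i; rewrite ?inE ?uF.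
  by rewrite inE => /andP[uF vu]; split=> //; apply/bigcupP; exists i.
elim/big_ind2: _ => [|A a B b0 h1 h2|//]; first by rewrite cards0.
exact: leq_trans (leq_card_setU _ _) (leq_add h1 h2).
Qed.

(** If W = S with its neighbours had size at most 3|S|, all E-edges at S would lie in W, making at
    least d|S|/2 >= d|W|/6 inner edges. Sparsity is asked of G and degrees of E, so expansion
    survives the deletion of used edges. *)
Lemma sparse_expand G E d s0 : E \subset G -> (forall u, u \in E -> #|u| = 2) ->
  (forall v, d <= #|incident E v|) ->
  (forall W, 0 < #|W| <= 3 * s0 -> 6 * #|inner_edges G W| < #|W| * d) ->
  forall S : {set V}, 0 < #|S| <= s0 -> 3 * #|S| < #|S :|: nbhd (edge_rel_of E) S|.
Proof.
move=> /subsetP sE E2 dE sparse S /andP[S0 Ss0]; rewrite ltnNge; apply/negP => le.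
set W := S :|: _ in le.
have W0 : 0 < #|W| by apply: leq_trans S0 (subset_leq_card (subsetUl _ _)).
have := sparse W; rewrite W0 (leq_trans le) ?leq_mul2l //= => /(_ isT).
apply/negP; rewrite -leqNgt.
have h1 : #|S| * d <= \sum_(v in S) #|incident E v|.
  by rewrite -sum_nat_const; apply: leq_sum => v _; apply: dE.
have h2 : \sum_(v in S) #|incident E v| <= \sum_(u in inner_edges G W) 2.
  under eq_bigr do rewrite -sum1_card.
  rewrite (exchange_big_dep (mem (inner_edges G W))) /=; last first.
    move=> v u vS; rewrite !inE => /andP[uE vu]; rewrite (sE _ uE) /=.
    have /eqP/cards2P[x [y [xy ue]]] := E2 _ uE.
    rewrite {}ue in uE vu *.
    have aux a b : a != b -> [set a; b] \in E -> a \in S -> [set a; b] \subset W.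
      move=> ab abE aS; apply/subsetP => z; rewrite !inE => /orP[/eqP->|/eqP->].
        by rewrite aS.
      by apply/orP; right; apply/existsP; exists a; rewrite aS /edge_rel_of /= ab abE.
    case/set2P: vu => e; first by apply: aux => //; rewrite -e.
    by rewrite set2C; apply: aux; [rewrite eq_sym | rewrite set2C | rewrite -e].
  apply: leq_sum => u uG; rewrite sum1_card.
  have [uE|nuE] := boolP (u \in E); last first.
    rewrite (eq_card0 (A := _)) // => v; rewrite unfold_in /= !inE (negbTE nuE) /= andbF //.
  rewrite -(E2 _ uE); apply: subset_leq_card; apply/subsetP => v.
  by rewrite unfold_in /= !inE => /andP[_ /andP[]].
rewrite sum_nat_const in h2; have h3 := leq_mul2r d #|W| (3 * #|S|).
rewrite le orbT in h3.
have : 3 * (#|S| * d) <= 3 * (#|inner_edges G W| * 2) by rewrite leq_mul2l (leq_trans h1).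
by move: h3; rewrite -mulnA; move: (#|W| * d) (#|S| * d) #|inner_edges G W|; lia.
Qed.

End PairSets.

(** * Cycles of a permutation inside a path *)

Section Orbits.
Variables (V : finType) (pi : {perm V}).
Implicit Types (A : rel V) (p : seq V).

Lemma good_orbit A w : (forall x, x != pi x -> A x (pi x)) -> good pi A (orbit pi w).
Proof.
move=> hA; have uo := orbit_uniq pi w; apply/and4P; split=> //.
- by rewrite /orbit -orderSpred.
- apply: (frel_sorted hA) => //; rewrite /orbit -orderSpred /=; exact: fpath_traject.
- apply/forallP => x; rewrite -!fconnect_orbit; apply/eqP.
  by rewrite -(same_fconnect1_r (@perm_inj _ pi)).
Qed.

Definition norb p : nat := #|[set O in porbits pi | O \subset [set x in p]]|.

Lemma porbit_closed p x : pi_closed pi p -> x \in p -> porbit pi x \subset [set x in p].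
Proof.
move=> cp xp; apply/subsetP => y /porbitP[i ->]; rewrite inE permX.
by elim: i => //= i IH; rewrite pi_closedP.
Qed.

Lemma norb_gt0 A p : good pi A p -> 0 < norb p.
Proof.
case/and4P; case: p => // x p _ _ _ cp; apply/card_gt0P; exists (porbit pi x).
by rewrite inE imset_f //= porbit_closed // inE eqxx.
Qed.

Lemma norb_le p : norb p <= #|porbits pi|.
Proof. by apply: subset_leq_card; apply/subsetP => O; rewrite inE => /andP[]. Qed.

Lemma norb_lt A p p' : good pi A p' -> [set x in p] \proper [set x in p'] ->
  norb p < norb p'.
Proof.
case/and4P=> _ _ _ cp' /properP[sub [w]]; rewrite !inE => wp' nwp.
apply: proper_card; apply/properP; split.
  by apply/subsetP => O; rewrite !inE => /andP[-> /subset_trans ->].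
exists (porbit pi w); first by rewrite inE imset_f //= porbit_closed.
rewrite inE negb_and; apply/orP; right; apply: contra nwp => /subsetP/(_ w).
by rewrite porbit_id inE => ->.
Qed.

End Orbits.

Section PairCount.
Variable V : finType.

Definition pair_sets : {set {set V}} := [set u : {set V} | #|u| == 2].

Lemma card_pair_sets : #|pair_sets| <= #|V| ^ 2.
Proof.
rewrite -mulnn -card_prod.
apply: (@leq_trans #|[set [set e.1; e.2] | e in [set: V * V]]|); last first.
  by rewrite -[leqRHS]cardsT leq_imset_card.
apply: subset_leq_card; apply/subsetP => u; rewrite inE => /cards2P[x [y [_ ->]]].
by apply/imsetP; exists (x, y).
Qed.

Lemma card_unordered (B : {set V * V}) : (forall e, e \in B -> e.1 != e.2) ->
  #|B| <= 2 * #|[set [set e.1; e.2] | e in B]|.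
Proof.
move=> hB; rewrite -[#|B|]sum1_card (partition_big_imset (fun e => [set e.1; e.2])) /=.
rewrite mulnC -sum_nat_const; apply: leq_sum => u /imsetP[[x y] xyB ->] /=.
rewrite sum1_card; apply: (@leq_trans #|[set (x, y); (y, x)]|); last first.
  by rewrite cards2; case: (_ != _).
apply: subset_leq_card; apply/subsetP => -[a b]; rewrite unfold_in /= !inE !xpair_eqE.
case/andP => /hB /= ab /eqP e.
have /set2P[ea|ea] : a \in [set x; y] by rewrite -e !inE eqxx.
all: have /set2P[eb|eb] : b \in [set x; y] by rewrite -e !inE eqxx orbT.
all: by rewrite ea eb ?eqxx ?orbT // in ab *.
Qed.

End PairCount.

(** * Turning disjoint permutations into disjoint Hamilton cycles *)

Section Process.
Variables (V : finType) (r d s0 M0 : nat) (pi : nat -> {perm V}) (G : {set {set V}}).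
Hypothesis G2 : G \subset pair_sets V.
Hypothesis piG : forall i, i < r -> perm_edges (pi i) \subset G.
Hypothesis pi_dis : forall i j, i < r -> j < r -> i != j ->
  [disjoint perm_edges (pi i) & perm_edges (pi j)].
Hypothesis degG : forall v, d + 2 * r <= #|incident G v|.
Hypothesis sparse : forall W : {set V}, 0 < #|W| <= 3 * s0 ->
  6 * #|inner_edges G W| < #|W| * d.
Variable x0 : V.

Definition num_cycles i := #|porbits (pi i)|.
Definition total_cycles := \sum_(i < r) num_cycles i.
Hypothesis room : 2 * (M0 + #|G| + total_cycles) <= s0 * s0.

Record state := State { hams : seq (seq V); cur : seq V; spr : {set {set V}} }.

Definition later i : {set {set V}} := \bigcup_(j < r | i < j) perm_edges (pi j).
Definition finished (hs : seq (seq V)) : {set {set V}} := \bigcup_(c <- hs) cycle_edges c.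
Definition avail i hs us : {set {set V}} := (G :|: us) :\: (finished hs :|: later i).

(** The predecessor accounts for the initial path, whose first cycle comes for free; closing the
    Hamilton cycle then earns the last unit. The total number of cycles thus bounds the number of
    moves and of sprinkled edges. *)
Definition progress S : nat :=
  let i := size (hams S) in
  \sum_(j < i) num_cycles j + (if i < r then (norb (pi i) (cur S)).-1 else 0).

Definition valid S : Prop :=
  let: State hs p us := S in let i := size hs in
  [/\ i <= r,
      [/\ us \subset pair_sets V, [disjoint us & G] & #|us| <= progress S],
      forall c, c \in hs -> [/\ uniq c, size c = #|V|, cycle_edges c \subset G :|: us &
        forall j, i <= j < r -> [disjoint cycle_edges c & perm_edges (pi j)]],
      pairwise (fun c c' => [disjoint cycle_edges c & cycle_edges c']) hs &
      i < r -> good (pi i) (edge_rel_of (avail i hs us)) p].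

Lemma finishedP hs u : reflect (exists2 c, c \in hs & u \in cycle_edges c) (u \in finished hs).
Proof.
rewrite /finished; elim: hs => [|c hs IH].
  by rewrite big_nil inE; constructor; case.
rewrite big_cons inE; apply: (iffP orP) => [[uc|/IH[c' ch uc]]|[c']].
- by exists c; rewrite ?inE ?eqxx.
- by exists c'; rewrite // inE ch orbT.
- by rewrite inE => /orP[/eqP->|ch] uc; [left|right; apply/IH; exists c'].
Qed.

Lemma laterP i u : reflect (exists2 j, i < j < r & u \in perm_edges (pi j)) (u \in later i).
Proof.
apply: (iffP bigcupP) => [[j ij uj]|[j /andP[ij jr] uj]].
  by exists j => //; rewrite ij ltn_ord.
by exists (Ordinal jr).
Qed.

Lemma perm_edge_avail hs us i : i < r ->
  (forall c, c \in hs -> [disjoint cycle_edges c & perm_edges (pi i)]) ->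
  perm_edges (pi i) \subset avail i hs us.
Proof.
move=> ir dis; apply/subsetP => u ui; rewrite !inE (subsetP (piG ir) _ ui) /= andbT.
rewrite negb_or; apply/andP; split.
  apply/finishedP => -[c /dis]; rewrite disjoint_sym => /disjointFr/(_ ui).
  by move=> ->.
apply/laterP => -[j /andP[ij jr]].
by rewrite (disjointFr (pi_dis ir jr _) ui) // neq_ltn ij.
Qed.

Lemma perm_rel_avail hs us i : i < r ->
  (forall c, c \in hs -> [disjoint cycle_edges c & perm_edges (pi i)]) ->
  forall x, x != pi i x -> edge_rel_of (avail i hs us) x (pi i x).
Proof.
move=> ir dis x nx; rewrite /edge_rel_of /= nx /=.
by apply: (subsetP (perm_edge_avail us ir dis)); apply: imset_f; rewrite inE.
Qed.

(** Each finished Hamilton cycle and each later permutation takes at most two edges at v, and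
    together there are fewer than r of them. Only edges of G are counted, since sparsity is known
    for G alone. *)
Lemma avail_degree hs us i v : size hs = i -> i < r ->
  (forall c, c \in hs -> uniq c) -> d <= #|incident (avail i hs us :&: G) v|.
Proof.
move=> sh ir uh; rewrite -(leq_add2r (2 * r)); apply: leq_trans (degG v) _.
apply: leq_trans (incidentD _ (finished hs :|: later i) v) _; apply: leq_add.
  apply: incident_sub; apply/subsetP => u; rewrite !inE => /andP[-> ->].
  by [].
apply: (@leq_trans (\sum_(c <- hs) 2 + \sum_(j < r | i < j) 2)).
  have le : #|incident (finished hs :|: later i) v| <=
      #|incident (finished hs) v| + #|incident (later i) v|.
    apply: leq_trans (leq_card_setU _ _); apply: subset_leq_card.
    by apply/subsetP => u; rewrite !inE => /andP[/orP[->|->] ->]; rewrite ?orbT.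
  apply: leq_trans le _; apply: leq_add; last first.
    apply: leq_trans (incident_bigcup _ _ _) _; apply: leq_sum => j _.
    exact: incident_perm.
  elim: (hs) uh => [|c l IH] uh; rewrite /finished ?big_nil ?big_cons.
    by rewrite (_ : incident _ _ = set0) ?cards0 //; apply/setP => u; rewrite !inE.
  apply: (@leq_trans (#|incident (cycle_edges c) v| + #|incident (finished l) v|)).
    apply: leq_trans (leq_card_setU _ _); apply: subset_leq_card.
    by apply/subsetP => u; rewrite !inE => /andP[/orP[->|->] ->]; rewrite ?orbT.
  apply: leq_add; first by apply: incident_cycle; apply: uh; rewrite inE eqxx.
  by apply: IH => c' cl; apply: uh; rewrite inE cl orbT.
rewrite big_const_seq count_predT iter_addn_0 sh [2 * i]mulnC.
have -> : i * 2 = \sum_(j < r | j < i) 2.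
  rewrite -(big_ord_widen r (fun=> 2)) ?(ltnW ir) //.
  by rewrite sum_nat_const card_ord.
have -> : 2 * r = \sum_(j < r) 2 by rewrite sum_nat_const card_ord mulnC.
rewrite big_mkcond [X in _ + X]big_mkcond -big_split; apply: leq_sum => j _ /=.
by case: ltngtP.
Qed.

Definition packed (M : {set {set V}}) : Prop :=
  exists c : 'I_r -> seq V,
    (forall i, [/\ uniq (c i), size (c i) = #|V| & cycle_edges (c i) \subset M]) /\
    (forall i j, i != j -> [disjoint cycle_edges (c i) & cycle_edges (c j)]).

(** An unfinished stage contributes at most its number of cycles minus one, so full progress means
    that all r cycles are closed. *)
Lemma valid_packed S : valid S -> total_cycles <= progress S -> packed (G :|: spr S).
Proof.
case: S => hs p us; set i := size hs; rewrite /progress /=.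
move=> [ir [_ _ _] hc pw gp] le.
have ei : i = r.
  apply/eqP; rewrite eqn_leq ir /= leqNgt; apply/negP => lt; move: le; rewrite -/i lt.
  rewrite leqNgt => /negP; apply.
  apply: (@leq_trans (\sum_(j < i) num_cycles j + num_cycles i)).
    by rewrite ltn_add2l prednK ?(norb_gt0 (gp lt)) // norb_le.
  rewrite /total_cycles -[X in X <= _](big_ord_recr i (fun j => num_cycles j)) /=.
  by rewrite (big_ord_widen r (fun j => num_cycles j) lt) [leqLHS]big_mkcond;
    apply: leq_sum => j _; case: ifP.
have lt_i (j : 'I_r) : j < size hs by rewrite -/i ei ltn_ord.
exists (fun j => nth [::] hs j); split=> [j|j k jk].
  by have [? ? ? _] := hc _ (mem_nth [::] (lt_i j)).
have /(pairwiseP [::]) h := pw.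
have [lt|lt|e] := ltngtP j k.
- by apply: h; rewrite ?inE.
- by rewrite disjoint_sym; apply: h; rewrite ?inE.
- by case/eqP: jk; apply: val_inj.
Qed.

Lemma cycle_edges_sub (E : {set {set V}}) (c : seq V) : path.cycle (edge_rel_of E) c -> cycle_edges c \subset E.
Proof.
move=> cyc; apply/subsetP => _ /imsetP[x xc ->].
by have := next_cycle cyc xc => /andP[].
Qed.

Lemma edge_rel_of_add (E : {set {set V}}) (x y : V) : x != y ->
  subrel (add_edge (edge_rel_of E) (x, y)) (edge_rel_of ([set x; y] |: E)).
Proof.
move=> xy a b; rewrite /add_edge /edge_rel_of /= !inE => /or3P[/andP[-> ->]|/eqP[-> ->]|/eqP[-> ->]].
- by rewrite orbT.
- by rewrite xy eqxx.
- by rewrite eq_sym xy set2C eqxx.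
Qed.

(** A new edge cannot be used or reserved already: finished cycles lie in G and the sprinkled edges,
    later permutations in G. *)
Lemma avail_setU (hs : seq (seq V)) (us : {set {set V}}) i (u : {set V}) : u \notin G -> u \notin us ->
  (forall c, c \in hs -> cycle_edges c \subset G :|: us) ->
  u |: avail i hs us \subset avail i hs (u |: us).
Proof.
move=> uG uus hc; apply/subsetP => v; rewrite !inE => /orP[/eqP->|/andP[-> /orP[->|->]]].
- rewrite eqxx orbT andbT negb_or; apply/andP; split.
    apply/finishedP => -[c /hc /subsetP sc /sc]; rewrite inE (negbTE uG) (negbTE uus) //.
  apply/laterP => -[j /andP[_ jr] /(subsetP (piG jr))]; rewrite (negbTE uG) //.
- by [].
- by rewrite !orbT.
Qed.

Lemma process_step S : valid S -> progress S < total_cycles ->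
  (exists S', [/\ valid S', progress S < progress S' & spr S' \subset spr S]) \/
  exists B : {set {set V}}, [/\ B \subset pair_sets V, M0 <= #|B| & forall u, u \in B ->
    exists S', [/\ valid S', progress S < progress S' & spr S' \subset u |: spr S]].
Proof.
case: S => hs p us; set i := size hs.
move=> [ir [us2 usG us_le] hc pw gp] ltJ; rewrite -/i in ir hc gp.
have {}ir : i < r.
  rewrite ltn_neqAle ir andbT; apply: contraTneq ltJ => ei.
  by rewrite /progress /= -/i ei ltnn addn0 -leqNgt.
have {}gp := gp ir; set A := avail i hs us in gp.
have hdis c : c \in hs -> [disjoint cycle_edges c & perm_edges (pi i)].
  by case/hc => _ _ _; apply; rewrite leqnn.
have hA := perm_rel_avail us ir hdis; rewrite -/A in hA.
have expand : forall S : {set V}, 0 < #|S| <= s0 -> 3 * #|S| < #|S :|: nbhd (edge_rel_of A) S|.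
  have e1 : A :&: G \subset G by apply: subsetIr.
  have e2 u : u \in A :&: G -> #|u| = 2.
    by move=> /(subsetP e1) /(subsetP G2); rewrite inE => /eqP.
  have e3 v : d <= #|incident (A :&: G) v|.
    by apply: avail_degree => // c /hc[].
  move=> S hS; apply: leq_trans (sparse_expand e1 e2 e3 sparse hS) _.
  apply: subset_leq_card; apply: setUS; apply/subsetP => w; rewrite !inE.
  case/existsP => y /and3P[yS yw]; rewrite inE => /andP[yA _]; apply/existsP; exists y.
  by rewrite yS /edge_rel_of /= yw.
have prog_ext p' us' : good (pi i) (edge_rel_of (avail i hs us')) p' ->
    [set x in p] \proper [set x in p'] -> progress (State hs p us) < progress (State hs p' us').
  move=> g' pr; rewrite /progress /= -/i ir ltn_add2l.
  by have := norb_lt g' pr; have := norb_gt0 gp; lia.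
have [[p' g' pr]|[B Bbig hB]] := extension_step (@edge_rel_of_sym _ A) hA expand gp.
  left; exists (State hs p' us); have lt := prog_ext _ _ g' pr; split=> //.
  split=> //; rewrite -/i //; first exact: ltnW.
  by split=> //; apply: leq_trans us_le (ltnW lt).
(* At least half of the s0^2 ordered boosters remain as unordered pairs. Those already in G or
   sprinkled are discarded, which [room] pays for while keeping M0 of them. *)
right; pose B1 := [set [set e.1; e.2] | e in B] :\: G :\: us.
exists B1.
have B2 : [set [set e.1; e.2] | e in B] \subset pair_sets V.
  by apply/subsetP => _ /imsetP[e eB ->]; rewrite inE cards2 (hB _ eB).1.
have us_small : #|us| <= total_cycles by apply: leq_trans us_le (ltnW ltJ).
split.
- apply/subsetP => u; rewrite !inE => /and3P[_ _ uB].
  by have := subsetP B2 _ uB; rewrite inE.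
- have h1 := card_unordered (fun e eB => (hB e eB).1).
  have h2 : #|[set [set e.1; e.2] | e in B]| <= #|B1| + #|us| + #|G|.
    rewrite /B1; set X := [set _ | _ in B].
    have := cardsID G X; have := cardsID us (X :\: G).
    have := subset_leq_card (subsetIr X G); have := subset_leq_card (subsetIr (X :\: G) us).
    by move: #|_| #|_| #|_| #|_| #|_| #|_| #|_|; lia.
  by move: room Bbig h1 h2 us_small; move: #|_| #|_| #|_| #|_| #|_|; lia.
move=> u; rewrite 2!inE => /andP[uus /andP[uG /imsetP[[x y] xyB ue]]].
have {hB}[/= xy hB] := hB _ xyB; set us' := u |: us.
have usub : us \subset us' by apply: subsetUr.
have hc' c : c \in hs -> [/\ uniq c, size c = #|V|, cycle_edges c \subset G :|: us' &
    forall j, i <= j < r -> [disjoint cycle_edges c & perm_edges (pi j)]].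
  by case/hc => h1 h2 h3 h4; split=> //; apply: subset_trans h3 (setUS _ usub).
have Asub : subrel (add_edge (edge_rel_of A) (x, y)) (edge_rel_of (avail i hs us')).
  move=> a b /(edge_rel_of_add xy); rewrite /edge_rel_of /= -ue => /andP[-> /=].
  by apply/subsetP/avail_setU => // c /hc[].
have us'2 : us' \subset pair_sets V.
  by rewrite subUset us2 andbT sub1set ue inE cards2 xy.
have us'G : [disjoint us' & G] by rewrite -setI_eq0 setIUl setU_eq0 !setI_eq0 usG disjoints1 uG.
have card_us' : #|us'| <= (progress (State hs p us)).+1.
  by apply: leq_trans (leq_card_setU _ _) _; rewrite cards1 add1n ltnS.
case: hB => [/(extends_sub Asub)[p' g' pr]|/(hamiltonian_sub Asub)[c [uc sc cc]]].
  exists (State hs p' us'); have lt := prog_ext _ _ g' pr; split=> //.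
  split=> //; rewrite -/i //; first exact: ltnW.
  by split=> //; apply: leq_trans card_us' lt.
(* The next stage starts from a single cycle of the next permutation. *)
pose S' := State (rcons hs c) (orbit (pi i.+1) x0) us'; exists S'.
have lt : progress (State hs p us) < progress S'.
  rewrite /progress /= size_rcons -/i ir big_ord_recr /= -addnA ltn_add2l.
  by apply: ltn_addr; rewrite prednK ?(norb_gt0 gp) // norb_le.
have cA := cycle_edges_sub cc.
split=> //; rewrite /valid /S' size_rcons -/i; split=> //.
- by split=> //; apply: leq_trans card_us' lt.
- move=> c'; rewrite mem_rcons inE => /orP[/eqP->|/hc'[h1 h2 h3 h4]]; last first.
    by split=> // j /andP[ij jr]; apply: h4; rewrite (ltnW ij).
  split=> //; first by apply: subset_trans cA (subsetDl _ _).
  move=> j ij; rewrite -setI_eq0; apply/eqP/setP => v; rewrite !inE.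
  apply/negP => /andP[/(subsetP cA)]; rewrite !inE negb_or => /andP[/andP[_ nl] _] vj.
  by case/laterP: nl; exists j.
- rewrite -cats1 pairwise_cat pw /= andbT allrel1r; apply/allP => c' c'h.
  rewrite -setI_eq0; apply/eqP/setP => v; rewrite !inE; apply/negP => /andP[vc'].
  move=> /(subsetP cA); rewrite !inE negb_or => /andP[/andP[nf _] _].
  by case/finishedP: nf; exists c'.
move=> ir1; apply: good_orbit; apply: perm_rel_avail => // c'.
rewrite mem_rcons inE => /orP[/eqP->|/hc'[_ _ _ h4]]; last by apply: h4; rewrite leqnSn.
rewrite -setI_eq0; apply/eqP/setP => v; rewrite !inE.
apply/negP => /andP[/(subsetP cA)]; rewrite !inE negb_or => /andP[/andP[_ nl] _] vj.
by case/laterP: nl; exists i.+1; rewrite ?ltnSn.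
Qed.

Local Open Scope ring_scope.

Lemma sprinkle_bound (q : {set V} -> R) (b : R) :
  (forall u, 0 <= q u <= 1) -> 0 <= b <= 1 -> (forall u, u \in pair_sets V -> q u = b) ->
  Pr (bern q) (fun f => ~~ `[< packed (G :|: on_set f) >]) <=
  (1 - b) ^+ M0 * (1 + #|pair_sets V|%:R) ^+ total_cycles.
Proof.
move=> q01 b01 qb; pose S0 := State [::] (orbit (pi 0%N) x0) set0.
have v0 : valid S0.
  split=> //; first by rewrite sub0set cards0 -setI_eq0 set0I eqxx.
  by move=> r0; apply: good_orbit; apply: perm_rel_avail.
apply: le_trans (online_bound q01 b01 qb process_step (S := S0) (j := total_cycles) v0 _); last first.
  exact: leq_addl.
apply: (Pr_le (bern_weight q01)) => f; apply: contraNN => /asboolP[S' [vS' pS' us]].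
apply/asboolP; have [c [h1 h2]] := valid_packed vS' pS'; exists c; split=> // i.
have [? ? sub] := h1 i; split=> //; apply: subset_trans sub _; apply: setUS.
by apply: subset_trans us _; rewrite /S0 /= set0U.
Qed.

End Process.

(** * Overlap of exactly half of an edge *)

Section DoubleBlocks.
Variables (n l : nat).
Hypothesis (l0 : 0 < l) (ln : l %| n) (nu3 : 2 < n %/ l).
Let nu := n %/ l.
Let lk : l <= 2 * l. Proof. by rewrite leq_pmull. Qed.

Lemma double_edgeE (s : {perm 'I_n}) (x : 'I_nu) (v : 'I_n) :
  (v \in ham_edge (2 * l) l s x) = (s v %/ l == x) || (s v %/ l == x.+1 %% nu).
Proof.
have -> : (v \in ham_edge (2 * l) l s x) = (s v \in base_edge (2 * l) x).
  by rewrite !inE perm1.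
rewrite (base_edgeE l0 lk (leqnn _) ln nu3).
have -> : 2 * l - l = l by lia.
by rewrite ltn_pmod // andbT.
Qed.

Lemma double_edge_inj (s : {perm 'I_n}) :
  injective (fun x : 'I_nu => ham_edge (2 * l) l s x).
Proof.
move=> x y e; apply/eqP; apply: contraT => xy.
have start_lt (z : 'I_nu) : z * l < n.
  by rewrite [X in _ < X](nuE ln) ltn_pmul2r //; apply: ltn_ord.
have aux (z z' : 'I_nu) : z != z' -> ham_edge (2 * l) l s z = ham_edge (2 * l) l s z' ->
    z'.+1 %% nu = z.
  move=> zz' ez; pose v : 'I_n := (s^-1)%g (Ordinal (start_lt z)).
  have := double_edgeE s z v; rewrite ez double_edgeE permKV /= mulnK // eqxx /=.
  by rewrite (inj_eq val_inj) (negbTE zz') => /eqP.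
have e1 := aux _ _ xy e; have e2 := aux y x; rewrite eq_sym xy in e2.
by have := succ_succ_mod_neq nu3 (ltn_ord y); rewrite -/nu e1 (e2 isT (esym e)) eqxx.
Qed.

Variables (V : finType) (x0 : V).
Hypothesis cV : #|V| = nu.

(** Vertices of V stand for the n / l blocks, so that edges of the hypergraph become pairs in V. *)
Definition block (v : 'I_n) : V := nth x0 (enum V) (v %/ l).

Definition block_edge (u : {set V}) : {set 'I_n} := [set v | block v \in u].

Lemma div_lt (v : 'I_n) : v %/ l < nu.
Proof. by rewrite ltn_divLR // -(nuE ln). Qed.

Lemma block_eq v x : (block v == x) = (v %/ l == index x (enum V)).
Proof.
have sz : size (enum V) = nu by rewrite -cardE.
have lt := div_lt v; apply/eqP/eqP => [<-|e].
  by rewrite /block index_uniq ?sz ?enum_uniq.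
by rewrite /block e nth_index ?mem_enum.
Qed.

Lemma card_block x : #|[set v | block v == x]| = l.
Proof.
have xl : index x (enum V) < nu by rewrite -cV cardE index_mem mem_enum.
rewrite -(card_block_part l0 lk (leqnn _) ln nu3 xl (leqnn l)); apply: eq_card => v.
by rewrite !inE block_eq ltn_pmod // andbT.
Qed.

Lemma card_block_edge u : #|block_edge u| = l * #|u|.
Proof.
rewrite -sum1_card (partition_big block (mem u)) /=; last by move=> v; rewrite inE.
rewrite mulnC -sum_nat_const; apply: eq_bigr => x xu.
rewrite -(card_block x) -sum1_card; apply: eq_bigl => v; rewrite !inE.
by rewrite andb_idl // => /eqP ->.
Qed.

Lemma block_edge_inj : injective block_edge.
Proof.
move=> u u' e; apply/setP => x.
have /card_gt0P[v] : 0 < #|[set v | block v == x]| by rewrite card_block.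
rewrite inE => /eqP vx.
by have /setP/(_ v) := e; rewrite !inE vx.
Qed.

Section OneCycle.
Variable c : seq V.
Hypothesis (uc : uniq c) (sc : size c = nu).

Lemma cycle_mem x : x \in c.
Proof.
have : c =i V; last by move=> ->.
by apply/subset_cardP; [rewrite (card_uniqP uc) sc cV|apply/subsetP].
Qed.

Lemma position_lt v : index (block v) c * l + v %% l < n.
Proof.
have h1 : index (block v) c < nu by rewrite -sc index_mem cycle_mem.
have h2 := ltn_pmod v l0; rewrite [X in _ < X](nuE ln) -/nu.
move: h1 h2; clear; move: (index _ _) (v %% l) => a b; nia.
Qed.

Definition position (v : 'I_n) : 'I_n := Ordinal (position_lt v).

Lemma position_div v : position v %/ l = index (block v) c.
Proof. by rewrite /= divnMDl // divn_small ?addn0 // ltn_pmod. Qed.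

Lemma position_inj : injective position.
Proof.
move=> v w e; apply: val_inj; rewrite /= (divn_eq v l) (divn_eq w l).
have e1 : v %% l = w %% l.
  by have := congr1 (fun z : 'I_n => z %% l) e; rewrite /= !modnMDl !modn_mod.
have e2 : block v = block w.
  have := congr1 (fun z : 'I_n => z %/ l) e; rewrite !position_div => h.
  by rewrite -(nth_index x0 (cycle_mem (block v))) h nth_index // cycle_mem.
have := block_eq v (block w); rewrite e2 eqxx => /esym/eqP ->.
by have := block_eq w (block w); rewrite eqxx => /esym/eqP <-; rewrite e1.
Qed.

Lemma next_nth_mod i : i < nu -> next c (nth x0 c i) = nth x0 c (i.+1 %% nu).
Proof.
move=> lt; have ltc : i < size c by rewrite sc.
rewrite next_nth mem_nth // index_uniq //; case: (c) sc ltc lt => // y p sp ltc lt.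
have sp' : (size p).+1 = nu := sp.
have [lt1|le1] := ltnP i.+1 nu.
  by rewrite modn_small //= (set_nth_default x0) // -ltnS sp'.
have -> : i.+1 = nu by apply/eqP; rewrite eqn_leq lt le1.
by rewrite modnn /= nth_default // -ltnS sp'.
Qed.

Lemma cycle_ham_cycle :
  is_ham_cycle (2 * l) l [set block_edge u | u in cycle_edges c].
Proof.
apply/existsP; exists (perm position_inj); apply/andP.
have E (i : 'I_nu) : ham_edge (2 * l) l (perm position_inj) i =
    block_edge [set nth x0 c i; next c (nth x0 c i)].
  apply/setP => v; rewrite double_edgeE permE position_div !inE.
  have lt1 : i < size c by rewrite sc.
  have lt2 : i.+1 %% nu < size c by rewrite sc ltn_pmod //; apply: leq_trans nu3.
  rewrite next_nth_mod // -{1}(index_uniq x0 lt1 uc) -[X in _ || (_ == X)](index_uniq x0 lt2 uc).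
  have nE j : j < size c -> (index (block v) c == index (nth x0 c j) c) = (block v == nth x0 c j).
    move=> lt; apply/eqP/eqP => [h|-> //].
    by rewrite -[LHS](nth_index x0 (cycle_mem (block v))) h nth_index // mem_nth.
  by rewrite !nE.
have CE : [set block_edge u | u in cycle_edges c] =
    [set ham_edge (2 * l) l (perm position_inj) i | i : 'I_nu].
  rewrite -imset_comp; apply/setP => e; apply/imsetP/imsetP => [[x xc ->]|[i _ ->]].
    have lt : index x c < nu by rewrite -sc index_mem.
    by exists (Ordinal lt) => //; rewrite E /= nth_index.
  by exists (nth x0 c i); rewrite ?E ?mem_nth ?sc.
split; first by rewrite CE.
by rewrite CE card_imset ?card_ord //; apply: double_edge_inj.
Qed.

End OneCycle.

Lemma packed_ham_packing r (M : {set {set V}}) :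
  packed r M -> ham_packing (2 * l) l r block_edge M.
Proof.
move=> [c [h1 h2]]; exists (fun i => cycle_edges (c i)); split=> [i|]; last exact: h2.
have [uc sc sub] := h1 i; rewrite sub andbT; apply: cycle_ham_cycle => //.
by rewrite sc cV.
Qed.

End DoubleBlocks.

(** * Three layers of vertices and cyclic matchings between them *)

Section Layers.
Variables (w rho : nat).

(** With three layers in cyclic order, an unordered pair between distinct layers determines its
    direction, so matchings on different blocks use different edges. The [rho] vertices are what is
    left over when the number of blocks is divided by 3. *)
Definition vtx : Type := ('I_3 * 'I_w + 'I_rho)%type.
HB.instance Definition _ := Finite.on vtx.

Definition next_layer (i : 'I_3) : 'I_3 := ordS i.

Lemma next_layer_neq i : next_layer i != i.
Proof. by case: i => [[|[|[|]]]]. Qed.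

Lemma next_layer2_neq i : next_layer (next_layer i) != i.
Proof. by case: i => [[|[|[|]]]]. Qed.

Lemma next_layer3 i : next_layer (next_layer (next_layer i)) = i.
Proof. by apply: val_inj; case: i => [[|[|[|]]]]. Qed.

Definition layer (v : vtx) : option 'I_3 := if v is inl (i, _) then Some i else None.

Lemma card_vtx : #|{: vtx}| = 3 * w + rho.
Proof. by rewrite card_sum card_prod !card_ord. Qed.

(** Leftover vertices are fixed points: cycles of length one, to be absorbed by the extension
    process like the others. *)
Definition layer_map (f : 'I_3 -> {perm 'I_w}) (v : vtx) : vtx :=
  match v with
  | inl (i, a) => inl (next_layer i, f i a)
  | inr z => inr z
  end.

Lemma layer_map_inj f : injective (layer_map f).
Proof.
move=> [[i a]|z] [[j b]|z'] /=; [move/eqP|by []|by []|by case=> ->].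
rewrite -[_ == _]/((next_layer i, f i a) == (next_layer j, f j b)) xpair_eqE.
by case/andP => /eqP/(can_inj (@ordSK 3)) <- /eqP/perm_inj <-.
Qed.

Definition layer_perm f : {perm vtx} := perm (@layer_map_inj f).

Definition cross_block (G : {set {set vtx}}) (i : 'I_3) : {set 'I_w * 'I_w} :=
  [set ab | [set inl (i, ab.1); inl (next_layer i, ab.2)] \in G].

Definition return_perm (f : 'I_3 -> {perm 'I_w}) : {perm 'I_w} :=
  (f ord0 * f (next_layer ord0) * f (next_layer (next_layer ord0)))%g.

Lemma layer_perm_return f a :
  ((layer_perm f) ^+ 3)%g (inl (ord0, a)) = inl (ord0, return_perm f a) :> vtx.
Proof.
rewrite !expgS expg0 mulg1 /return_perm !permM !permE /=.
by congr (inl (_, _)); apply: next_layer3.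
Qed.

Lemma porbit_return f a b : b \in porbit (return_perm f) a ->
  porbit (layer_perm f) (inl (ord0, b) : vtx) = porbit (layer_perm f) (inl (ord0, a) : vtx).
Proof.
case/porbitP => i ->; elim: i => [|i IH]; first by rewrite perm1.
rewrite expgSr permM -layer_perm_return -[RHS]IH.
apply/eqP; rewrite eq_porbit_mem; exact: mem_porbit.
Qed.

Lemma porbit_to_layer0 f i a : exists b : 'I_w,
  porbit (layer_perm f) (inl (i, a) : vtx) = porbit (layer_perm f) (inl (ord0, b) : vtx).
Proof.
have step j c : porbit (layer_perm f) (inl (j, c) : vtx) =
    porbit (layer_perm f) (inl (next_layer j, f j c) : vtx).
  apply/eqP; rewrite eq_porbit_mem porbit_sym.
  by have := mem_porbit (layer_perm f) 1 (inl (j, c)); rewrite expg1 permE.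
have [->|ni] := eqVneq i ord0; first by exists a.
have [e|ni2] := eqVneq (next_layer i) ord0; first by rewrite step e; eexists.
rewrite step step; exists (f (next_layer i) (f i a)); congr (porbit _ (inl (_, _))).
by apply: val_inj; move: i ni ni2 {a step} => [[|[|[|]]]].
Qed.

(** Every cycle through the layers meets layer 0, and its trace there is a cycle of the return
    permutation. *)
Lemma card_porbits_layer f :
  #|porbits (layer_perm f)| <= #|porbits (return_perm f)| + rho.
Proof.
pose F (O : {set 'I_w}) : {set vtx} :=
  if [pick a in O] is Some a then porbit (layer_perm f) (inl (ord0, a) : vtx) else set0.
pose H (z : 'I_rho) : {set vtx} := porbit (layer_perm f) (inr z : vtx).
have sub : porbits (layer_perm f) \subset (F @: porbits (return_perm f)) :|: (H @: setT).
  apply/subsetP => O /imsetP[[[i a]|z] _ ->]; rewrite inE; last by rewrite imset_f ?orbT.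
  have [b ->] := porbit_to_layer0 f i a; apply/orP; left; apply/imsetP.
  exists (porbit (return_perm f) b); first exact: imset_f.
  rewrite /F; case: pickP => [c cb|/(_ b)]; last by rewrite porbit_id.
  by rewrite (porbit_return cb).
apply: leq_trans (subset_leq_card sub) _; apply: leq_trans (leq_card_setU _ _) _.
apply: leq_add; first exact: leq_imset_card.
by apply: leq_trans (leq_imset_card _ _) _; rewrite cardsT card_ord.
Qed.

End Layers.

Section GraphConditions.
Variables (w rho r d : nat) (G : {set {set vtx w rho}}).
Variable f : 'I_3 -> 'I_r -> {perm 'I_w}.
Hypothesis fG : forall i j a, (a, f i j a) \in cross_block G i.
Hypothesis f_dis : forall i j j' a, f i j a = f i j' a -> j = j'.

Definition layer_perms (j : nat) : {perm vtx w rho} :=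
  if insub j is Some j' then layer_perm rho (fun i => f i j') else 1%g.

Lemma layer_permsE (j : 'I_r) : layer_perms j = layer_perm rho (fun i => f i j).
Proof. by rewrite /layer_perms insubT // => lt; congr layer_perm; apply: funext => i; congr (f i _); apply: val_inj. Qed.

Lemma perm_edges_layer (j : 'I_r) u : u \in perm_edges (layer_perms j) ->
  exists i a, u = [set inl (i, a); inl (next_layer i, f i j a)].
Proof.
rewrite layer_permsE => /imsetP[[[i a]|z]]; rewrite inE permE /= => nx ->.
  by exists i, a.
by rewrite eqxx in nx.
Qed.

Lemma layer_perms_sub j : j < r -> perm_edges (layer_perms j) \subset G.
Proof.
move=> jr; apply/subsetP => u /(@perm_edges_layer (Ordinal jr))[i [a ->]].
by have := fG i (Ordinal jr) a; rewrite inE.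
Qed.

Lemma cross_pair_inj i a b i' a' b' :
  [set (inl (i, a) : vtx w rho); inl (next_layer i, b)] =
  [set (inl (i', a') : vtx w rho); inl (next_layer i', b')] ->
  [/\ i = i', a = a' & b = b'].
Proof.
move=> e.
have /setP/(_ (inl (i, a))) := e; rewrite !inE eqxx /= => /esym h1.
have /setP/(_ (inl (next_layer i, b))) := e; rewrite !inE eqxx orbT /= => /esym h2.
have inlE x y : ((inl x : vtx w rho) == inl y) = (x == y) by [].
rewrite !inlE !xpair_eqE in h1 h2.
case/orP: h1 => /andP[/eqP e1 /eqP e2]; case/orP: h2 => /andP[/eqP e3 /eqP e4].
- by have := next_layer_neq i; rewrite e3 e1 eqxx.
- by [].
- by have := next_layer2_neq i'; rewrite -e1 e3 eqxx.
- by have := next_layer_neq i; rewrite e3 -e1 eqxx.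
Qed.

Lemma layer_perms_dis j j' : j < r -> j' < r -> j != j' ->
  [disjoint perm_edges (layer_perms j) & perm_edges (layer_perms j')].
Proof.
move=> jr jr' jj; rewrite -setI_eq0; apply/eqP/setP => u; rewrite !inE; apply/negP => /andP[].
move=> /(@perm_edges_layer (Ordinal jr))[i [a ->]] /(@perm_edges_layer (Ordinal jr'))[i' [a' e]].
have [ei ea eb] := cross_pair_inj e; rewrite -ei -ea in eb.
by have [ej] := f_dis eb; rewrite ej eqxx in jj.
Qed.

Definition same_layer (u : {set vtx w rho}) :=
  [exists i, u \subset [set v | layer v == Some i]].

Lemma same_layer_cross i a b :
  same_layer [set inl (i, a); inl (next_layer i, b)] = false.
Proof.
apply/existsP => -[j /subsetP h].
have := h (inl (i, a)); have := h (inl (next_layer i, b)); rewrite !inE !eqxx orbT /=.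
by move=> /(_ isT)/eqP[<-] /(_ isT)/eqP[/eqP]; rewrite eq_sym (negbTE (next_layer_neq i)).
Qed.

Definition inner_pairs (v : vtx w rho) : {set {set vtx w rho}} :=
  [set u in pair_sets (vtx w rho) | (v \in u) && same_layer u].

(** The r outgoing and r incoming matching edges at a vertex are distinct and join different layers,
    so the d edges inside its layer are additional. *)
Lemma layer_vertex_degree i a :
  d <= #|G :&: inner_pairs (inl (i, a))| -> d + 2 * r <= #|incident G (inl (i, a))|.
Proof.
move=> hd; pose v : vtx w rho := inl (i, a).
pose i' := next_layer (next_layer i).
have i'i : next_layer i' = i by apply: next_layer3.
pose out (j : 'I_r) : {set vtx w rho} := [set v; inl (next_layer i, f i j a)].
pose inn (j : 'I_r) : {set vtx w rho} := 
  [set inl (i', (f i' j)^-1%g a); inl (next_layer i', a)].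
have outG j : out j \in G by have := fG i j a; rewrite inE.
have innG j : inn j \in G.
  by have := fG i' j ((f i' j)^-1%g a); rewrite inE permKV.
have vE : v = inl (next_layer i', a) by rewrite i'i.
have out_inj : injective out.
  by move=> j j' /cross_pair_inj[_ _ /f_dis].
have inn_inj : injective inn.
  move=> j j'; move=> /cross_pair_inj[_ e _].
  by apply: (f_dis (i := i') (a := (f i' j)^-1%g a)); rewrite permKV e permKV.
have dis j j' : out j != inn j'.
  apply/eqP => /cross_pair_inj[e _ _].
  by have := next_layer2_neq i; rewrite -/i' -e eqxx.
have sl_out j : same_layer (out j) = false by apply: same_layer_cross.
have sl_inn j : same_layer (inn j) = false by apply: same_layer_cross.
pose X := (out @: setT) :|: (inn @: setT).
have cX : #|X| = 2 * r.
  rewrite cardsU !card_imset // cardsT card_ord (_ : _ :&: _ = set0) ?cards0; first by lia.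
  apply/setP => u; rewrite !inE; apply/negP => /andP[/imsetP[j _ ->] /imsetP[j' _ /eqP]].
  by rewrite (negbTE (dis j j')).
have dX : [disjoint G :&: inner_pairs v & X].
  rewrite -setI_eq0; apply/eqP/setP => u; rewrite !inE; apply/negP.
  move=> /andP[/andP[_ /andP[_ /andP[_ sl]]]].
  by case/orP => /imsetP[j _ e]; move: sl; rewrite e ?sl_out ?sl_inn.
have := leq_card_setU (G :&: inner_pairs v) X => -[_]; rewrite dX => /eqP cU.
apply: (@leq_trans #|(G :&: inner_pairs v) :|: X|); first by rewrite cU cX leq_add2r.
apply: subset_leq_card; apply/subsetP => u; rewrite !inE => /orP[/and3P[-> _ /andP[-> _]] //|].
case/orP => /imsetP[j _ ->]; first by rewrite outG !inE eqxx.
by rewrite innG -/v vE !inE eqxx orbT.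
Qed.

End GraphConditions.

(** * Bounding the number of cycles by relabelling *)

Section Relabel.
Variables (w rho : nat).
Let V := vtx w rho.

Definition layer2 : 'I_3 := next_layer (next_layer ord0).

Definition relabel_vertex (s : {perm 'I_w}) (v : V) : V :=
  if v is inl (i, a) then (if i == ord0 then inl (i, s a) else inl (i, a)) else v.

Lemma relabel_vertexK s : cancel (relabel_vertex s) (relabel_vertex s^-1).
Proof.
case=> [[i a]|z] //=; have [e|ne] := eqVneq i ord0; rewrite /= ?e ?eqxx ?permK //.
by rewrite (negbTE ne).
Qed.

Lemma layer_relabel s v : layer (relabel_vertex s v) = layer v.
Proof. by case: v => [[i a]|z] //=; case: ifP. Qed.

Definition meets_layer2 (u : {set V}) := [exists v in u, layer v == Some layer2].

(* Relabels the first layer, but only as seen from the third one: only the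
   edges between these two layers are affected. *)
Definition relabel_edge (s : {perm 'I_w}) (u : {set V}) : {set V} :=
  if meets_layer2 u then relabel_vertex s @: u else u.

Lemma meets_layer2_relabel s (u : {set V}) : meets_layer2 (relabel_vertex s @: u) = meets_layer2 u.
Proof.
apply/existsP/existsP => [[_ /andP[/imsetP[v vu ->] lv]]|[v /andP[vu lv]]].
  by exists v; rewrite vu -(layer_relabel s).
by exists (relabel_vertex s v); rewrite imset_f //= layer_relabel.
Qed.

(** Relabelling keeps layers, so the case of the definition that was applied can be read off the
    image. *)
Lemma relabel_edge_inj s : injective (relabel_edge s).
Proof.
have vinj := can_inj (relabel_vertexK s).
move=> u u' e.
have e2 : meets_layer2 u = meets_layer2 u'.
  have h t : meets_layer2 (relabel_edge s t) = meets_layer2 t.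
    by rewrite /relabel_edge; case: ifP => // <-; rewrite meets_layer2_relabel.
  by rewrite -h e h.
move: e; rewrite /relabel_edge e2; case: ifP => // _; exact: imset_inj.
Qed.

Lemma card_relabel_edge s u : #|relabel_edge s u| = #|u|.
Proof.
rewrite /relabel_edge; case: ifP => // _; apply: card_imset.
exact: can_inj (relabel_vertexK s).
Qed.

Lemma same_layer_relabel s u : same_layer (relabel_edge s u) = same_layer u.
Proof.
rewrite /relabel_edge; case: ifP => // _; apply: eq_existsb => i.
apply/subsetP/subsetP => h v.
  by move=> vu; have := h _ (imset_f (relabel_vertex s) vu); rewrite !inE layer_relabel.
by case/imsetP => x /h; rewrite !inE => lx ->; rewrite layer_relabel.
Qed.

Definition relabelled (s : {perm 'I_w}) (G : {set {set V}}) : {set {set V}} :=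
  [set u | relabel_edge s u \in G].

Lemma cross_block_relabelled s G i a b :
  ((a, b) \in cross_block (relabelled s G) i) =
  ((a, if i == layer2 then s b else b) \in cross_block G i).
Proof.
rewrite !inE /relabel_edge /=.
have -> : meets_layer2 [set inl (i, a); inl (next_layer i, b)] = (i != ord0).
  apply/existsP/idP => [[v /andP[]]|ni].
    by rewrite !inE => /orP[/eqP->|/eqP->] /=; move: i {a b} => [[|[|[|]]]].
  have [e|ne] := eqVneq i layer2.
    by exists (inl (i, a)); rewrite !inE eqxx /= e.
  exists (inl (next_layer i, b)); rewrite !inE eqxx orbT /=.
  by move: i ni ne {a b} => [[|[|[|]]]].
have [e|ni] := eqVneq i ord0 => /=.
  by rewrite e.
rewrite imsetU1 imset_set1 /= (negbTE ni).
have -> : (next_layer i == ord0) = (i == layer2).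
  by move: i ni {a b} => [[|[|[|]]]].
by case: ifP.
Qed.

Section Count.
Variables (r K : nat).

Definition cross_packing (G : {set {set V}}) (f : 'I_3 -> 'I_r -> {perm 'I_w}) : Prop :=
  (forall i j a, (a, f i j a) \in cross_block G i) /\
  (forall i j j' a, f i j a = f i j' a -> j = j').

Definition few_cycles (G : {set {set V}}) : Prop :=
  exists2 f, cross_packing G f &
    forall j, #|porbits (return_perm (fun i => f i j))| <= K.

Lemma dense_cross_packing G : (forall i, dense r (cross_block G i)) ->
  exists f, cross_packing G f.
Proof.
move=> dG; have [f fP] := choice (fun i => dense_packing (dG i)).
by exists f; split=> i; have [] := fP i.
Qed.

Definition relabel_packing (s : {perm 'I_w}) (f : 'I_3 -> 'I_r -> {perm 'I_w}) :=
  fun i j => if i == layer2 then (f i j * s)%g else f i j.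

Lemma cross_packing_relabelled s G f :
  cross_packing (relabelled s G) (relabel_packing s^-1 f) <-> cross_packing G f.
Proof.
have E i j a : relabel_packing s^-1 f i j a = if i == layer2 then s^-1%g (f i j a) else f i j a.
  by rewrite /relabel_packing; case: ifP => _; rewrite ?permM.
split=> -[h1 h2]; split.
- move=> i j a; have := h1 i j a; rewrite cross_block_relabelled E.
  by case: (i == layer2); rewrite ?permKV.
- move=> i j j' a e; apply: (h2 i j j' a); rewrite !E; case: (i == layer2); rewrite e //.
- move=> i j a; have := h1 i j a; rewrite cross_block_relabelled E.
  by case: (i == layer2); rewrite ?permKV.
- move=> i j j' a; rewrite !E; case: (i == layer2); last exact: h2.
  by move=> /perm_inj; apply: h2.
Qed.

Lemma relabel_packingK s f : relabel_packing s^-1 (relabel_packing s f) = f.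
Proof.
apply: funext => i; apply: funext => j; rewrite /relabel_packing.
by case: (i == layer2); rewrite ?mulgK.
Qed.

Definition bad_cycles (G : {set {set V}}) : bool :=
  [forall i, dense r (cross_block G i)] && ~~ `[< few_cycles G >].

(** A packing of G is carried to every relabelling, with each of its r return permutations
    multiplied by the inverse of s. A bad s thus makes one of these products have more than K
    cycles. If G has no packing, neither has any relabelling, and none is bad since density would
    provide one. *)
Lemma count_bad_relabelling G :
  #|[set s : {perm 'I_w} | bad_cycles (relabelled s G)]| * 2 ^ K.+1 <= r * (w.+1)`!.
Proof.
have [[f fG]|no] := pselect (exists f, cross_packing G f); last first.
  rewrite (_ : [set _ | _] = set0) ?cards0 //; apply/setP => s; rewrite !inE.
  apply/negP => /andP[/forallP/dense_cross_packing[f fP] _]; apply: no.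
  exists (relabel_packing s f); apply/(cross_packing_relabelled s).
  by rewrite relabel_packingK.
pose h j := return_perm (fun i => f i j).
have hE s j : return_perm (fun i => relabel_packing s^-1 f i j) = (h j * s^-1)%g.
  by rewrite /h /return_perm /relabel_packing /= mulgA.
pose many : {set {perm 'I_w}} := [set s | K < #|porbits s|].
have sub : [set s | bad_cycles (relabelled s G)] \subset
    \bigcup_(j < r) [set s : {perm 'I_w} | (h j * s^-1)%g \in many].
  apply/subsetP => s; rewrite inE => /andP[_]; apply: contraNT => nb; apply/asboolP.
  exists (relabel_packing s^-1 f); first exact/cross_packing_relabelled.
  move=> j; rewrite hE leqNgt; apply: contra nb => lt.
  by apply/bigcupP; exists j => //; rewrite !inE.
have cj j : #|[set s : {perm 'I_w} | (h j * s^-1)%g \in many]| = #|many|.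
  rewrite -[RHS](card_imset _ (f := fun t => (t^-1 * h j)%g)); last first.
    by move=> s t /mulIg/invg_inj.
  apply: eq_card => s; rewrite !inE; apply/idP/imsetP => [hs|[t tm ->]].
    by exists (h j * s^-1)%g; rewrite ?inE // invMg invgK mulgKV.
  by rewrite invMg invgK mulKVg; rewrite inE in tm.
apply: (@leq_trans (r * #|many| * 2 ^ K.+1)).
  rewrite leq_mul2r; apply/orP; right; apply: leq_trans (subset_leq_card sub) _.
  have le : #|\bigcup_(j < r) [set s : {perm 'I_w} | (h j * s^-1)%g \in many]| <=
      \sum_(j < r) #|[set s : {perm 'I_w} | (h j * s^-1)%g \in many]|.
    elim/big_ind2: _ => [|x A y B hx hy|//]; first by rewrite cards0.
    exact: leq_trans (leq_card_setU _ _) (leq_add hx hy).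
  apply: leq_trans le _; rewrite (eq_bigr (fun=> #|many|)) => [|j _]; last exact: cj.
  by rewrite sum_nat_const card_ord.
rewrite -mulnA leq_mul2l; apply/orP; right.
by have := card_many_porbits 'I_w K.+1; rewrite card_ord.
Qed.

Local Open Scope ring_scope.

(** The law is invariant under each relabelling, so the probability equals the mean, over the graph,
    of the proportion of bad relabellings. *)
Lemma bad_cycles_bound (q : {set V} -> R) :
  (forall u, 0 <= q u <= 1) -> (forall s u, q (relabel_edge s u) = q u) ->
  Pr (bern q) (fun f => bad_cycles (on_set f)) <= (r * w.+1)%:R / (2 ^ K.+1)%:R.
Proof.
move=> q01 qs; have ww := bern_weight q01.
have inv (s : {perm 'I_w}) : Pr (bern q) (fun f => bad_cycles (relabelled s (on_set f))) =
    Pr (bern q) (fun f => bad_cycles (on_set f)).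
  rewrite /Pr -[RHS](@Ex_pull _ _ _ _ (bern q) (relabel_edge s) (fun _ b => b)) //.
  - apply: eq_Ex => f; congr ((bad_cycles _)%:R); apply/setP => u.
    by rewrite !inE ffunE.
  - exact: relabel_edge_inj.
  by move=> u b; rewrite (big_pred1 b) // /bern qs.
have tot : (w`!)%:R * Pr (bern q) (fun f => bad_cycles (on_set f)) <=
    (r * (w.+1)`!)%:R / (2 ^ K.+1)%:R.
  have -> : (w`!)%:R * Pr (bern q) (fun f => bad_cycles (on_set f)) =
      \sum_(s : {perm 'I_w}) Pr (bern q) (fun f => bad_cycles (relabelled s (on_set f))).
    rewrite (eq_bigr (fun=> Pr (bern q) (fun f => bad_cycles (on_set f)))) => [|s _].
      by rewrite sumr_const card_Sn mulr_natl.
    exact: inv.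
  rewrite -Ex_sum -[leRHS](Ex_cst ww); apply: (Ex_le ww) => f.
  rewrite -natr_sum ler_pdivlMr ?ltr0n ?expn_gt0 // -natrM ler_nat.
  apply: leq_trans (count_bad_relabelling (on_set f)); rewrite leq_mul2r; apply/orP; right.
  rewrite -sum1_card [leqRHS]big_mkcond leq_eqVlt; apply/orP; left; apply/eqP.
  by apply: eq_big => // s _; rewrite inE; case: (bad_cycles _).
have f0 : 0 < (w`!)%:R :> R by rewrite ltr0n fact_gt0.
rewrite -(ler_pM2l f0); apply: le_trans tot _.
by rewrite factS mulnA [(_ * w`!)%N]mulnC natrM mulrA.
Qed.

End Count.
End Relabel.

(** * The random layered graph and its bad events *)

Section RandomBlocks.
Local Open Scope ring_scope.
Variables (w rho r d s0 M0 g0 K : nat) (q0 eta e : R).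
Hypothesis w0 : (0 < w)%N.
Hypothesis q01 : 0 <= q0 <= 1.
Hypothesis eta_half : 0 <= eta <= 1 / 2.
Let V : finType := vtx w rho.
Let nu : nat := (3 * w + rho)%N.
Let pairs : {set {set V}} := pair_sets V.

(** Pairs between layers feed the matchings and get almost all of the density. Pairs inside a layer
    are kept sparse; they guarantee the degree that the matchings cannot use up. A share eta of the
    density is reserved for sprinkling on all pairs. *)
Definition main_weight (u : {set V}) : R :=
  if u \in pairs then (if same_layer u then eta * q0 else (1 - eta) * q0) else 0.

Definition sprinkle_weight (u : {set V}) : R := if u \in pairs then eta * q0 else 0.

Lemma eta_q0 : 0 <= eta * q0 <= (1 - eta) * q0 /\ (1 - eta) * q0 <= q0.
Proof. by case/andP: q01 => a b; case/andP: eta_half => a' b'; split; nra. Qed.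

Lemma main_weight_le u : 0 <= main_weight u <= q0.
Proof.
rewrite /main_weight; have [/andP[h1 h2] h3] := eta_q0; case/andP: q01 => a b.
by case: ifP => _; [case: ifP => _|]; lra.
Qed.

Lemma main_weight01 u : 0 <= main_weight u <= 1.
Proof. by have := main_weight_le u; case/andP: q01 => a b; lra. Qed.

Lemma sprinkle_weight01 u : 0 <= sprinkle_weight u <= 1.
Proof.
rewrite /sprinkle_weight; have [/andP[h1 h2] h3] := eta_q0; case/andP: q01 => a b.
by case: ifP => _; lra.
Qed.

Let ww := bern_weight main_weight01.

Lemma pair2 (x y : V) : x != y -> [set x; y] \in pairs.
Proof. by move=> xy; rewrite inE cards2 xy. Qed.

Hypothesis e14 : 0 < e <= 1 / 4.
Hypothesis r_le : r%:R <= (1 - e) * (w%:R * ((1 - eta) * q0)).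
Let y1 : R := exp (- (e ^+ 2 * (w%:R * ((1 - eta) * q0)) / 32)).
Hypothesis y1_small : w%:R * y1 <= 1 / 2.

Lemma cross_dense_bound (i : 'I_3) :
  Pr (bern main_weight) (fun f => ~~ dense r (cross_block (on_set f) i)) <= 8 * (w%:R * y1).
Proof.
have q01' : 0 <= (1 - eta) * q0 <= 1.
  by have [h1 h2] := eta_q0; case/andP: q01 => a b; lra.
have := @random_dense 'I_w ((1 - eta) * q0) e r q01' e14.
rewrite !card_ord => /(_ r_le y1_small); apply: le_trans.
rewrite le_eqVlt; apply/orP; left; apply/eqP.
pose emb (ab : 'I_w * 'I_w) : {set V} := [set inl (i, ab.1); inl (next_layer i, ab.2)].
have emb_inj : injective emb.
  by move=> [a b] [a' b'] /cross_pair_inj /= [_ -> ->].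
rewrite /Pr -(@Ex_pull _ _ _ _ (bern main_weight) emb (fun _ b => b) ww emb_inj).
  apply: eq_Ex => f; congr ((~~ dense r _)%:R); apply/setP => ab.
  by rewrite !inE ffunE.
move=> [a b] c; rewrite (big_pred1 c) //.
suff E : main_weight (emb (a, b)) = (1 - eta) * q0 by rewrite /bern E.
rewrite /main_weight /emb /= pair2.
  by rewrite same_layer_cross.
apply/eqP => /(congr1 (@layer w rho)) [/esym /eqP].
by rewrite (negbTE (next_layer_neq i)).
Qed.

Lemma inner_degree_bound (i : 'I_3) (a : 'I_w) :
  Pr (bern main_weight) (fun f => #|on_set f :&: inner_pairs (inl (i, a))|%:R <= d%:R :> R)
  <= exp (d%:R / 4 - 3 / 16 * ((w.-1)%:R * (eta * q0))).
Proof.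
apply: le_trans (lower_tail main_weight01 (a := 1 / 4) (mu := (w.-1)%:R * (eta * q0)) _ _ _) _.
- by lra.
- rewrite (eq_bigr (fun=> eta * q0)) => [|u]; last first.
    by rewrite inE => /andP[up /andP[_ sl]]; rewrite /main_weight up sl.
  rewrite sumr_const -[leRHS]mulr_natl ler_wpM2r //; first by have [/andP[]] := eta_q0.
  rewrite ler_nat.
  pose F (b : 'I_w) : {set V} := [set inl (i, a); inl (i, b)].
  have F_inj : {in [set~ a] &, injective F}.
    move=> b b'; rewrite !inE => ba b'a /setP/(_ (inl (i, b))).
    rewrite !inE eqxx orbT => /esym/orP[/eqP[e0]|/eqP[->] //].
    by rewrite e0 eqxx in ba.
  have <- : #|F @: [set~ a]| = w.-1 by rewrite card_in_imset // cardsC1 card_ord.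
  apply: subset_leq_card; apply/subsetP => _ /imsetP[b ba ->].
  rewrite !inE in ba *; rewrite eqxx /= cards2.
  have -> : ((inl (i, a) : V) != inl (i, b)) = (a != b).
    by congr (~~ _); apply/eqP/eqP => [[]|->].
  rewrite [a == b]eq_sym ba /=; apply/existsP; exists i.
  by apply/subsetP => v; rewrite !inE => /orP[/eqP->|/eqP->].
- by apply: exp_mono; lra.
Qed.

(** A leftover vertex has no matching edges but sees all three layers: its mean degree of about
    three layers' worth exceeds 2r, which is about two. *)
Lemma outer_degree_bound (z : 'I_rho) :
  Pr (bern main_weight) (fun f => #|on_set f :&: incident pairs (inr z)|%:R <= (d + 2 * r)%:R :> R)
  <= exp ((d + 2 * r)%:R / 8 - 7 / 64 * ((3 * w)%:R * ((1 - eta) * q0))).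
Proof.
apply: le_trans (lower_tail main_weight01 (a := 1 / 8)
  (mu := (3 * w)%:R * ((1 - eta) * q0)) _ _ _) _.
- by lra.
- rewrite (eq_bigr (fun=> (1 - eta) * q0)) => [|u]; last first.
    rewrite inE => /andP[up zu]; rewrite /main_weight up.
    case: ifP => // /existsP[i /subsetP/(_ _ zu)]; rewrite inE //.
  rewrite sumr_const -[leRHS]mulr_natl ler_wpM2r //.
    by have [/andP[]] := eta_q0; lra.
  rewrite ler_nat.
  pose F (x : 'I_3 * 'I_w) : {set V} := [set inr z; inl x].
  have F_inj : injective F.
    move=> x y /setP/(_ (inl x)); rewrite !inE eqxx orbT => /esym/orP[/eqP //|/eqP[-> //]].
  have <- : #|F @: setT| = (3 * w)%N by rewrite card_imset // cardsT card_prod !card_ord.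
  apply: subset_leq_card; apply/subsetP => _ /imsetP[x _ ->].
  by rewrite inE pair2 // !inE eqxx.
- by apply: exp_mono; lra.
Qed.

Let y4 : R := exp (- (d%:R / 12)).
Hypothesis s0_small : 72 * (q0 * s0%:R) <= d%:R.
Hypothesis y4_small : nu%:R * y4 <= 1 / 2.

Lemma card_inner_pairs (W : {set V}) : (#|inner_edges pairs W| <= #|W| * #|W|)%N.
Proof.
rewrite -cardsX; apply: (@leq_trans #|[set [set x.1; x.2] | x in setX W W]|); last first.
  exact: leq_imset_card.
apply: subset_leq_card; apply/subsetP => u; rewrite !inE => /andP[/cards2P[x [y [_ ->]]]].
rewrite subUset !sub1set => /andP[xW yW]; apply/imsetP; exists (x, y) => //.
by rewrite inE /= xW.
Qed.

(** The mean number of edges inside W is at most |W|^2 q0 with |W| <= 3 s0. By the choice of s0,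
    twice this is at most half of the threshold |W| d / 6, so W fails with probability y4^|W|, and
    the union bound is a binomial sum. *)
Lemma sparse_bound :
  Pr (bern main_weight) (fun f => [exists W : {set V}, (0 < #|W| <= 3 * s0)%N &&
     (#|W|%:R * d%:R / 6 <= #|on_set f :&: inner_edges pairs W|%:R :> R)])
  <= 2 * (nu%:R * y4).
Proof.
apply: le_trans (Pr_union ww _ _) _.
apply: (@le_trans _ _ (\sum_(W : {set V} | (0 < #|W|)%N) y4 ^+ #|W|)); last first.
  by have := @sum_set0_pow_le V y4 (exp_ge0 _); rewrite card_vtx; apply.
rewrite big_mkcond [leRHS]big_mkcond; apply: ler_sum => W _.
case: ifP => [/andP[W0 Ws]|_]; last by case: ifP => // _; rewrite exprn_ge0 // exp_ge0.
rewrite W0; apply: le_trans (upper_tail main_weight01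
  (mu := (#|W| * #|W|)%:R * q0) _ _) _.
  apply: (@le_trans _ _ (\sum_(u in inner_edges pairs W) q0)).
    by apply: ler_sum => u _; case/andP: (main_weight_le u).
  rewrite sumr_const -[leLHS]mulr_natl ler_wpM2r ?ler_nat ?card_inner_pairs //.
  by case/andP: q01.
rewrite /y4 expRX; apply: exp_mono; rewrite -[(- _) *+ #|W|]mulr_natl natrM.
have : (#|W|%:R : R) <= 3 * s0%:R by rewrite -natrM ler_nat.
have : 0 <= (#|W|%:R : R) by rewrite ler0n.
move: (#|W|%:R : R) (s0%:R : R) (d%:R : R) s0_small => x s D h x0 xs.
have h2 : 0 <= q0 by case/andP: q01.
have h3 : x * (q0 * x) <= x * (q0 * (3 * s)) by rewrite !ler_wpM2l.
have h4 : x * (72 * (q0 * s)) <= x * D by rewrite ler_wpM2l.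
by lra.
Qed.

Lemma edge_count_bound :
  Pr (bern main_weight) (fun f => g0%:R <= #|on_set f :&: pairs|%:R :> R)
  <= exp (2 * (nu%:R ^+ 2 * q0) - g0%:R).
Proof.
apply: (upper_tail main_weight01).
apply: (@le_trans _ _ (\sum_(u in pairs) q0)).
  by apply: ler_sum => u _; case/andP: (main_weight_le u).
rewrite sumr_const -[leLHS]mulr_natl ler_wpM2r //; first by case/andP: q01.
by rewrite -natrX ler_nat; apply: leq_trans (card_pair_sets _) _; rewrite card_vtx.
Qed.

Lemma main_weight_relabel s u : main_weight (relabel_edge s u) = main_weight u.
Proof. by rewrite /main_weight same_layer_relabel !inE card_relabel_edge. Qed.

Hypothesis room : (2 * (M0 + g0 + r * (K + rho)) <= s0 * s0)%N.

(** One term per bad event, in order: a block that is not dense, low degree in a layer, low degree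
    of a leftover vertex, a small dense set, too many edges, too many cycles; the last term is the
    failure of the sprinkling. *)
Definition graph_error : R :=
  24 * (w%:R * y1)
  + (3 * w)%:R * exp (d%:R / 4 - 3 / 16 * ((w.-1)%:R * (eta * q0)))
  + rho%:R * exp ((d + 2 * r)%:R / 8 - 7 / 64 * ((3 * w)%:R * ((1 - eta) * q0)))
  + 2 * (nu%:R * y4)
  + exp (2 * (nu%:R ^+ 2 * q0) - g0%:R)
  + (r * w.+1)%:R / (2 ^ K.+1)%:R
  + (1 - eta * q0) ^+ M0 * (1 + nu%:R ^+ 2) ^+ (r * (K + rho)).

Let bad1 (f : {ffun {set V} -> bool}) :=
  [exists i, true && ~~ dense r (cross_block (on_set f) i)].
Let bad2 (f : {ffun {set V} -> bool}) :=
  [exists ia : 'I_3 * 'I_w, true &&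
     (#|on_set f :&: inner_pairs (inl (ia.1, ia.2))|%:R <= d%:R :> R)].
Let bad3 (f : {ffun {set V} -> bool}) :=
  [exists z : 'I_rho, true &&
    (#|on_set f :&: incident pairs (inr z)|%:R <= (d + 2 * r)%:R :> R)].
Let bad4 (f : {ffun {set V} -> bool}) :=
  [exists W : {set V}, (0 < #|W| <= 3 * s0)%N &&
     (#|W|%:R * d%:R / 6 <= #|on_set f :&: inner_edges pairs W|%:R :> R)].
Let bad5 (f : {ffun {set V} -> bool}) := (g0%:R <= #|on_set f :&: pairs|%:R :> R).
Let bad6 (f : {ffun {set V} -> bool}) := bad_cycles r K (on_set f).

Lemma good_graph_packed f :
  ~~ [|| bad1 f, bad2 f, bad3 f, bad4 f, bad5 f | bad6 f] ->
  Pr (bern sprinkle_weight) (fun f2 => ~~ `[< packed r (on_set f :|: on_set f2) >])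
  <= (1 - eta * q0) ^+ M0 * (1 + nu%:R ^+ 2) ^+ (r * (K + rho)).
Proof.
rewrite !negb_or => /and5P[n1 n2 n3 n4 /andP[n5 n6]].
have dn i : dense r (cross_block (on_set f) i).
  by have /existsPn/(_ i) := n1; rewrite /= negbK.
have few : few_cycles r K (on_set f).
  by move: n6; rewrite /bad6 negb_and negbK => /orP[/forallPn[i]|/asboolP //]; rewrite dn.
case: few => p [pG p_dis] pK.
pose G := on_set f :&: pairs.
have crossG i : cross_block G i = cross_block (on_set f) i.
  apply/setP => ab; rewrite !inE; apply/andb_idr => _; rewrite cards2.
  suff -> : (inl (i, ab.1) : V) != inl (next_layer i, ab.2) by [].
  apply/eqP => /(congr1 (@layer w rho)) [/esym /eqP].
  by rewrite (negbTE (next_layer_neq i)).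
have pG' i j a : (a, p i j a) \in cross_block G i by rewrite crossG.
have deg v : (d + 2 * r <= #|incident G v|)%N.
  case: v => [[i a]|z].
    apply: (layer_vertex_degree pG' p_dis).
    have /existsPn/(_ (i, a)) := n2; rewrite /= -ltNge ltr_nat => /ltnW.
    congr (_ <= _)%N; apply: eq_card => u; rewrite !inE.
    by case: (f u) => //=; case: (#|u| == 2).
  have /existsPn/(_ z) := n3; rewrite /= -ltNge ltr_nat => /ltnW.
  by congr (_ <= _)%N; apply: eq_card => u; rewrite !inE andbA.
have sparse (W : {set V}) : (0 < #|W| <= 3 * s0)%N -> (6 * #|inner_edges G W| < #|W| * d)%N.
  move=> hW; have /existsPn/(_ W) := n4; rewrite hW /= -ltNge.
  rewrite ltr_pdivlMr // -!natrM ltr_nat mulnC.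
  by congr (_ * _ < _)%N; apply: eq_card => u; rewrite !inE andbA.
have cG : (#|G| < g0)%N by move: n5; rewrite /bad5 -ltNge ltr_nat.
have cyc : (total_cycles r (layer_perms rho p) <= r * (K + rho))%N.
  rewrite /total_cycles -[X in (_ <= X * _)%N]card_ord -sum_nat_const; apply: leq_sum => j _.
  rewrite /num_cycles layer_permsE; apply: leq_trans (card_porbits_layer _ _) _.
  by rewrite leq_add2r.
have room' : (2 * (M0 + #|G| + total_cycles r (layer_perms rho p)) <= s0 * s0)%N.
  apply: leq_trans room; rewrite leq_mul2l /=; apply: leq_add cyc.
  by rewrite leq_add2l ltnW.
have v0 : V := inl (ord0, Ordinal w0).
have [/andP[b0 b1] b2] := eta_q0; case/andP: (q01) => q0_ge0 q0_le1.
have b01 : 0 <= eta * q0 <= 1 by apply/andP; split=> //; lra.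
have := sprinkle_bound (subsetIr _ _) (layer_perms_sub pG') (layer_perms_dis rho p_dis) deg sparse v0
   room' sprinkle_weight01 b01.
have hb u : u \in pair_sets V -> sprinkle_weight u = eta * q0.
  by rewrite /sprinkle_weight /pairs => ->.
move=> /(_ hb) le; apply: le_trans (le_trans _ le) _.
  apply: (Pr_le (bern_weight sprinkle_weight01)) => f2; apply: contraNN => /asboolP[c [h1 h2]].
  apply/asboolP; exists c; split=> // i; have [? ? sub] := h1 i; split=> //.
  by apply: subset_trans sub _; apply: setSU; apply: subsetIl.
have X0 : 0 <= (1 - eta * q0) ^+ M0 by rewrite exprn_ge0 // subr_ge0; case/andP: b01.
apply: (ler_wpM2l X0).
have nu1 : 1 <= 1 + nu%:R ^+ 2 :> R by rewrite lerDl exprn_ge0.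
have le1 : 1 + #|pair_sets V|%:R <= 1 + nu%:R ^+ 2 :> R.
  by rewrite lerD2l -natrX ler_nat; apply: leq_trans (card_pair_sets _) _; rewrite card_vtx.
apply: (@le_trans _ _ ((1 + nu%:R ^+ 2) ^+ total_cycles r (layer_perms rho p))).
  by apply: lerXn2r; rewrite ?nnegrE //; [apply: addr_ge0|apply: le_trans nu1].
by rewrite ler_weXn2l.
Qed.

Lemma graph_bound :
  Ex (bern main_weight) (fun f => Pr (bern sprinkle_weight)
     (fun f2 => ~~ `[< packed r (on_set f :|: on_set f2) >])) <= graph_error.
Proof.
set X := (1 - eta * q0) ^+ M0 * (1 + nu%:R ^+ 2) ^+ (r * (K + rho)).
have [/andP[b0 b1] b2] := eta_q0; case/andP: (q01) => q0_ge0 q0_le1.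
have X0 : 0 <= X.
  by rewrite mulr_ge0 // exprn_ge0 //; [lra|rewrite addr_ge0 // exprn_ge0].
pose bad f := [|| bad1 f, bad2 f, bad3 f, bad4 f, bad5 f | bad6 f].
apply: (@le_trans _ _ (Pr (bern main_weight) bad + X)).
  rewrite -[X in _ + X](Ex_cst ww) -ExD; apply: (Ex_le ww) => f.
  have [bf|nb] := boolP (bad f); last by rewrite add0r good_graph_packed.
  by rewrite ler_wpDr // Pr_le1 //; apply: bern_weight sprinkle_weight01.
rewrite /graph_error lerD2r.
apply: le_trans (PrU ww _ _) _; rewrite -!addrA lerD //.
  apply: le_trans (Pr_union ww _ _) _.
  apply: (@le_trans _ _ (\sum_(i < 3) 8 * (w%:R * y1))).
    by apply: ler_sum => i _; apply: cross_dense_bound.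
  by rewrite sumr_const card_ord -[leLHS]mulr_natl mulrA -natrM.
apply: le_trans (PrU ww _ _) _; rewrite lerD //.
  apply: le_trans (Pr_union ww _ _) _.
  apply: (@le_trans _ _ (\sum_(ia : 'I_3 * 'I_w) exp (d%:R / 4 - 3 / 16 * ((w.-1)%:R * (eta * q0))))).
    by apply: ler_sum => i _; apply: inner_degree_bound.
  by rewrite sumr_const card_prod !card_ord -[leLHS]mulr_natl.
apply: le_trans (PrU ww _ _) _; rewrite lerD //.
  apply: le_trans (Pr_union ww _ _) _.
  apply: (@le_trans _ _ (\sum_(z < rho) exp ((d + 2 * r)%:R / 8 - 7 / 64 * ((3 * w)%:R * ((1 - eta) * q0))))).
    by apply: ler_sum => i _; apply: outer_degree_bound.
  by rewrite sumr_const card_ord -[leLHS]mulr_natl.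
apply: le_trans (PrU ww _ _) _; rewrite lerD //; first exact: sparse_bound.
apply: le_trans (PrU ww _ _) _; rewrite lerD //; first exact: edge_count_bound.
apply: bad_cycles_bound; [exact: main_weight01|exact: main_weight_relabel].
Qed.

End RandomBlocks.

(** * From a single structure to the random hypergraph *)

Section LogFacts.
Local Open Scope ring_scope.

Definition lnn (n : nat) : R := ln (INR n).

Lemma exp_lnn n : (0 < n)%N -> exp (lnn n) = n%:R.
Proof.
move=> n0; rewrite /lnn exp_ln ?INRE //.
by apply/RltP; rewrite ltr0n.
Qed.

Lemma exp_lnnM n (k : nat) : (0 < n)%N -> exp (k%:R * lnn n) = n%:R ^+ k.
Proof. by move=> n0; rewrite -(exp_lnn n0) expRX mulr_natl. Qed.

Lemma lnn_ge (A : R) : exists n0 : nat, forall n, (n0 <= n)%N -> A <= lnn n.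
Proof.
exists (Num.truncn (exp A)).+1 => n le; have n0 : (0 < n)%N by apply: leq_trans le.
rewrite leNgt; apply/negP => /RltP lt; have /RltP := exp_increasing _ _ lt.
rewrite exp_lnn // ltNge => /negP; apply.
apply: ltW; apply: lt_le_trans (_ : (Num.truncn (exp A)).+1%:R <= _); last by rewrite ler_nat.
exact: truncnS_gt.
Qed.

Lemma nat_floor (x : R) : 0 <= x -> exists m : nat, m%:R <= x < m.+1%:R.
Proof. by move=> x0; exists (Num.truncn x); apply: truncn_itv. Qed.

End LogFacts.

Section Glue.
Local Open Scope ring_scope.

(* The reduction target: edge slots [U] of one random structure with relative
   weights [g]; [e] is the error parameter and [q0] the edge density within one
   structure. *)
Definition scheme (k l : nat) (kap0 kap1 : R) : Prop :=
  exists2 C : R, 0 < C & exists n0 : nat, forall (n : nat) (e : R),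
    (n0 <= n)%N -> (l %| n)%N -> 0 < e -> C * e <= 1 ->
    lnn n ^+ 2 <= e ^+ 4 * n%:R ->
    exists (U : finType) (emb : U -> {set 'I_n}) (g : U -> R),
      [/\ injective emb, (forall u, 0 <= g u <= 1),
          (forall u, g u != 0 -> #|emb u| = k) & 1 <= \sum_u g u] /\
      forall q0 : R, 0 <= q0 <= 1 ->
      kap0 * lnn n <= n%:R * q0 * e ^+ 2 <= kap1 * lnn n ->
      exists (h : U -> R) (r : nat),
      [/\ (forall u, 0 <= h u <= q0 * g u),
          (1 - C * e) * (q0 * (\sum_u g u) * (l%:R / n%:R)) <= r%:R &
          Pr (bern h) (fun f => ~~ `[< ham_packing k l r emb (on_set f) >]) <=
            exp (- ((k.+2)%:R * lnn n))].

(** [master_bound] with no copies at all. *)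
Lemma certain_packing n k l (p b : R) : 0 <= p <= 1 -> (0 < n %/ l)%N -> b <= 0 ->
  1 <= @prob_H n k p (has_disjoint_ham_cycles k l b).
Proof.
move=> p01 nl b0.
have := @master_bound n k l 0 0 'I_0 (fun _ => set0) (fun _ => 0) (fun _ => 0) p 0 0 1
  [ffun=> 1%g].
rewrite !mul0r subr0; apply=> //.
- by move=> [].
- by move=> [].
- by move=> [].
- by case/andP: p01.
- by move=> s; rewrite big_ord0.
- by apply: Pr_le1; apply: bern_weight => -[].
Qed.

Lemma slot_density_le1 n k (U : finType) (emb : U -> {set 'I_n}) (g : U -> R) :
  injective emb -> (forall u, 0 <= g u <= 1) -> (forall u, g u != 0 -> #|emb u| = k) ->
  (k <= n)%N -> slot_density n k g <= 1.
Proof.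
move=> inj g01 supp kn; rewrite /slot_density.
have C0 : 0 < 'C(n, k)%:R :> R by rewrite ltr0n bin_gt0.
rewrite ler_pdivrMr // mul1r.
apply: (@le_trans _ _ (\sum_(u | #|emb u| == k) 1)).
  rewrite [leRHS]big_mkcond; apply: ler_sum => u _; have /andP[_ g1] := g01 u.
  by case: eqP => // /eqP ne; apply: (contraNle _ ne) => g0; apply/eqP/supp; rewrite gt_eqF.
rewrite sumr_const ler_nat -(card_imset _ inj) -[in leqRHS](card_ord n) -card_draws.
apply: subset_leq_card; apply/subsetP => _ /imsetP[u uk ->].
by move: uk; rewrite unfold_in /= inE.
Qed.

Lemma binomial_le_exp n k : (0 < n)%N -> 'C(n, k)%:R <= exp (k%:R * lnn n).
Proof.
move=> n0; rewrite exp_lnnM // -natrX ler_nat.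
have h : ('C(n, k) <= n ^_ k)%N by rewrite -bin_ffact leq_pmulr // fact_gt0.
apply: leq_trans h _; elim: k => [|k IH]; first by rewrite ffactn0.
by rewrite ffactnSr expnSr leq_mul // leq_subr.
Qed.

Lemma error_term (x L e : R) : 0 < x -> 0 <= L -> e = sqrt (L / sqrt x) ->
  0 <= e /\ e ^+ 4 * x = L ^+ 2.
Proof.
move=> x0 L0 ->; have x0' : Rle 0 x by apply/RleP/ltW.
have s0 : 0 < sqrt x by apply/RltP/sqrt_lt_R0/RltP.
have sx : sqrt x * sqrt x = x by exact: sqrt_sqrt.
have q0 : 0 <= L / sqrt x by rewrite divr_ge0 // ltW.
split; first by apply/RleP/sqrt_pos.
have sq : sqrt (L / sqrt x) * sqrt (L / sqrt x) = L / sqrt x.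
  by apply: sqrt_sqrt; apply/RleP.
move: sq s0 sx {q0 x0 x0'}; set t := sqrt _; set s := sqrt x => sq s0 sx.
have -> : t ^+ 4 = (L / s) ^+ 2 by rewrite -sq; ring.
clearbody s; rewrite -sx; field.
by rewrite gt_eqF.
Qed.

(** Uneven coverage divides the yield by 1 + 4e, which costs the additional 4 in the constant. *)
Lemma packing_arith (C e p th S B l n m r : R) :
  0 < C -> 0 < e -> (C + 4) * e <= 1 -> 0 < p -> 0 < th -> 0 < S -> S = th * B -> 0 < l -> 0 < n ->
  0 < m -> (1 - C * e) * ((p / ((1 + 4 * e) * (m * th))) * S * (l / n)) <= r ->
  (1 - (C + 4) * e) * B * p / (n / l) <= m * r.
Proof.
move=> C0 e0 Ce p0 th0 S0 SE l0 n0 m0 h.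
have B0 : 0 < B by rewrite -(pmulr_rgt0 B th0) -SE.
have e4 : 0 < 1 + 4 * e by lra.
apply: le_trans (ler_wpM2l (ltW m0) h).
have -> : m * ((1 - C * e) * (p / ((1 + 4 * e) * (m * th)) * S * (l / n))) =
    (1 - C * e) / (1 + 4 * e) * (B * p * (l / n)).
  rewrite SE; field; by rewrite !gt_eqF.
have -> : (1 - (C + 4) * e) * B * p / (n / l) = (1 - (C + 4) * e) * (B * p * (l / n)).
  by field; rewrite !gt_eqF.
apply: ler_wpM2r; first by rewrite !mulr_ge0 ?invr_ge0 // ltW.
rewrite ler_pdivlMr //.
have : 0 <= (C + 4) * e * e by rewrite !mulr_ge0 //; lra.
by lra.
Qed.

Lemma packing_at n k l (C e p : R) (U : finType) (emb : U -> {set 'I_n}) (g : U -> R) :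
  (0 < l)%N -> (l %| n)%N -> (0 < n)%N -> (k <= n)%N -> 0 < C -> 0 < e -> (C + 4) * e <= 1 ->
  1 <= lnn n -> 0 < p <= 1 -> e ^+ 4 * (n%:R * p) = lnn n ^+ 2 ->
  injective emb -> (forall u, 0 <= g u <= 1) -> (forall u, g u != 0 -> #|emb u| = k) ->
  1 <= \sum_u g u ->
  (forall q0 : R, 0 <= q0 <= 1 ->
      1 / (4 * k.+1%:R) * lnn n <= n%:R * q0 * e ^+ 2 <= 1 / k.+1%:R * lnn n ->
      exists (h : U -> R) (r : nat),
      [/\ (forall u, 0 <= h u <= q0 * g u),
          (1 - C * e) * (q0 * (\sum_u g u) * (l%:R / n%:R)) <= r%:R &
          Pr (bern h) (fun f => ~~ `[< ham_packing k l r emb (on_set f) >]) <=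
            exp (- ((k.+2)%:R * lnn n))]) ->
  forall b : R, b = (1 - (C + 4) * e) * 'C(n, k)%:R * p / (n%:R / l%:R) ->
  1 - (k.+1%:R + 1) / n%:R <= @prob_H n k p (has_disjoint_ham_cycles k l b).
Proof.
move=> l0 ln n0 kn C0 e0 Ce L1 /andP[p0 p1] e4 inj g01 supp S1 hq b ->.
set L := lnn n in L1 e4 hq; set S := \sum_u g u in S1 hq.
have nR : 0 < n%:R :> R by rewrite ltr0n.
have lR : 0 < l%:R :> R by rewrite ltr0n.
have BR : 0 < 'C(n, k)%:R :> R by rewrite ltr0n bin_gt0.
have K1 : 0 < k.+1%:R :> R by rewrite ltr0n.
set th := slot_density n k g.
have SE : S = th * 'C(n, k)%:R by rewrite /th /slot_density divfK // gt_eqF.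
have th1 : th <= 1 := slot_density_le1 inj g01 supp kn.
have th0 : 0 < th by rewrite -(pmulr_lgt0 th BR) -SE; lra.
have e1 : e <= 1 / 4 by nra.
have e2 : 0 < e ^+ 2 by rewrite exprn_gt0.
(* The target mean coverage: the factor k + 1 beats the n^k sets in the union bound of
   [exists_cover]. *)
pose x := k.+1%:R * L / e ^+ 2.
have x0 : 0 < x by rewrite /x divr_gt0 // mulr_gt0 //; lra.
have [m0 /andP[m0x xm0]] := nat_floor (ltW (divr_gt0 x0 th0)); set m := m0.+1.
have mR : 0 < m%:R :> R by rewrite ltr0n.
have mth_lo : x <= m%:R * th by rewrite -ler_pdivrMr // ltW.
have m_hi : m%:R <= x / th + 1 by rewrite /m -natr1 lerD2r.
have mth_hi : m%:R * th <= x + 1.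
  have := ler_wpM2r (ltW th0) m_hi; rewrite mulrDl divfK ?gt_eqF // mul1r; lra.
have x1 : 1 <= x.
  rewrite /x ler_pdivlMr // mul1r.
  have : e ^+ 2 <= 1 by rewrite expr2; nra.
  have : (1 : R) <= k.+1%:R by rewrite ler1n.
  move: (k.+1%:R : R) => K; nra.
set D := (1 + 4 * e) * (m%:R * th).
have D_lo : x <= D by rewrite /D; nra.
have D_hi : D <= 4 * x by rewrite /D; nra.
have D0 : 0 < D by lra.
have [s cov] : exists s : {ffun 'I_m -> {perm 'I_n}}, forall E,
    \sum_j slot_weight emb g (s j) E <= D.
  apply: (exists_cover inj g01 supp kn); first by lra.
  have h1 := binomial_le_exp k n0.
  apply: (@le_lt_trans _ _ (exp (k%:R * L) * exp (- (2 * e ^+ 2 * (m%:R * th))))).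
    by rewrite ler_wpM2r // exp_ge0.
  rewrite expRM -[ltRHS]exp0; apply/RltP/exp_increasing/RltP.
  have : e ^+ 2 * x <= e ^+ 2 * (m%:R * th) by rewrite ler_wpM2l // ltW.
  have -> : e ^+ 2 * x = k.+1%:R * L by rewrite /x mulrC divfK // gt_eqF.
  rewrite -natr1 => h2; have kR : 0 <= (k%:R : R) by rewrite ler0n.
  have : 0 <= k%:R * L by rewrite mulr_ge0 //; lra.
  by move: h2; rewrite mulrDl; lra.
pose q0 := p / D.
have q01 : 0 <= q0 <= 1.
  apply/andP; split; first by apply: divr_ge0; apply: ltW.
  by rewrite /q0 ler_pdivrMr // mul1r; lra.
(* The defining relation of e puts the density of one copy in a window of order log n / (n e^2),
   whose width is the factor 4 between x and the bound on D. *)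
have nq : n%:R * q0 * e ^+ 2 = k.+1%:R^-1 * L * (x / D).
  have np : n%:R * p = L ^+ 2 / e ^+ 4.
    by rewrite -e4 mulrC mulrAC divff ?mul1r // gt_eqF // exprn_gt0.
  rewrite /q0 mulrA np /x; field.
  by rewrite addrC natr1 !gt_eqF.
have kap : 1 / (4 * k.+1%:R) * L <= n%:R * q0 * e ^+ 2 <= 1 / k.+1%:R * L.
  rewrite nq; have L0 : 0 <= k.+1%:R^-1 * L by rewrite mulr_ge0 ?invr_ge0 ?ltW //; lra.
  have -> : 1 / (4 * k.+1%:R) * L = k.+1%:R^-1 * L * (1 / 4).
    by field; rewrite addrC natr1 gt_eqF.
  have -> : 1 / k.+1%:R * L = k.+1%:R^-1 * L * 1 by rewrite mulr1 mul1r.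
  apply/andP; split; apply: ler_wpM2l => //.
    by rewrite ler_pdivlMr //; lra.
  by rewrite ler_pdivrMr //; lra.
have [h [r [hle rle fail]]] := hq q0 q01 kap.
have q0D : q0 * D <= p by rewrite /q0 divfK ?gt_eqF.
have p01 : 0 <= p <= 1 by rewrite p1 ltW.
have nl0 : (0 < n %/ l)%N by rewrite divn_gt0 // dvdn_leq.
have q0_ge0 : 0 <= q0 by case/andP: q01.
have := master_bound inj supp hle p01 q0D cov q0_ge0 nl0 fail.
have bm : (1 - (C + 4) * e) * 'C(n, k)%:R * p / (n%:R / l%:R) <= (m * r)%:R.
  rewrite natrM; apply: (packing_arith C0 e0 Ce p0 th0 _ SE lR nR mR rle); lra.
move=> /(_ _ bm); apply: le_trans; rewrite lerD2l lerN2.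
(* The number of copies is about x / th, where 1 / th is at most n^k because the structure has total
   weight at least 1, and L / e^2 is at most n. *)
have mbound : (m%:R : R) <= (k.+1%:R + 1) * n%:R ^+ k.+1.
  have thB : 1 / th <= 'C(n, k)%:R.
    by rewrite ler_pdivrMr // mulrC -SE.
  have Bn : 'C(n, k)%:R <= n%:R ^+ k :> R.
    by have := binomial_le_exp k n0; rewrite exp_lnnM.
  have Le : L / e ^+ 2 <= n%:R.
    have n1 : (1 : R) <= n%:R by rewrite ler1n.
    have le0 : 0 <= L / e ^+ 2 by rewrite divr_ge0 // ltW // (lt_le_trans ltr01).
    have : (L / e ^+ 2) ^+ 2 <= n%:R.
      rewrite expr_div_n -e4 -exprM ler_pdivrMr ?exprn_gt0 // mulrC ler_wpM2r //.
        by rewrite exprn_ge0 // ltW.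
      by rewrite -[leRHS]mulr1 ler_wpM2l // ltW.
    move: (L / e ^+ 2) (n%:R : R) le0 n1; clear => y z y0 z1; rewrite expr2; nra.
  suff le3 : x / th + 1 <= (k.+1%:R + 1) * n%:R ^+ k.+1 by exact: le_trans m_hi le3.
  have -> : x / th = k.+1%:R * ((L / e ^+ 2) * (1 / th)).
    by rewrite /x; field; rewrite !gt_eqF.
  rewrite mulrDl [1 * n%:R ^+ _]mul1r; apply: lerD.
    apply: ler_wpM2l; first exact: ltW.
    rewrite [n%:R ^+ _]exprS; apply: ler_pM => //.
    - by rewrite divr_ge0 // ltW // (lt_le_trans ltr01).
    - by rewrite divr_ge0 // ltW.
    - exact: le_trans thB Bn.
  by rewrite -natrX ler1n expn_gt0 n0.
apply: (@le_trans _ _ ((k.+1%:R + 1) * n%:R ^+ k.+1 * exp (- (k.+2%:R * L)))).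
  by rewrite ler_wpM2r // exp_ge0.
have E : exp (- (k.+2%:R * L)) = (n%:R ^+ k.+2)^-1.
  apply: (@mulfI _ (n%:R ^+ k.+2)); first by rewrite gt_eqF // exprn_gt0.
  by rewrite divff ?gt_eqF ?exprn_gt0 // -exp_lnnM // exp_inv.
rewrite E [n%:R ^+ k.+2]exprS le_eqVlt; apply/orP; left; apply/eqP; field.
by rewrite !gt_eqF // exprn_gt0.
Qed.

Theorem scheme_packing (k l : nat) : (0 < l)%N ->
  scheme k l (1 / (4 * k.+1%:R)) (1 / k.+1%:R) ->
  exists Cst : R, 0 < Cst /\
  forall p : nat -> R, (forall n, (l %| n)%N -> 0 < p n /\ p n <= 1) ->
  forall delta : R, 0 < delta ->
  exists N : nat, forall n : nat, (N <= n)%N -> (l %| n)%N ->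
  forall e b : R, e = sqrt (lnn n / sqrt (n%:R * p n)) ->
    b = (1 - Cst * e) * 'C(n, k)%:R * p n / (n%:R / l%:R) ->
    1 - delta <= @prob_H n k (p n) (has_disjoint_ham_cycles k l b).
Proof.
move=> l0 [C C0 [n0 hS]]; exists (C + 4); split; first by lra.
move=> p p01 delta delta0.
have [n1 hn1] := lnn_ge 1.
have x0 : 0 <= (k.+1%:R + 1) / delta by rewrite divr_ge0 ?addr_ge0 // ltW.
have [n2 /andP[_ hn2]] := nat_floor x0.
exists (maxn (maxn n0 n1) (maxn n2.+1 (maxn k l))) => n; rewrite !geq_max.
move=> /andP[/andP[nn0 nn1] /andP[nn2 /andP[kn lnn']]] ln e b eE bE.
have n_gt0 : (0 < n)%N by apply: leq_trans nn2.
have [pn0 pn1] := p01 n ln.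
have nR : 0 < n%:R :> R by rewrite ltr0n.
have np0 : 0 < n%:R * p n by rewrite mulr_gt0.
have L1 := hn1 n nn1.
have [e0 e4] := error_term np0 (le_trans ler01 L1) eE.
have nl0 : (0 < n %/ l)%N by rewrite divn_gt0.
(* For large e the number of cycles asked for is not positive. *)
have [big|small] := lerP 1 ((C + 4) * e).
  apply: (@le_trans _ _ 1); first by lra.
  apply: certain_packing => //; first by rewrite pn1 ltW.
  rewrite bE; apply: mulr_le0_ge0; last by rewrite invr_ge0 divr_ge0.
  apply: mulr_le0_ge0; last exact: ltW.
  by apply: mulr_le0_ge0; rewrite ?ler0n //; lra.
have e_gt0 : 0 < e.
  rewrite lt_neqAle e0 andbT eq_sym; apply/eqP => ez.
  by move: e4; rewrite ez expr0n mul0r => /esym/eqP; rewrite expf_eq0 /= gt_eqF //; lra.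
have Le : lnn n ^+ 2 <= e ^+ 4 * n%:R.
  by rewrite -e4 ler_wpM2l ?exprn_ge0 // -[leRHS]mulr1 ler_wpM2l // ltW.
have Ce : C * e <= 1 by nra.
have [U [emb [g [[inj g01 supp S1] hq]]]] := hS n e nn0 ln e_gt0 Ce Le.
have pn : 0 < p n <= 1 by rewrite pn0.
apply: le_trans (packing_at l0 ln n_gt0 kn C0 e_gt0 (ltW small) L1 pn e4 inj g01 supp S1 hq bE).
rewrite lerD2l lerN2 ler_pdivrMr // mulrC -ler_pdivrMr //.
by apply: ltW; apply: lt_le_trans hn2 _; rewrite ler_nat.
Qed.

End Glue.

(** * Parameters for a short overlap *)

Section ShortScheme.
Local Open Scope ring_scope.

Lemma exp_tail n (a b : nat) (X : R) : (0 < n)%N -> (a + b)%:R * lnn n <= X ->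
  n%:R ^+ a * exp (- X) <= exp (- (b%:R * lnn n)).
Proof.
move=> n0 le; rewrite -exp_lnnM // expRM; apply: exp_mono.
by move: le; rewrite natrD mulrDl; lra.
Qed.

Lemma pow4_ge (x : R) : 3 <= x -> 16 * x <= x ^+ 4.
Proof.
move=> x3; rewrite exprSr ler_wpM2r //; first by lra.
have : 9 <= x ^+ 2 by rewrite expr2; nra.
by rewrite exprSr; nra.
Qed.

Lemma floor_matching (c e d : R) : 0 < c -> c * e <= 1 / 4 -> 0 < e -> 1 <= c * e * d -> 0 <= d ->
  exists r : nat, r%:R <= (1 - c * e) * d /\ (1 - 2 * c * e) * d <= r%:R.
Proof.
move=> c0 ce e0 ced d0.
have h : 0 <= (1 - c * e) * d by rewrite mulr_ge0 //; lra.
have [r /andP[r1 r2]] := nat_floor h; exists r; split=> //.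
by move: r2; rewrite -natr1; lra.
Qed.

Theorem short_scheme (k l : nat) (kap0 kap1 : R) : (2 <= k)%N -> (l <= k)%N -> (k < 2 * l)%N ->
  0 < kap0 -> scheme k l kap0 kap1.
Proof.
move=> k2 lk k2l kap0_gt0.
have l1 : (1 < l)%N by lia.
have l0 : (0 < l)%N by lia.
have lR : 0 < l%:R :> R by rewrite ltr0n.
(* Chosen so that (c e)^2 d / 32 is at least (k + 6) log n, for d the mean degree n q0 / l: the
   exponent of [random_dense] at loss c e. The added 1 ensures c >= 1. *)
pose c : R := 32 * (l%:R / kap0) * (k%:R + 6) + 1.
have lk0 : 0 < l%:R / kap0 by rewrite divr_gt0.
have kR : 0 <= k%:R :> R by rewrite ler0n.
have c1 : 1 <= c.
  have : 0 <= 32 * (l%:R / kap0) * (k%:R + 6) by apply: mulr_ge0; lra.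
  by rewrite /c; lra.
have c_lk : l%:R / kap0 <= c by rewrite /c; nra.
have c2 : 32 * (l%:R / kap0) * (k%:R + 6) <= c ^+ 2.
  by rewrite expr2; apply: (@le_trans _ _ c); [rewrite /c; lra|nra].
have [n1 hn1] := lnn_ge 1.
exists (4 * c); first by lra.
exists (maxn n1 (3 * l)%N) => n e; rewrite geq_max => /andP[nn1 n3l] ln e0 ce Le.
have n0 : (0 < n)%N by apply: leq_trans n3l; rewrite muln_gt0.
have L1 := hn1 n nn1.
have nu3 : (2 < n %/ l)%N by rewrite leq_divRL.
set nu := (n %/ l)%N in nu3.
have nE : n%:R = nu%:R * l%:R :> R by rewrite -natrM divnK.
have nuR : 0 < nu%:R :> R by rewrite ltr0n (ltn_trans _ nu3).
have lnE : l%:R / n%:R = nu%:R^-1 :> R by rewrite nE invfM mulrCA divff ?mulr1 // gt_eqF.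
(* All slots of the complete bipartite graph have full weight. *)
exists ('I_nu * 'I_nu)%type, (slot_edge l1 lk k2l ln nu3), (fun=> 1); split.
  split.
  - exact: slot_edge_inj.
  - by move=> u; rewrite ler01 lexx.
  - by move=> u _; apply: card_slot_edge.
  - by rewrite sumr_const card_prod card_ord ler1n muln_gt0 andbb (ltn_trans _ nu3).
move=> q0 /andP[q0_ge0 q0_le1] /andP[kq _].
have Sg : \sum_(u : 'I_nu * 'I_nu) (1 : R) = nu%:R * nu%:R.
  by rewrite sumr_const card_prod card_ord natrM.
pose d : R := nu%:R * q0.
have d0 : 0 <= d by rewrite mulr_ge0 // ltW.
have de : l%:R / kap0 * (d * e ^+ 2) >= lnn n.
  have -> : l%:R / kap0 * (d * e ^+ 2) = (n%:R * q0 * e ^+ 2) / kap0.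
    by rewrite nE /d; field; rewrite gt_eqF.
  by rewrite ler_pdivlMr // mulrC.
have ce4 : c * e <= 1 / 4 by lra.
have e1 : e <= 1 by nra.
have de0 : 0 <= d * e ^+ 2 by rewrite mulr_ge0 // sqr_ge0.
have ced : 1 <= c * e * d.
  have h1 : l%:R / kap0 * (d * e ^+ 2) <= c * (d * e ^+ 2) by rewrite ler_wpM2r.
  have h2 : d * e ^+ 2 <= d * e by rewrite ler_wpM2l // expr2; nra.
  have h3 : c * (d * e ^+ 2) <= c * (d * e) by rewrite ler_wpM2l //; lra.
  by lra.
have [r [r1 r2]] := floor_matching (lt_le_trans ltr01 c1) ce4 e0 ced d0.
exists (fun=> q0), r; split.
- by move=> u; rewrite mulr1 lexx q0_ge0.
- rewrite Sg lnE; apply: le_trans r2.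
  have -> : q0 * (nu%:R * nu%:R) * nu%:R^-1 = d by rewrite /d; field; rewrite gt_eqF.
  by rewrite ler_wpM2r //; nra.
have X_ge : (k + 6)%:R * lnn n <= (c * e) ^+ 2 * d / 32.
  have h1 : 32 * (l%:R / kap0) * (k%:R + 6) * (d * e ^+ 2) <= c ^+ 2 * (d * e ^+ 2).
    by rewrite ler_wpM2r.
  have k6 : 0 <= k%:R + 6 :> R by lra.
  have h2 := ler_wpM2l k6 de.
  rewrite natrD ler_pdivlMr // exprMn; lra.
set X := (c * e) ^+ 2 * d / 32 in X_ge.
have q01 : 0 <= q0 <= 1 by rewrite q0_ge0.
have ce14 : 0 < c * e <= 1 / 4 by rewrite ce4 mulr_gt0 //; lra.
have nun' : (nu <= n)%N.
  exact: leq_div.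
have nun : nu%:R <= n%:R :> R by rewrite ler_nat.
have t1 : n%:R ^+ 4 * exp (- X) <= exp (- ((k + 2)%:R * lnn n)).
  by apply: exp_tail => //; rewrite addnCA.
have n3' : (3 <= n)%N by rewrite (leq_trans _ n3l) // leq_pmulr.
have n3 : 3 <= n%:R :> R by rewrite ler_nat.
have n4 : 16 * n%:R <= n%:R ^+ 4 :> R by apply: pow4_ge.
have eX := exp_ge0 (- X).
have small : 16 * (nu%:R * exp (- X)) <= exp (- (k.+2%:R * lnn n)).
  rewrite -[k.+2]addn2; apply: le_trans t1.
  apply: (@le_trans _ _ (16 * n%:R * exp (- X))); last by rewrite ler_wpM2r.
  by rewrite mulrA; apply: ler_wpM2r => //; apply: ler_wpM2l.
have e_le1 : exp (- (k.+2%:R * lnn n)) <= 1.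
  by rewrite -[leRHS]exp0; apply: exp_mono; rewrite oppr_le0; apply: mulr_ge0; [rewrite ler0n|apply: le_trans L1].
have := @random_dense 'I_nu q0 (c * e) r q01 ce14; rewrite !card_ord -/d -/X => /(_ r1).
have sm : nu%:R * exp (- X) <= 1 / 2 by lra.
move=> /(_ sm) fail.
have nX : 0 <= nu%:R * exp (- X) := mulr_ge0 (ltW nuR) eX.
apply: le_trans (le_trans fail _); last by lra.
apply: Pr_le; first by apply: bern_weight.
move=> f; apply: contraNN => /(dense_ham_packing l1 lk k2l ln nu3) h.
by apply/asboolP.
Qed.

End ShortScheme.

(** * Parameters for an overlap of half an edge *)

Section Numerics.
Local Open Scope ring_scope.

(** Each error term is kept a factor n below the target, so their number is absorbed once n >= 7. *)
Lemma seven_terms (n j : nat) (t1 t2 t3 t4 t5 t6 t7 : R) : (7 <= n)%N ->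
  (forall t, t \in [:: t1; t2; t3; t4; t5; t6; t7] -> t <= exp (- (j.+1%:R * lnn n))) ->
  t1 + t2 + t3 + t4 + t5 + t6 + t7 <= exp (- (j%:R * lnn n)).
Proof.
move=> n7 le; have n0 : (0 < n)%N by apply: leq_trans n7.
have -> : exp (- (j%:R * lnn n)) = n%:R * exp (- (j.+1%:R * lnn n)).
  by rewrite -[n%:R in RHS](exp_lnn n0) expRM; congr exp; rewrite -natr1; ring.
set T := exp _ in le *; have T0 : 0 <= T by rewrite /T exp_ge0.
apply: (@le_trans _ _ (7 * T)); last by rewrite ler_wpM2r // ler_nat.
have le1 := le t1; have le2 := le t2; have le3 := le t3; have le4 := le t4.
have le5 := le t5; have le6 := le t6; have le7 := le t7.
move: le1 le2 le3 le4 le5 le6 le7; clear le; rewrite !inE !eqxx !orbT /=.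
by do 7!(move=> /(_ isT) ?); lra.
Qed.

Lemma exp_half_le2 (x : R) (m : nat) : x <= m%:R -> exp (x / 2) <= 2 ^+ m.
Proof.
move=> xm; have h : exp (1 / 2) <= 2.
  have h0 := exp_ge0 (1 / 2).
  have : exp (1 / 2) * exp (1 / 2) <= 3.
    by rewrite expRM (_ : 1 / 2 + 1 / 2 = 1 :> R) ?exp1_le3 //; lra.
  by nra.
apply: (@le_trans _ _ (exp (1 / 2) ^+ m)).
  by rewrite expRX; apply: exp_mono; rewrite -[leRHS]mulr_natl; lra.
by apply: lerXn2r; rewrite ?nnegrE ?exp_ge0.
Qed.

Lemma one_sub_pow_le (x : R) (m : nat) : 0 <= x <= 1 -> (1 - x) ^+ m <= exp (- (x * m%:R)).
Proof.
case/andP=> x0 x1; have -> : - (x * m%:R) = (- x) *+ m by rewrite -[RHS]mulr_natr; ring.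
rewrite -expRX; apply: lerXn2r; rewrite ?nnegrE ?exp_ge0 ?subr_ge0 //.
exact: exp_ge1D.
Qed.

End Numerics.

(** * Inequalities between the parameters of the layered graph *)

Section RealEstimates.
Local Open Scope ring_scope.
Variables (k w q0 eta L : R).
Hypotheses (k0 : 0 <= k) (w1 : 1 <= w) (q01 : 0 <= q0 <= 1) (eta14 : 0 < eta <= 1 / 4) (L1 : 1 <= L).
Let y : R := w * q0.
Hypothesis h2 : 48 * ((k + 7) * L) <= eta * y.

Lemma kL_ge : k + 7 <= (k + 7) * L.
Proof.
have k7 : 0 <= k + 7 by move: k0 => ?; lra.
exact: ler_peMr.
Qed.

Lemma y_ge0 : 0 <= y.
Proof. by move: w1 q01 => ? /andP[? _]; apply: mulr_ge0 => //; lra. Qed.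

Lemma y_large : 192 * ((k + 7) * L) <= y.
Proof.
have : eta * y <= 1 / 4 * y by case/andP: eta14 => ? ?; rewrite ler_wpM2r // y_ge0.
by move: h2 => ?; lra.
Qed.

Lemma inner_exponent (d : R) : d <= eta * y / 4 ->
  (1 + (k + 3)) * L <= 3 / 16 * ((w - 1) * (eta * q0)) - d / 4.
Proof.
move=> dh; have h := kL_ge; have e1 : eta * q0 <= 1.
  by case/andP: q01 => a b; case/andP: eta14 => a' b'; nra.
by move: h2 k0 L1 dh; rewrite /y => ? ? ? ?; lra.
Qed.

Lemma outer_exponent (d r : R) : d <= eta * y / 4 -> r <= (1 - eta) * y ->
  (1 + (k + 3)) * L <= 7 / 64 * ((3 * w) * ((1 - eta) * q0)) - (d + 2 * r) / 8.
Proof.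
move=> dh rh; have h := kL_ge; have hy := y_large.
have hk : 0 <= (k + 7) * L by move: k0 L1 => ? ?; apply: le_trans h; lra.
have h3 : eta * y <= 1 / 4 * y.
  by case/andP: eta14 => ? ?; rewrite ler_wpM2r // y_ge0.
by move: k0 L1 dh rh h3 hy; rewrite /y => *; lra.
Qed.

Lemma degree_exponent (d : R) : eta * y / 4 - 1 <= d -> (2 + (k + 3)) * L <= d / 12.
Proof. by move=> dh; have h := kL_ge; move: h2 k0 L1 => ? ? ?; lra. Qed.

Lemma sparse_exponent (d s : R) : eta * y / 4 - 1 <= d -> s <= eta * w / 600 ->
  72 * (q0 * s) <= d.
Proof.
move=> dh sh; have h := kL_ge; case/andP: q01 => a _.
have : q0 * s <= q0 * (eta * w / 600) by rewrite ler_wpM2l.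
by move: h2 dh k0 L1; rewrite /y => ? ? ? ? ?; lra.
Qed.

(* Vertex sets of size up to s = eta w / 600 expand, which yields about s ^ 2
   boosters: [h3] makes this exceed the number, at most 51 w y, of edges already
   present, and [h4] lets the sprinkling beat the union bound over its
   histories. *)
Hypothesis h3 : 306 * (w * y) <= (eta * w / 1200) ^+ 2.
Hypothesis h4 : 12 * 1200 ^+ 2 * (6 * k + 37) * L ^+ 2 <= eta ^+ 3 * w.

Lemma eta_cube_le : eta ^+ 3 * w <= eta * w.
Proof.
case/andP: eta14 => a b; have w0 : 0 <= w by move: w1 => ?; lra.
rewrite ler_wpM2r // exprSr ler_piMl ?(ltW a) //.
by rewrite expr2; nra.
Qed.

Lemma L2_ge : L <= L ^+ 2.
Proof.
have L0 : 0 <= L by move: L1 => ?; lra.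
by rewrite expr2; apply: ler_peMr.
Qed.

Lemma eta_w_large : 4800 * ((k + 7) * L) <= eta * w.
Proof.
apply: le_trans eta_cube_le; apply: le_trans h4.
have h := L2_ge; have kk : k * L <= k * L ^+ 2 by rewrite ler_wpM2l.
have kL : 0 <= k * L ^+ 2 by rewrite mulr_ge0 // sqr_ge0.
have P0 : 4800 <= 12 * 1200 ^+ 2 :> R by lra.
have Q0 : 0 <= (6 * k + 37) * L ^+ 2 by move: L1 => ?; lra.
rewrite -mulrA; apply: (@le_trans _ _ (4800 * ((6 * k + 37) * L ^+ 2))); last first.
  exact: ler_wpM2r.
by rewrite ler_wpM2l //; move: k0 L1 => ? ?; lra.
Qed.

Lemma s_lower (s : R) : eta * w / 600 - 1 <= s -> eta * w / 1200 <= s.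
Proof.
move=> sh; have := eta_w_large; have := kL_ge; move: k0 sh.
by move: (_ * L) (eta * w) => A B *; lra.
Qed.

Lemma wy_large : [/\ (k + 3) * L + 1 <= w * y, 2 * (k + 6) * L * y <= w * y & 1 <= y].
Proof.
have h := kL_ge; have hy := y_large; have hw := eta_w_large.
have hk : 0 <= (k + 7) * L by move: k0 L1 => ? ?; apply: le_trans h; lra.
have y1 : 1 <= y by move: k0 hy h => ? ? ?; lra.
have w0 : 0 <= w by move: w1 => ?; lra.
have ew : eta * w <= w by case/andP: eta14 => ? ?; rewrite ler_piMl //; lra.
have yw : y <= w * y by rewrite ler_peMl //; lra.
split=> //; first by move: k0 L1 h hy yw => *; lra.
rewrite ler_wpM2r //; first by lra.
by apply: le_trans ew; apply: le_trans hw; move: k0 L1 hk h => *; lra.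
Qed.

(** The boosters to be kept take a third of s^2. The edges number at most 51 w y and the cycles at
    most w y, and twice their sum fits in the rest by the factor 306. *)
Lemma room_exponent (s M0 g J nu : R) : eta * w / 1200 <= s -> M0 <= s ^+ 2 / 6 ->
  0 <= nu <= 5 * w -> g <= 2 * (nu ^+ 2 * q0) + (k + 3) * L + 1 ->
  J <= 2 * (k + 6) * L * y -> 2 * (M0 + g + J) <= s ^+ 2.
Proof.
move=> zs Mh /andP[nu0 nuw] gh Jh; have [a1 a2 a3] := wy_large.
have z0 : 0 <= eta * w / 1200.
  by case/andP: eta14 => ? _; rewrite !mulr_ge0 ?invr_ge0 //; move: w1 => *; lra.
have zs2 : (eta * w / 1200) ^+ 2 <= s ^+ 2.
  by apply: lerXn2r => //; rewrite nnegrE // (le_trans z0).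
have nq : nu ^+ 2 * q0 <= 25 * (w * y).
  rewrite (_ : 25 * (w * y) = (5 * w) ^+ 2 * q0); last by rewrite /y; ring.
  case/andP: q01 => ? _; rewrite ler_wpM2r //.
  by apply: lerXn2r; rewrite ?nnegrE ?(le_trans nu0).
have Jw := le_trans Jh a2; have s0 := sqr_ge0 s.
move: h3 zs2 Mh gh Jw nq a1 s0.
move: (nu ^+ 2 * q0) (_ * y) ((_ / _) ^+ 2) (s ^+ 2) ((k + 3) * L) => N Y Z S A.
move: M0 J g {Jh}; clear => *; lra.
Qed.

Lemma sprinkle_exponent (s M0 J : R) : eta * w / 1200 <= s -> s ^+ 2 / 6 - 1 <= M0 ->
  J <= 2 * (k + 6) * L * y -> 3 * L * J + (k + 3) * L <= eta * q0 * M0.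
Proof.
move=> zs Mh Jh; have [_ _ y1] := wy_large.
have hw := eta_w_large; have h := kL_ge; have hy := y_large.
set z := eta * w / 1200 in zs.
have z4 : 4 <= z by rewrite /z ler_pdivlMr //; move: k0 h hw => *; lra.
have zs2 : z ^+ 2 <= s ^+ 2 by apply: lerXn2r => //; rewrite nnegrE; lra.
have z12 : 12 <= z ^+ 2 by rewrite expr2; nra.
have Mz : z ^+ 2 / 12 <= M0 by move: zs2 z12 Mh; move: (s ^+ 2) (z ^+ 2) => *; lra.
have eq0 : 0 <= eta * q0.
  by case/andP: q01 => ? _; case/andP: eta14 => ? _; rewrite mulr_ge0 // ltW.
apply: le_trans (ler_wpM2l eq0 Mz).
have y0 : 0 <= y := y_ge0.
have E : eta * q0 * (z ^+ 2 / 12) = eta ^+ 3 * w * y / (12 * 1200 ^+ 2).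
  rewrite /z /y; have : 1200 != 0 :> R by rewrite pnatr_eq0.
  by move: (1200 : R) => c cn; field.
rewrite E ler_pdivlMr; last by rewrite mulr_gt0 // exprn_gt0.
have hh := ler_wpM2r y0 h4; apply: le_trans hh.
have P0 : 0 <= 12 * 1200 ^+ 2 :> R by rewrite mulr_ge0 // exprn_ge0.
move: (12 * 1200 ^+ 2 : R) P0 => P P0.
rewrite [leLHS]mulrC -!(mulrA P); apply: ler_wpM2l => //.
have L0 : 0 <= L by move: L1 => *; lra.
have L2 := L2_ge.
have j1 : 3 * L * J <= 3 * L * (2 * (k + 6) * L * y).
  by apply: ler_wpM2l => //; rewrite mulr_ge0.
have j2 : (k + 3) * L <= L ^+ 2 * y.
  have : y <= L ^+ 2 * y by rewrite ler_peMl //; move: L1 => *; lra.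
  by move: k0 L1 hy h => *; lra.
by apply: le_trans (lerD j1 j2) _; rewrite le_eqVlt; apply/orP; left; apply/eqP; ring.
Qed.

End RealEstimates.

Section DoubleParameters.
Local Open Scope ring_scope.

Lemma exp_tailS (n i k : nat) (c X Z : R) : (0 < n)%N -> c <= n%:R ^+ i ->
  (i%:R + (k%:R + 3)) * lnn n <= X -> Z = - X -> c * exp Z <= exp (- (k.+3%:R * lnn n)).
Proof.
move=> n0 ci le ->; apply: (@le_trans _ _ (n%:R ^+ i * exp (- X))).
  by rewrite ler_wpM2r // exp_ge0.
by apply: exp_tail => //; rewrite -[k.+3]addn3 2!natrD.
Qed.

Lemma dense_term (n k w : nat) (q0 eta e : R) : (7 <= n)%N -> (w <= n)%N -> 0 <= lnn n ->
  0 <= q0 -> 0 <= eta <= 1 / 4 ->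
  64 * ((k%:R + 8) * lnn n) <= e ^+ 2 * (w%:R * q0) ->
  24 * (w%:R * exp (- (e ^+ 2 * (w%:R * ((1 - eta) * q0)) / 32))) <= exp (- (k.+3%:R * lnn n)).
Proof.
move=> n7 wn L0 q00 /andP[eta0 eta1] h1; have n0 : (0 < n)%N by apply: leq_trans n7.
rewrite mulrA; apply: (exp_tailS (i := 3) n0 _ _ (erefl _)).
- apply: (@le_trans _ _ (n%:R ^+ 2 * n%:R)); last by rewrite -exprSr.
  apply: ler_pM => //; last by rewrite ler_nat.
  have : 7 <= n%:R :> R by rewrite ler_nat.
  by rewrite expr2; move: (n%:R : R) => x; nra.
- have y0 : 0 <= e ^+ 2 * (w%:R * q0) by rewrite mulr_ge0 ?sqr_ge0 // mulr_ge0.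
  have kL : 0 <= k%:R * lnn n by rewrite mulr_ge0.
  have : e ^+ 2 * (w%:R * ((1 - eta) * q0)) >= 1 / 2 * (e ^+ 2 * (w%:R * q0)).
    have -> : e ^+ 2 * (w%:R * ((1 - eta) * q0)) = (1 - eta) * (e ^+ 2 * (w%:R * q0)) by ring.
    by rewrite ler_wpM2r //; lra.
  move: h1 L0 y0 kL; clear.
  by move: (_ ^+ 2 * _) (_ ^+ 2 * _) (lnn n) (k%:R : R) => *; lra.
Qed.

Lemma cycle_term (n k r w K : nat) : (0 < n)%N -> (r <= n)%N -> (w < n)%N ->
  2 * ((k%:R + 5) * lnn n) <= K.+1%:R ->
  (r * w.+1)%:R / (2 ^ K.+1)%:R <= exp (- (k.+3%:R * lnn n)).
Proof.
move=> n0 rn wn hK; have h := exp_half_le2 hK.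
rewrite (_ : 2 * _ / 2 = (k%:R + 5) * lnn n :> R) in h; last by field.
have rw2 : (r * w.+1)%:R <= n%:R ^+ 2 :> R by rewrite -natrX ler_nat leq_mul.
apply: (@le_trans _ _ ((r * w.+1)%:R * exp (- ((k%:R + 5) * lnn n)))).
  rewrite natrX; apply: ler_wpM2l => //.
  have e0 := exp_gt0 ((k%:R + 5) * lnn n).
  have : (2 ^+ K.+1)^-1 <= (exp ((k%:R + 5) * lnn n))^-1 by rewrite lef_pV2 // posrE exprn_gt0.
  move=> le; apply: le_trans le _; rewrite le_eqVlt; apply/orP; left; apply/eqP.
  apply: (@mulfI _ (exp ((k%:R + 5) * lnn n))); first by rewrite gt_eqF.
  by rewrite divff ?gt_eqF // exp_inv.
apply: (exp_tailS n0 rw2 _ (erefl _)).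
by rewrite le_eqVlt; apply/orP; left; apply/eqP; ring.
Qed.

(** Each of the J moves costs a factor at most n^3 in the union over histories, hence the 3 log n
    per move. *)
Lemma sprinkle_term (n k nu M0 J : nat) (x : R) : (7 <= n)%N -> (nu <= n)%N -> 0 <= x <= 1 ->
  3 * lnn n * J%:R + (k%:R + 3) * lnn n <= x * M0%:R ->
  (1 - x) ^+ M0 * (1 + nu%:R ^+ 2) ^+ J <= exp (- (k.+3%:R * lnn n)).
Proof.
move=> n7 nun x01 h; have n0 : (0 < n)%N by apply: leq_trans n7.
have n7' : 7 <= n%:R :> R by rewrite ler_nat.
have b1 : 1 + nu%:R ^+ 2 <= exp (3 * lnn n).
  rewrite exp_lnnM //; have nn : nu%:R <= n%:R :> R by rewrite ler_nat.
  have n2 : nu%:R ^+ 2 <= n%:R ^+ 2 :> R by apply: lerXn2r; rewrite ?nnegrE.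
  rewrite [n%:R ^+ 3]exprSr; have n2' : 1 <= n%:R ^+ 2 :> R by rewrite expr2; nra.
  have n3 : n%:R ^+ 2 * 7 <= n%:R ^+ 2 * n%:R :> R by rewrite ler_wpM2l // sqr_ge0.
  by move: n2 n2' n3; move: (nu%:R ^+ 2 : R) (n%:R ^+ 2 : R) => A B *; lra.
have b2 : (1 + nu%:R ^+ 2) ^+ J <= exp (3 * lnn n * J%:R) :> R.
  have -> : 3 * lnn n * J%:R = (3 * lnn n) *+ J by rewrite -[RHS]mulr_natr.
  by rewrite -expRX; apply: lerXn2r; rewrite ?nnegrE ?exp_ge0 // addr_ge0 ?sqr_ge0.
apply: (@le_trans _ _ (exp (- (x * M0%:R)) * exp (3 * lnn n * J%:R))).
  apply: ler_pM => //; last exact: one_sub_pow_le.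
    by rewrite exprn_ge0 // subr_ge0; case/andP: x01.
  by rewrite exprn_ge0 // addr_ge0 // sqr_ge0.
rewrite expRM; apply: exp_mono; rewrite -[k.+3]addn3 natrD.
by move: h; move: (x * _) (_ * J%:R) => *; lra.
Qed.

Lemma nat_floor2 (x : R) : 0 <= x -> exists m : nat, m%:R <= x /\ x - 1 <= m%:R.
Proof.
by move=> x0; have [m /andP[a b]] := nat_floor x0; exists m; split=> //; rewrite -natr1 in b; lra.
Qed.

Theorem double_parameters (k n w rho : nat) (q0 eta e : R) :
  (7 <= n)%N -> (0 < w)%N -> (rho <= 2)%N -> (3 * w + rho <= n)%N -> 1 <= lnn n ->
  0 <= q0 <= 1 -> 0 < eta <= 1 / 4 -> 0 < e <= 1 / 4 ->
  64 * ((k%:R + 8) * lnn n) <= e ^+ 2 * (w%:R * q0) ->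
  48 * ((k%:R + 7) * lnn n) <= eta * (w%:R * q0) ->
  306 * (w%:R * (w%:R * q0)) <= (eta * w%:R / 1200) ^+ 2 ->
  12 * 1200 ^+ 2 * (6 * k%:R + 37) * lnn n ^+ 2 <= eta ^+ 3 * w%:R ->
  exists r : nat, [/\ r%:R <= (1 - e) * (w%:R * ((1 - eta) * q0)),
    (1 - e) * (w%:R * ((1 - eta) * q0)) <= r%:R + 1 &
    Ex (bern (@main_weight w rho q0 eta)) (fun f => Pr (bern (@sprinkle_weight w rho q0 eta))
     (fun f2 => ~~ `[<packed r (on_set f :|: on_set f2)>])) <= exp (- (k.+2%:R * lnn n))].
Proof.
move=> n7 w0 rho2 nun L1 q01 eta14 e14 h1 h2 h3 h4.
have n0 : (0 < n)%N by apply: leq_trans n7.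
have k0 : 0 <= k%:R :> R by rewrite ler0n.
have w1 : 1 <= w%:R :> R by rewrite ler1n.
have /andP[q00 q0_le1] := q01; have /andP[eta0 eta1] := eta14; have /andP[e0 e1] := e14.
have e' : 0 <= 1 - e by clear -e1; lra.
have eta' : 0 <= 1 - eta by clear -eta1; lra.
have y0 : 0 <= w%:R * q0 by rewrite mulr_ge0.
have L0 : 0 <= lnn n by apply: le_trans L1.
have wn3 : (w.+1 <= n)%N.
  apply: leq_trans nun; apply: (@leq_trans (3 * w)); last exact: leq_addr.
  by rewrite mulSn -addn1 leq_add2l muln_gt0.
(* Choice of the integers: [d] is about a quarter of the mean degree inside a layer; [s] is the
   expansion scale, with 72 q0 s <= d; [M0] is a sixth of s^2; [K] makes 2^(K+1) exceed n^(k+5); [g]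
   is twice a bound on the mean number of edges plus (k+3) log n, as the upper tail requires. *)
have [r [r1 r2]] : exists r : nat, r%:R <= (1 - e) * (w%:R * ((1 - eta) * q0)) /\
    (1 - e) * (w%:R * ((1 - eta) * q0)) - 1 <= r%:R.
  by apply: nat_floor2; rewrite !mulr_ge0.
have [d [d1 d2]] : exists d : nat, d%:R <= eta * (w%:R * q0) / 4 /\
    eta * (w%:R * q0) / 4 - 1 <= d%:R.
  by apply: nat_floor2; rewrite divr_ge0 // mulr_ge0 // ltW.
have [s [s1 s2]] : exists s : nat, s%:R <= eta * w%:R / 600 /\ eta * w%:R / 600 - 1 <= s%:R.
  by apply: nat_floor2; rewrite divr_ge0 // mulr_ge0 // ltW.
have [M0 [M1 M2]] : exists M : nat, M%:R <= s%:R ^+ 2 / 6 :> R /\ s%:R ^+ 2 / 6 - 1 <= M%:R :> R.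
  by apply: nat_floor2; rewrite divr_ge0 // sqr_ge0.
have [K [K1 K2]] : exists K : nat, K%:R <= 2 * ((k%:R + 5) * lnn n) /\
    2 * ((k%:R + 5) * lnn n) - 1 <= K%:R.
  by apply: nat_floor2; rewrite !mulr_ge0 // addr_ge0.
have [g [g1 g2]] : exists g : nat,
    g%:R <= 2 * ((3 * w + rho)%:R ^+ 2 * q0) + (k%:R + 3) * lnn n + 1 /\
    2 * ((3 * w + rho)%:R ^+ 2 * q0) + (k%:R + 3) * lnn n + 1 - 1 <= g%:R.
  by apply: nat_floor2; rewrite !addr_ge0 // mulr_ge0 ?addr_ge0 // mulr_ge0 // sqr_ge0.
have ry : r%:R <= (1 - eta) * (w%:R * q0).
  apply: le_trans r1 _; rewrite [w%:R * _]mulrCA; apply: ler_piMl; first by rewrite mulr_ge0.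
  by clear -e0; lra.
have rw : (r <= w)%N.
  rewrite -(ler_nat R); apply: le_trans ry _; rewrite mulrCA; apply: ler_piMr => //.
  by move: eta' q00 q0_le1 eta0; clear; nra.
have J1 : (r * (K + rho))%:R <= 2 * (k%:R + 6) * lnn n * (w%:R * q0).
  rewrite natrM mulrC; apply: ler_pM => //; last first.
    by apply: le_trans ry _; apply: ler_piMl => //; clear -eta0; lra.
  have : rho%:R <= 2 :> R by rewrite ler_nat.
  by rewrite natrD; move: K1 L1; move: (lnn n) (K%:R : R) (rho%:R : R) (k%:R : R); clear=> *; lra.
have zs := s_lower k0 w1 eta14 L1 h4 s2.
have nu0 : 0 <= ((3 * w + rho)%:R : R) <= 5 * w%:R.
  rewrite ler0n /= -natrM ler_nat (_ : 5 * w = 3 * w + 2 * w)%N ?leq_add2l; last by rewrite -mulnDl.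
  by apply: leq_trans rho2 _; rewrite leq_pmulr.
have room : (2 * (M0 + g + r * (K + rho)) <= s * s)%N.
  rewrite -(ler_nat R) [leRHS]natrM -expr2 natrM (natrD _ (M0 + g)) (natrD _ M0).
  exact: (room_exponent k0 w1 q01 eta14 L1 h2 h3 h4 zs M1 nu0 g1 J1).
have T1 : exp (- (k.+3%:R * lnn n)) <= 1.
  by rewrite -[leRHS]exp0; apply: exp_mono; rewrite oppr_le0 mulr_ge0.
have etah : 0 <= eta <= 1 / 4 by rewrite ltW.
have wn := ltnW wn3.
have E1 := dense_term n7 wn L0 q00 etah h1.
have n7' : 7 <= n%:R :> R by rewrite ler_nat.
have E2 : (3 * w)%:R * exp (d%:R / 4 - 3 / 16 * ((w.-1)%:R * (eta * q0))) <=
    exp (- (k.+3%:R * lnn n)).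
  apply: (exp_tailS (i := 1) n0 _ (inner_exponent k0 q01 eta14 L1 h2 d1)).
    by rewrite expr1 ler_nat; apply: leq_trans nun; apply: leq_addr.
  by rewrite -subn1 natrB // opprB.
have E3 : rho%:R * exp ((d + 2 * r)%:R / 8 - 7 / 64 * ((3 * w)%:R * ((1 - eta) * q0))) <=
    exp (- (k.+3%:R * lnn n)).
  apply: (exp_tailS (i := 1) n0 _ (outer_exponent k0 w1 q01 eta14 L1 h2 d1 ry)).
    by rewrite expr1 ler_nat; apply: leq_trans rho2 _; apply: leq_trans n7.
  by rewrite natrD !natrM opprB.
have E4 : 2 * ((3 * w + rho)%:R * exp (- (d%:R / 12))) <= exp (- (k.+3%:R * lnn n)).
  rewrite mulrA; apply: (exp_tailS (i := 2) n0 _ (degree_exponent k0 L1 h2 d2) (erefl _)).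
  rewrite expr2; apply: ler_pM => //; last by rewrite ler_nat.
  by apply: le_trans n7'; rewrite ler_nat.
have E5 : exp (2 * ((3 * w + rho)%:R ^+ 2 * q0) - g%:R) <= exp (- (k.+3%:R * lnn n)).
  apply: exp_mono; rewrite -[k.+3]addn3 (natrD _ k).
  by move: g2; move: (_ ^+ 2 * q0) (_ * lnn n) (g%:R : R); clear => *; lra.
have E6 : (r * w.+1)%:R / (2 ^ K.+1)%:R <= exp (- (k.+3%:R * lnn n)).
  apply: cycle_term => //; first exact: leq_trans rw wn.
  by rewrite -[K.+1%:R]natr1; move: K2; move: (_ * lnn n) (K%:R : R); clear => *; lra.
have E7 : (1 - eta * q0) ^+ M0 * (1 + (3 * w + rho)%:R ^+ 2) ^+ (r * (K + rho)) <=
    exp (- (k.+3%:R * lnn n)).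
  apply: sprinkle_term => //.
    by move: q00 q0_le1 eta0 eta1; clear=> *; apply/andP; split; nra.
  exact: (sprinkle_exponent k0 w1 q01 eta14 L1 h2 h4 zs M2 J1).
exists r; split=> //; first by move: r2; clear => *; lra.
apply: le_trans (@graph_bound w rho r d s M0 g K q0 eta e w0 q01 _ e14 r1 _ _ _ room) _.
- by move: eta0 eta1; clear => *; apply/andP; split; lra.
- move: (le_trans E1 T1); move: (w%:R * exp _) ; clear => X h; lra.
- exact: (sparse_exponent k0 q01 L1 h2 d2 s1).
- move: (le_trans E4 T1); move: (_ * exp _) ; clear => X h; lra.
apply: (seven_terms n7) => t; rewrite !inE.
by case/or4P=> [/eqP->|/eqP->|/eqP->|/or4P[/eqP->|/eqP->|/eqP->|/eqP->]].
Qed.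


End DoubleParameters.

(** * The layered graph as a weighted structure *)

Section DoubleScheme.
Local Open Scope ring_scope.

(** The main graph and the sprinkling are independent, so their union is again a random set with
    independent elements, as [scheme] requires. *)
Lemma Ex_union (U : finType) (a b : U -> R) (F : {set U} -> R) :
  (forall u, 0 <= a u <= 1) -> (forall u, 0 <= b u <= 1) ->
  Ex (bern (fun u => 1 - (1 - a u) * (1 - b u))) (fun f => F (on_set f)) =
  Ex (bern a) (fun f => Ex (bern b) (fun f2 => F (on_set f :|: on_set f2))).
Proof.
move=> a01 b01; pose w u (x : bool * bool) := bern a u x.1 * bern b u x.2.
have ww : prob_weight w.
  have [wa0 wa1] := bern_weight a01; have [wb0 wb1] := bern_weight b01; split=> [u x|u].
    by rewrite mulr_ge0.
  rewrite /w -(pair_big xpredT xpredT (fun x y => bern a u x * bern b u y)) /=.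
  by under eq_bigr do rewrite -mulr_sumr wb1 mulr1; apply: wa1.
rewrite -(Ex_pair _ _ (fun f f2 => F (on_set f :|: on_set f2))).
rewrite -(Ex_pull (emb := id) (phi := fun _ x => x.1 || x.2) ww) //; last first.
  move=> u c; rewrite big_mkcond /= -(pair_big xpredT xpredT
    (fun x y => if x || y == c then w u (x, y) else 0)) /= !big_bool /= /w /bern /=.
  by case: c; rewrite /= ?eqxx; ring.
by apply: eq_Ex => f; congr F; apply/setP => u; rewrite !inE !ffunE.
Qed.

Lemma sum_cover_le (U T : finType) (g : U -> R) (F : T -> U) :
  (forall u, 0 <= g u) -> (forall u, g u != 0 -> exists t, F t = u) ->
  \sum_u g u <= \sum_t g (F t).
Proof.
move=> g0 cov; rewrite [leRHS](partition_big F xpredT) //=; apply: ler_sum => u _.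
rewrite (eq_bigr (fun=> g u)) => [|t /eqP->//].
have [->|/cov[t Ft]] := eqVneq (g u) 0; first by apply: sumr_ge0.
by rewrite (bigD1 t) /= ?Ft // lerDl; apply: sumr_ge0.
Qed.

Lemma next_layer_cases (i j : 'I_3) : i != j -> next_layer i != j -> next_layer j = i.
Proof.
move=> ij ne; apply/eqP; move: ij ne.
by move: i j => [[|[|[|i]]] i3] [[|[|[|j]]] j3].
Qed.

Section Weights.
Variables (w rho : nat) (eta : R).
Hypothesis eta01 : 0 <= eta <= 1 / 4.
Let V := vtx w rho.

Definition rel_weight (u : {set V}) : R :=
  if u \in pair_sets V then (if same_layer u then 2 * eta else 1) else 0.

Lemma rel_weight01 u : 0 <= rel_weight u <= 1.
Proof. by rewrite /rel_weight; case: ifP => _; [case: ifP => _|]; move: eta01 => ?; lra. Qed.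

(** An upper bound is what matters, as the number of cycles owed is proportional to the total
    weight. The three summands parametrize pairs between layers, inside a layer, and at a leftover
    vertex. *)
Lemma sum_rel_weight_le : \sum_u rel_weight u <=
  3 * w%:R ^+ 2 + 6 * eta * w%:R ^+ 2 + (rho * (3 * w + rho))%:R.
Proof.
pose T := ('I_3 * 'I_w * 'I_w + 'I_3 * 'I_w * 'I_w + 'I_rho * V)%type.
pose F (t : T) : {set V} := match t with
  | inl (inl (i, a, b)) => [set inl (i, a); inl (next_layer i, b)]
  | inl (inr (i, a, b)) => [set inl (i, a); inl (i, b)]
  | inr (z, v) => [set inr z; v] end.
apply: le_trans (@sum_cover_le _ _ _ F _ _) _ => [u|u|].
- by case/andP: (rel_weight01 u).
- rewrite /rel_weight; case: ifP; last by rewrite eqxx.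
  rewrite inE => /cards2P[x [y [_ ->]]] _.
  case: x => [[i a]|z]; last by exists (inr (z, y)).
  case: y => [[j b]|z]; last by exists (inr (z, inl (i, a))); rewrite /= setUC.
  have [<-|ij] := eqVneq i j; first by exists (inl (inr (i, a, b))).
  have [e|ne] := eqVneq (next_layer i) j; first by exists (inl (inl (i, a, b))); rewrite /= e.
  have ji := next_layer_cases ij ne.
  by exists (inl (inl (j, b, a))); rewrite /= ji setUC.
rewrite !big_sumType /=; apply: lerD; first apply: lerD.
- apply: (@le_trans _ _ (\sum_(t : 'I_3 * 'I_w * 'I_w) 1)).
    by apply: ler_sum => -[[i a] b] _; case/andP: (rel_weight01 (F (inl (inl (i, a, b))))).
  by rewrite sumr_const !card_prod !card_ord !natrM expr2 mulrA.
- apply: (@le_trans _ _ (\sum_(t : 'I_3 * 'I_w * 'I_w) 2 * eta)).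
    apply: ler_sum => -[[i a] b] _ /=; rewrite /rel_weight.
    have -> : same_layer [set (inl (i, a) : V); inl (i, b)].
      by apply/existsP; exists i; apply/subsetP => v; rewrite !inE => /orP[] /eqP->.
    by case: ifP => // _; rewrite mulr_ge0 //; case/andP: eta01.
  rewrite sumr_const !card_prod !card_ord -[leLHS]mulr_natl !natrM.
  by rewrite le_eqVlt; apply/orP; left; apply/eqP; ring.
apply: (@le_trans _ _ (\sum_(t : 'I_rho * V) 1)).
  by apply: ler_sum => -[z v] _; case/andP: (rel_weight01 (F (inr (z, v)))).
by rewrite sumr_const card_prod card_ord card_vtx.
Qed.

Lemma sum_rel_weight_ge1 : (0 < w)%N -> 1 <= \sum_u rel_weight u.
Proof.
move=> w0; pose u : {set V} := [set inl (ord0, Ordinal w0); inl (next_layer ord0, Ordinal w0)].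
have ne i : (inl (i, Ordinal w0) : V) != inl (next_layer i, Ordinal w0).
  apply/eqP => /(congr1 (@layer w rho)) [/esym/eqP].
  by rewrite (negbTE (next_layer_neq i)).
have uP : u \in pair_sets V := pair2 (ne _).
rewrite (bigD1 u) //= {1}/rel_weight same_layer_cross uP.
by apply: ler_wpDr => //; apply: sumr_ge0 => v _; case/andP: (rel_weight01 v).
Qed.

Variable q0 : R.
Hypothesis q01 : 0 <= q0 <= 1.

Lemma union_weight_le u :
  0 <= 1 - (1 - main_weight q0 eta u) * (1 - sprinkle_weight q0 eta u) <= q0 * rel_weight u.
Proof.
rewrite /main_weight /sprinkle_weight /rel_weight /V.
case/andP: q01 => q00 q1; case/andP: eta01 => e0 e1.
have h1 : 0 <= eta * q0 <= 1 by apply/andP; split; nra.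
have h2 : 0 <= (1 - eta) * q0 <= 1 by apply/andP; split; nra.
case/andP: h1 => h1 h1'; case/andP: h2 => h2 h2'.
case: ifP => _; last by apply/andP; split; lra.
have p1 := mulr_ge0 h1 h1; have p2 := mulr_ge0 h1 h2.
by case: ifP => _; apply/andP; split; move: p1 p2 h1 h1' h2 h2'; nra.
Qed.

End Weights.
End DoubleScheme.

(** * Inequalities for large n *)

Section Asymptotics.
Local Open Scope ring_scope.

(** A cubic lower bound on exp L leaves one factor L to absorb the constants. *)
Lemma sq_le_exp (B L l w : R) : 0 < l -> 0 <= L -> 135 * l * B <= L -> exp L <= 5 * l * w ->
  B * L ^+ 2 <= w.
Proof.
move=> l0 L0 BL en.
have h : (L / 3) ^+ 3 <= 5 * l * w.
  apply: le_trans en; have -> : L = (L / 3) *+ 3 by rewrite -[RHS]mulr_natl; field.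
  rewrite -expRX; have -> : L / 3 *+ 3 / 3 = L / 3 :> R by rewrite -[_ *+ 3]mulr_natl; field.
  have h1 := exp_ge1D (L / 3).
  apply: lerXn2r; rewrite ?nnegrE ?exp_ge0 ?divr_ge0 //; lra.
have h2 : 135 * l * B * L ^+ 2 <= L * L ^+ 2 by rewrite ler_wpM2r // sqr_ge0.
have h3 : L * L ^+ 2 = 27 * (L / 3) ^+ 3 by field.
rewrite -(ler_pM2l (_ : 0 < 135 * l)) ?mulr_gt0 //; rewrite mulrA.
by move: h h2 h3; move: ((L / 3) ^+ 3) (_ * L ^+ 2) (L * L ^+ 2) => *; lra.
Qed.

(** Only e^4 w is known to be large, and (e^3 w)^4 = (e^4 w)^3 w; the spare factor w exceeds any
    multiple of L^2 once n is large. *)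
Lemma cube_lower (e w L g B : R) : 0 < g -> 0 <= B -> 0 <= L -> 0 <= e -> 0 <= w ->
  g * L ^+ 2 <= e ^+ 4 * w -> B ^+ 4 / g ^+ 3 * L ^+ 2 <= w -> B * L ^+ 2 <= e ^+ 3 * w.
Proof.
move=> g0 B0 L0 e0 w0 h1 h2.
have x0 : 0 <= B * L ^+ 2 by rewrite mulr_ge0 // sqr_ge0.
have y0 : 0 <= e ^+ 3 * w by rewrite mulr_ge0 // exprn_ge0.
rewrite -(ler_pXn2r (n := 4)) ?nnegrE //.
have -> : (e ^+ 3 * w) ^+ 4 = (e ^+ 4 * w) ^+ 3 * w by ring.
have -> : (B * L ^+ 2) ^+ 4 = (g * L ^+ 2) ^+ 3 * (B ^+ 4 / g ^+ 3 * L ^+ 2).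
  by field; rewrite gt_eqF.
have g2 : 0 <= g * L ^+ 2 by rewrite mulr_ge0 ?sqr_ge0 // ltW.
apply: ler_pM => //.
- by rewrite exprn_ge0.
- by rewrite mulr_ge0 ?sqr_ge0 // divr_ge0 // exprn_ge0 // ltW.
by apply: lerXn2r => //; rewrite nnegrE // (le_trans g2).
Qed.

(** As y is at most b L / e^2, the claim needs e^4 w to exceed a multiple of L. It exceeds a
    multiple of L^2, which suffices for large L. *)
Lemma pair_room (D c e w y b g L : R) : 0 < e -> 0 <= w -> 0 <= L ->
  y * e ^+ 2 <= b * L -> g * L ^+ 2 <= e ^+ 4 * w -> 0 <= D -> D * b <= c ^+ 2 * g * L ->
  D * (w * y) <= (c * e * w) ^+ 2.
Proof.
move=> e0 w0 L0 h1 h2 D0 h3.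
have -> : (c * e * w) ^+ 2 = w * ((c * e) ^+ 2 * w) by ring.
rewrite mulrCA; apply: ler_wpM2l => //.
rewrite -(ler_pM2r (_ : 0 < e ^+ 2)) ?exprn_gt0 //.
have -> : (c * e) ^+ 2 * w * e ^+ 2 = c ^+ 2 * (e ^+ 4 * w) by ring.
apply: le_trans (ler_wpM2l (sqr_ge0 c) h2).
rewrite -mulrA; apply: le_trans (ler_wpM2l D0 h1) _.
have := ler_wpM2r L0 h3.
by rewrite (_ : c ^+ 2 * (g * L ^+ 2) = c ^+ 2 * g * L * L) ?mulrA //; ring.
Qed.

Lemma degree_lower (c a e y L : R) : 0 < a -> 0 <= c -> 0 < e <= 1 -> 0 <= y -> 0 <= L ->
  a * L <= y * e ^+ 2 -> c * L <= (c / a + 1) * e * y.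
Proof.
move=> a0 c0 /andP[e0 e1] y0 L0 h.
have ey : 0 <= e * y by rewrite mulr_ge0 // ltW.
have h1 : y * e ^+ 2 <= e * y.
  by rewrite mulrC expr2 -mulrA; apply: ler_piMl.
have ca : 0 <= c / a by rewrite divr_ge0 // ltW.
have h2 := ler_wpM2l ca (le_trans h h1).
rewrite mulrA divfK ?gt_eqF // in h2.
have -> : (c / a + 1) * e * y = c / a * (e * y) + e * y by ring.
by apply: ler_wpDr.
Qed.

Lemma square_lower (c a e y L : R) : 0 < a -> 0 <= c -> 0 <= y -> 0 <= L ->
  a * L <= y * e ^+ 2 -> c * L <= ((c / a + 1) * e) ^+ 2 * y.
Proof.
move=> a0 c0 y0 L0 h.
have ca : 0 <= c / a by rewrite divr_ge0 // ltW.
have h2 := ler_wpM2l ca h; rewrite mulrA divfK ?gt_eqF // in h2; apply: le_trans h2 _.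
have ye : 0 <= y * e ^+ 2 by rewrite mulr_ge0 ?sqr_ge0.
have -> : ((c / a + 1) * e) ^+ 2 * y = (c / a + 1) ^+ 2 * (y * e ^+ 2) by ring.
by rewrite ler_wpM2r // expr2; nra.
Qed.

(** The yield w q0 is lowered by the shares c1 e and c2 e, while the weight inside layers raises the
    demand by 2 c1 e. Rounding and leftover vertices cost an additive 3, absorbed through 1 <= e w
    q0. *)
Lemma density_bound (c1 c2 e q0 w rho S r : R) : 0 < c1 -> 0 < c2 -> 0 < e ->
  (4 * (c1 + c2) + 3) * e <= 1 -> 0 <= q0 <= 1 -> 1 <= w -> 0 <= rho <= 2 ->
  1 <= e * (w * q0) ->
  S <= 3 * w ^+ 2 + 6 * (c1 * e) * w ^+ 2 + rho * (3 * w + rho) ->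
  (1 - c2 * e) * (w * ((1 - c1 * e) * q0)) <= r + 1 ->
  (1 - (4 * (c1 + c2) + 3) * e) * (q0 * S * (3 * w + rho)^-1) <= r.
Proof.
move=> c10 c20 e0 Ce /andP[q00 q01] w1 /andP[rho0 rho2] ey Sle rge.
have nu0 : 0 < 3 * w + rho by lra.
have y0 : 0 <= w * q0 by rewrite mulr_ge0 //; lra.
have eta0 : 0 <= c1 * e by rewrite mulr_ge0 // ltW.
have ep0 : 0 <= c2 * e by rewrite mulr_ge0 // ltW.
have avg : q0 * S * (3 * w + rho)^-1 <= w * q0 * (1 + 2 * (c1 * e)) + 2.
  rewrite ler_pdivrMr //.
  apply: le_trans (ler_wpM2l q00 Sle) _.
  have w0 : 0 <= w by lra.
  have p1 : 0 <= w * q0 * (1 + 2 * (c1 * e)) * rho by rewrite !mulr_ge0 //; lra.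
  have p2 : q0 * (rho * (3 * w + rho)) <= 2 * (3 * w + rho).
    rewrite mulrA ler_wpM2r //; first exact: ltW.
    by move: q00 q01 rho0 rho2; clear; nra.
  have -> : (w * q0 * (1 + 2 * (c1 * e)) + 2) * (3 * w + rho) =
    q0 * (3 * w ^+ 2 + 6 * (c1 * e) * w ^+ 2) + w * q0 * (1 + 2 * (c1 * e)) * rho
      + 2 * (3 * w + rho) by ring.
  by move: p1 p2; clear; lra.
have C0 : 0 <= 1 - (4 * (c1 + c2) + 3) * e by clear -Ce; lra.
apply: le_trans (ler_wpM2l C0 avg) _.
have q1 : 0 <= (c2 * e) * (c1 * e) * (w * q0).
  by apply: mulr_ge0 => //; apply: mulr_ge0.
have q2 : 0 <= (4 * (c1 + c2) + 3) * e * (2 * (c1 * e) * (w * q0) + 2).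
  apply: mulr_ge0; first by apply: mulr_ge0; [move: c10 c20; clear; lra|exact: ltW].
  by apply: addr_ge0 => //; apply: mulr_ge0 => //; apply: mulr_ge0.
have q3 : 0 <= c1 * (e * (w * q0)) by rewrite mulr_ge0 //; lra.
have q4 : 0 <= c2 * (e * (w * q0)) by rewrite mulr_ge0 //; lra.
move: rge ey q1 q2 q3 q4; clear; lra.
Qed.

End Asymptotics.

Section DoubleScheme.
Local Open Scope ring_scope.

Lemma third_bounds (nu : nat) : (2 < nu)%N ->
  [/\ (0 < nu %/ 3)%N, (nu %% 3 <= 2)%N, nu = (3 * (nu %/ 3) + nu %% 3)%N &
      (nu <= 5 * (nu %/ 3))%N].
Proof.
move=> nu3; have w0 : (0 < nu %/ 3)%N by rewrite divn_gt0.
have r2 : (nu %% 3 <= 2)%N by rewrite -ltnS ltn_mod.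
have E : nu = (3 * (nu %/ 3) + nu %% 3)%N by rewrite mulnC -divn_eq.
split=> //; rewrite [leqLHS]E (mulnDl 3 2) leq_add2l.
by rewrite (leq_trans r2) // leq_pmulr.
Qed.

Lemma window_bounds (kap0 kap1 l n w q0 e L : R) : 0 < l -> 0 <= w -> 0 <= q0 ->
  3 * w * l <= n -> n <= 5 * l * w ->
  kap0 * L <= n * q0 * e ^+ 2 <= kap1 * L ->
  kap0 / (5 * l) * L <= w * q0 * e ^+ 2 /\ w * q0 * e ^+ 2 <= kap1 / (3 * l) * L.
Proof.
move=> l0 w0 q00 n3 n5 /andP[h1 h2].
have qe : 0 <= q0 * e ^+ 2 by rewrite mulr_ge0 // sqr_ge0.
split.
  rewrite mulrAC ler_pdivrMr ?mulr_gt0 //; apply: le_trans h1 _.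
  have := ler_wpM2r qe n5; rewrite mulrA => /le_trans; apply.
  by rewrite le_eqVlt; apply/orP; left; apply/eqP; ring.
rewrite [leRHS]mulrAC ler_pdivlMr ?mulr_gt0 //; apply: le_trans h2.
have := ler_wpM2r qe n3; rewrite [n * (_ * _)]mulrA => h; apply: le_trans h.
by rewrite le_eqVlt; apply/orP; left; apply/eqP; ring.
Qed.

Theorem double_scheme (l : nat) (kap0 kap1 : R) : (0 < l)%N -> 0 < kap0 -> 0 < kap1 ->
  scheme (2 * l) l kap0 kap1.
Proof.
move=> l0 kap00 kap10.
have lR : 0 < l%:R :> R by rewrite ltr0n.
pose k : R := (2 * l)%:R.
have k0 : 0 <= k by rewrite ler0n.
pose a : R := kap0 / (5 * l%:R).
pose b : R := kap1 / (3 * l%:R).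
pose gam : R := 1 / (5 * l%:R).
have a0 : 0 < a by rewrite divr_gt0 // mulr_gt0.
have b0 : 0 < b by rewrite divr_gt0 // mulr_gt0.
have gam0 : 0 < gam by rewrite divr_gt0 // mulr_gt0.
(* [c1 * e] is the sprinkling share eta and [c2 * e] the matching loss; the constants are those
   needed by [degree_lower] and [square_lower] for the first two inequalities of
   [double_parameters]. *)
pose c1 : R := 48 * (k + 7) / a + 1.
pose c2 : R := 64 * (k + 8) / a + 1.
have k7 : 0 <= 48 * (k + 7) by rewrite mulr_ge0 // addr_ge0.
have k8 : 0 <= 64 * (k + 8) by rewrite mulr_ge0 // addr_ge0.
have c11 : 1 <= c1 by rewrite lerDr divr_ge0 // ltW.
have c21 : 1 <= c2 by rewrite lerDr divr_ge0 // ltW.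
have c10 : 0 < c1 by apply: lt_le_trans c11.
have c20 : 0 < c2 by apply: lt_le_trans c21.
pose D : R := 306 * 1200 ^+ 2.
have D0 : 0 <= D by rewrite mulr_ge0 // exprn_ge0.
pose P : R := 12 * 1200 ^+ 2 * (6 * k + 37).
have P0 : 0 <= P by rewrite mulr_ge0 ?addr_ge0 ?mulr_ge0 ?exprn_ge0.
pose B : R := P / c1 ^+ 3.
have B0 : 0 <= B by rewrite divr_ge0 // exprn_ge0 // ltW.
have [n1 hn1] := lnn_ge 1.
(* The thresholds serve in turn to make e w q0 at least 1, to give [pair_room] its large logarithm,
   and to let n beat log^2 n in [sq_le_exp]. *)
have [n2 hn2] := lnn_ge (1 / a).
have [n3 hn3] := lnn_ge (D * b / (c1 ^+ 2 * gam)).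
have [n4 hn4] := lnn_ge (135 * l%:R * (B ^+ 4 / gam ^+ 3)).
pose C : R := 4 * (c1 + c2) + 3.
exists C; first by rewrite /C; move: c10 c20; clear; lra.
exists (maxn (maxn (maxn n1 n2) (maxn n3 n4)) (7 * l)) => n e.
rewrite !geq_max => /andP[/andP[/andP[nn1 nn2] /andP[nn3 nn4]] n7l] ln e0 Ce Le.
have {hn1 nn1}L1 := hn1 n nn1; have {hn2 nn2}L2 := hn2 n nn2.
have {hn3 nn3}L3 := hn3 n nn3; have {hn4 nn4}L4 := hn4 n nn4.
have L0 : 0 <= lnn n by apply: le_trans L1.
have n7 : (7 <= n)%N by apply: leq_trans n7l; rewrite leq_pmulr.
have n0 : (0 < n)%N by apply: leq_trans n7.
have nu3 : (2 < n %/ l)%N by rewrite leq_divRL //; apply: leq_trans n7l; rewrite leq_mul2r orbT.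
have [w0 rho2 nuE nu5] := third_bounds nu3.
set w := (n %/ l %/ 3)%N in w0 nuE nu5; set rho := (n %/ l %% 3)%N in rho2 nuE.
have nunat : (3 * w + rho <= n)%N by rewrite -nuE leq_div.
have cV : #|{: vtx w rho}| = (n %/ l)%N by rewrite card_vtx -nuE.
have w1 : 1 <= w%:R :> R by rewrite ler1n.
have nE : n%:R = (n %/ l)%:R * l%:R :> R by rewrite -natrM divnK.
have n3w : 3 * w%:R * l%:R <= n%:R :> R.
  by rewrite nE ler_pM2r // nuE -natrM ler_nat leq_addr.
have n5w : n%:R <= 5 * l%:R * w%:R :> R.
  by rewrite nE mulrC -mulrA mulrCA ler_pM2l // -natrM ler_nat.
have eta0 : 0 < c1 * e by rewrite mulr_gt0.
have ep0 : 0 < c2 * e by rewrite mulr_gt0.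
have [eta14 ep14] : c1 * e <= 1 / 4 /\ c2 * e <= 1 / 4.
  by move: Ce eta0 ep0 e0; rewrite /C; clear; split; lra.
have e1 : e <= 1 by move: eta14 c11 e0; clear; nra.
have eta01 : 0 <= c1 * e <= 1 / 4 by rewrite ltW.
pose x0 : vtx w rho := inl (ord0, Ordinal w0).
pose g := @rel_weight w rho (c1 * e).
exists {set vtx w rho}, (block_edge n l x0), g; split.
  split.
  - exact: (block_edge_inj l0 ln nu3 cV).
  - exact: rel_weight01.
  - move=> u; rewrite /g /rel_weight; case: ifP; last by rewrite eqxx.
    by rewrite inE => /eqP u2 _; rewrite (card_block_edge l0 ln nu3 x0 cV) u2 mulnC.
  - exact: sum_rel_weight_ge1.
move=> q0 q01 win; have /andP[q00 q1] := q01.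
have w0R : 0 <= w%:R :> R by [].
have [y1 y2] := window_bounds lR w0R q00 n3w n5w win.
rewrite -/a -/b in y1 y2.
have y0 : 0 <= w%:R * q0 by rewrite mulr_ge0.
have gL : gam * lnn n ^+ 2 <= e ^+ 4 * w%:R.
  rewrite /gam mulrAC mul1r ler_pdivrMr ?mulr_gt0 //; apply: le_trans Le _.
  by rewrite -[leRHS]mulrA; apply: ler_wpM2l; [rewrite exprn_ge0 // ltW|rewrite mulrC].
have e01 : 0 < e <= 1 by rewrite e0.
have h1 : 64 * ((k + 8) * lnn n) <= (c2 * e) ^+ 2 * (w%:R * q0).
  by rewrite mulrA; apply: square_lower.
have h2 : 48 * ((k + 7) * lnn n) <= c1 * e * (w%:R * q0).
  by rewrite mulrA; apply: degree_lower.
have h3 : 306 * (w%:R * (w%:R * q0)) <= (c1 * e * w%:R / 1200) ^+ 2.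
  have Db : D * b <= c1 ^+ 2 * gam * lnn n.
    have cg : 0 < c1 ^+ 2 * gam by rewrite mulr_gt0 // exprn_gt0.
    by rewrite [leRHS]mulrC -(ler_pdivrMr _ _ cg).
  rewrite expr_div_n ler_pdivlMr ?exprn_gt0 // mulrAC -/D.
  exact: pair_room e0 w0R L0 y2 gL D0 Db.
have h4 : 12 * 1200 ^+ 2 * (6 * k + 37) * lnn n ^+ 2 <= (c1 * e) ^+ 3 * w%:R.
  have := cube_lower gam0 B0 L0 (ltW e0) w0R gL
    (sq_le_exp lR L0 L4 _); rewrite exp_lnn // => /(_ n5w).
  have c3 : 0 < c1 ^+ 3 by rewrite exprn_gt0.
  rewrite -/P -(ler_pM2l c3) mulrA /B (mulrC (c1 ^+ 3)) divfK ?gt_eqF // => h.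
  by apply: le_trans h _; rewrite exprMn mulrA.
have eta14' : 0 < c1 * e <= 1 / 4 by rewrite eta0.
have ep14' : 0 < c2 * e <= 1 / 4 by rewrite ep0.
have [r [r1 r2 fail]] := double_parameters n7 w0 rho2 nunat L1 q01 eta14' ep14' h1 h2 h3 h4.
pose h u := 1 - (1 - @main_weight w rho q0 (c1 * e) u) * (1 - @sprinkle_weight w rho q0 (c1 * e) u).
exists h, r; split.
- by move=> u; apply: union_weight_le.
- have ey : 1 <= e * (w%:R * q0).
    have h5 : 1 <= a * lnn n by rewrite mulrC -ler_pdivrMr.
    apply: le_trans h5 (le_trans y1 _); rewrite mulrC expr2 -mulrA.
    by apply: ler_piMl => //; rewrite mulr_ge0 // ltW.
  have lnE : l%:R / n%:R = (3 * w%:R + rho%:R)^-1 :> R.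
    rewrite -natrM -natrD -nuE nE invfM mulrCA divff ?mulr1 // gt_eqF //.
  rewrite lnE; apply: (@density_bound c1 c2 e) => //.
  + by rewrite ler0n (ler_nat R _ 2).
  + have := @sum_rel_weight_le w rho _ eta01; by rewrite natrM natrD natrM.
rewrite /h; have eta12 : 0 <= c1 * e <= 1 / 2 by move: eta14 eta0; clear => *; lra.
rewrite /Pr (@Ex_union _ _ _ (fun M => (~~ `[< ham_packing (2 * l) l r (block_edge n l x0) M >])%:R)).
- apply: le_trans fail; apply: Ex_le => [|f].
    by apply: bern_weight => u; apply: main_weight01.
  apply: Pr_le => [|f2]; first by apply: bern_weight => u; apply: sprinkle_weight01.
  by apply: contraNN => /asboolP pk; apply/asboolP; apply: (packed_ham_packing l0 ln nu3 _ cV).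
- by move=> u; apply: main_weight01.
- by move=> u; apply: sprinkle_weight01.
Qed.

End DoubleScheme.

Lemma packing_scheme (k l : nat) : (2 <= k)%N -> (l <= k)%N -> (k <= 2 * l)%N ->
  scheme k l (1 / (4 * k.+1%:R)) (1 / k.+1%:R).
Proof.
move=> k2 lk k2l.
have l0 : (0 < l)%N by case: l k2l lk => //; rewrite muln0 leqn0 => /eqP k0; rewrite k0 in k2.
have kap0 : (0 < 1 / (4 * k.+1%:R) :> R)%R by rewrite divr_gt0 // mulr_gt0.
have kap1 : (0 < 1 / k.+1%:R :> R)%R by rewrite divr_gt0.
move: k2l; rewrite leq_eqVlt => /orP[/eqP kE|k2l]; last exact: short_scheme.
by move: kap0 kap1; rewrite kE; apply: double_scheme.
Qed.

(* Numerals in the theorem are those of [R_scope]. *)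
Bind Scope R_scope with R.

Theorem theorem2 :
  forall k l : nat, (2 <= k)%N -> (l <= k)%N -> (k <= 2 * l)%N ->
  exists Cst : R, Rlt 0 Cst /\
  forall p : nat -> R,
    (forall n, (l %| n)%N -> Rlt 0 (p n) /\ Rle (p n) 1) ->
    (forall M : R, exists N : nat, forall n : nat, (N <= n)%N -> (l %| n)%N ->
        Rle M (Rdiv (Rmult (INR n) (p n)) (pow (ln (INR n)) 2))) ->
    forall delta : R, Rlt 0 delta ->
    exists N : nat, forall n : nat, (N <= n)%N -> (l %| n)%N ->
      let eps := Rmult Cst (sqrt (Rdiv (ln (INR n)) (sqrt (Rmult (INR n) (p n))))) in
      let nu := Rdiv (INR n) (INR l) in
      let b := Rdiv (Rmult (Rmult (Rminus 1 eps) (INR 'C(n, k))) (p n)) nu in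
      Rle (Rminus 1 delta) (@prob_H n k (p n) (@has_disjoint_ham_cycles n k l b)).
Proof.
move=> k l k2 lk k2l.
have l0 : (0 < l)%N by case: l k2l lk => //; rewrite muln0 leqn0 => /eqP k0; rewrite k0 in k2.
have [Cst [Cst0 packing]] := scheme_packing l0 (packing_scheme k2 lk k2l); exists Cst; split; first exact/RltP.
move=> p p01 _ delta /RltP delta0.
have [|N hN] := packing p _ delta delta0.
  by move=> n /p01[/RltP ? /RleP ?].
exists N => n Nn ln eps nu b; apply/RleP; apply: (hN n Nn ln _ _ (erefl _)).
by rewrite /b /eps /nu /lnn -!INRE.
Qed.
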